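(* Let $f:\mathbb{D}\to\mathbb{D}$ be an analytic function. Then the following statements are equivalent. (a) $\displaystyle\angle\lim_{z\to\zeta}\left(1-|z|^2\right)\frac{|f'(z)|}{1-|f(z)|^2}=1$ for a.e. $\zeta\in\partial\mathbb{D}$. (b) $f$ is an inner function with finite angular derivative at almost every point of $\partial\mathbb{D}$.
   Context: $\mathbb{D}=\{z\in\mathbb{C}:|z|<1\}$. $\angle\lim_{z\to\zeta}$ denotes the nontangential (angular) limit at $\zeta\in\partial\mathbb{D}$. ''Almost every'' refers to Lebesgue measure on $\partial\mathbb{D}$. An inner function is an analytic $f:\mathbb{D}\to\mathbb{D}$ whose angular limits have modulus $1$ at a.e. point of $\partial\mathbb{D}$. An analytic $f:\mathbb{D}\to\mathbb{D}$ has a finite angular derivative at $\zeta\in\partial\mathbb{D}$ if for some $\omega\in\partial\mathbb{D}$ the angular limit $\angle\lim_{z\to\zeta}\frac{f(z)-\omega}{z-\zeta}$ exists and is finite. *)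

(* Defs.v *)
From HB Require Import structures.
From mathcomp Require Import all_boot all_order all_algebra.
From mathcomp Require Import all_classical all_reals all_analysis.
From mathcomp Require Import complex.

Set Implicit Arguments.
Unset Strict Implicit.
Unset Printing Implicit Defensive.

Import Order.TTheory GRing.Theory Num.Theory.
Import numFieldNormedType.Exports.

Local Open Scope classical_set_scope.
Local Open Scope ring_scope.
Local Open Scope complex_scope.

(* The library puts the topology and the normed-module structure on the alias
   [R[i]^o] of [R[i]], as the regular module over the field [R[i]]: derivatives
   below are complex derivatives.  The norm [`|z|] lies in [R[i]], whose order
   [x <= y] says that [y - x] is real and nonnegative. *)
Section AngularLimits.
Context {R : realType}.
Notation C := (R[i]^o).

Definition unit_disk : set C := [set z | `|z| < 1].

Definition unit_circle : set C := [set z | `|z| = 1].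

Definition analytic_on (D : set C) (f : C -> C) : Prop :=
  forall z : C, D z -> derivable f z 1.

Definition analytic_self_map (f : C -> C) : Prop :=
  analytic_on unit_disk f /\ (forall z, unit_disk z -> unit_disk (f z)).

Definition circle_point (t : R) : C := cos t +i* sin t.

(* The Lebesgue measure on the circle is the image of the Lebesgue measure on
   [0, 2 pi) under [circle_point]. *)
Definition ae_circle (P : C -> Prop) : Prop :=
  {ae @lebesgue_measure R, forall t : R,
    t \in `[0, 2 * pi[ -> P (circle_point t)}.

(* Nontangential approach region of aperture M at z0; it is empty for M <= 1. *)
Definition stolz_region (z0 : C) (M : R) : set C :=
  [set z | unit_disk z /\ `|z - z0| < M%:C * (1 - `|z|)].

Definition angular_limit (g : C -> C) (z0 l : C) : Prop :=
  forall M : R, 1 < M -> g z @[z --> within (stolz_region z0 M) (nbhs z0)] --> l.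

Definition inner_function (f : C -> C) : Prop :=
  analytic_self_map f /\
  ae_circle (fun z0 => exists2 l : C, unit_circle l & angular_limit f z0 l).

Definition has_finite_angular_derivative (f : C -> C) (z0 : C) : Prop :=
  exists2 w : C, unit_circle w &
    exists l : C, angular_limit (fun z => (f z - w) / (z - z0)) z0 l.

End AngularLimits.

(* Main.v *)
Require Import Defs.
From HB Require Import structures.
From mathcomp Require Import all_boot all_order all_algebra.
From mathcomp Require Import all_classical all_reals all_analysis.
From mathcomp Require Import complex ring lra.
Import Order.TTheory GRing.Theory Num.Theory.
Import numFieldNormedType.Exports.
Import ComplexField.Normc.
Local Open Scope classical_set_scope.
Local Open Scope ring_scope.
Local Open Scope complex_scope.
Set Implicit Arguments.
Unset Strict Implicit.
Unset Printing Implicit Defensive.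

(* If the distortion (1-|z|^2)|f'(z)|/(1-|f(z)|^2) tends to 1 at zeta, then either |f'|
   tends to infinity in a Stolz region at zeta, or (1-|f(z)|^2)/(1-|z|^2) stays bounded
   along some sequence tending to zeta. The latter is the hypothesis of the Julia-
   Caratheodory theorem, which gives a finite nonzero angular derivative at zeta, hence a
   unimodular angular limit of f and distortion tending to 1; conversely a finite angular
   derivative at zeta yields such a sequence. So it remains to see that the first
   alternative occurs only on a null set (Privalov). For g = f' blowing up on a set of
   positive measure, choose a density point x and a closed set K of almost full measure
   near x, above which |g| >= 1 at small heights and |g| >= N at height dl. A Blaschke
   product B with zeros above the gaps of K is bounded away from 1 on the sides of the
   sawtooth region over K, but close to 1 in modulus at a point z0 at fixed height above
   x. With (1+q)^m = N^2, the maximum principle for B^m/g bounds |g(z0)| below by a power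
   tending to infinity with m. *)

(** Privalov's theorem is classically proved by mapping the sawtooth region conformally and
    comparing harmonic measures. Here only lower bounds for |g| are at hand, so the maximum
    principle must act on 1/g, which is at most 1 on the region but small only on its bottom; the
    factor [B ^+ m] makes up for this on the other sides. The sum of the defects of the factors of B
    is a discretized Poisson integral of the gaps, at least q on those sides and at most q/2 at z0,
    so each power gains the factor (1 - q/2)(1 + q) > 1. The order of choices is essential: x, the
    scale rho and z0 precede m, whereas N, dl, K and the zeros of B depend on m. Since f is only
    assumed complex differentiable, the holomorphy of f' must be proved as well. Goursat's lemma
    gives local primitives, and their difference quotients have second order expansions; these yield
    a maximum principle, and from it Schwarz's lemma and Cauchy's estimates, without the Cauchy
    integral formula. *)

Section ComplexModulus.
Context {R : realType}.
Local Notation C := (R[i]^o).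
Local Notation Re := complex.Re.
Local Notation Im := complex.Im.
Implicit Types z w v : C.

Lemma normrC z : `|z| = (normc z)%:C. Proof. by []. Qed.

Lemma ReD z w : Re (z + w) = Re z + Re w. Proof. by case: z w => ? ? []. Qed.
Lemma ImD z w : Im (z + w) = Im z + Im w. Proof. by case: z w => ? ? []. Qed.
Lemma ReN z : Re (- z) = - Re z. Proof. by case: z. Qed.
Lemma ImN z : Im (- z) = - Im z. Proof. by case: z. Qed.
Lemma ReB z w : Re (z - w) = Re z - Re w. Proof. by rewrite ReD ReN. Qed.
Lemma ImB z w : Im (z - w) = Im z - Im w. Proof. by rewrite ImD ImN. Qed.
Lemma ReM z w : Re (z * w) = Re z * Re w - Im z * Im w.
Proof. by case: z w => ? ? []. Qed.
Lemma ImM z w : Im (z * w) = Re z * Im w + Im z * Re w.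
Proof. by case: z w => ? ? []. Qed.
Lemma ReJ z : Re z^* = Re z. Proof. by case: z. Qed.
Lemma ImJ z : Im z^* = - Im z. Proof. by case: z. Qed.
Lemma Re1 : Re (1 : C) = 1. Proof. by []. Qed.
Lemma Im1 : Im (1 : C) = 0. Proof. by []. Qed.
Lemma Re0 : Re (0 : C) = 0. Proof. by []. Qed.
Lemma Im0 : Im (0 : C) = 0. Proof. by []. Qed.
Lemma ReC (x : R) : Re x%:C = x. Proof. by []. Qed.
Lemma ImC (x : R) : Im x%:C = 0. Proof. by []. Qed.
Definition ReImE := (ReD, ImD, ReN, ImN, ReM, ImM, ReJ, ImJ, Re1, Im1, Re0, Im0, ReC, ImC).

Lemma eqC z w : Re z = Re w -> Im z = Im w -> z = w.
Proof. by case: z w => a b [c d] /= -> ->. Qed.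

Lemma sqr_normcE z : normc z ^+ 2 = Re z ^+ 2 + Im z ^+ 2.
Proof. by case: z => a b /=; rewrite sqr_sqrtr // addr_ge0 ?sqr_ge0. Qed.

Lemma normc_ge0 z : 0 <= normc z. Proof. by case: z => a b; exact: sqrtr_ge0. Qed.
Hint Resolve normc_ge0 : core.

Lemma normc_eq0 z : (normc z == 0) = (z == 0).
Proof. by apply/eqP/eqP => [/eq0_normc//|->]; exact: normc0. Qed.

Lemma normc_gt0 z : (0 < normc z) = (z != 0).
Proof. by rewrite lt_neqAle eq_sym normc_eq0 normc_ge0 andbT. Qed.

Lemma normcD z w : normc (z + w) <= normc z + normc w. Proof. exact: le_normcD. Qed.

Lemma normcBC z w : normc (z - w) = normc (w - z).
Proof. by rewrite -normcN opprB. Qed.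

Lemma normcB z w : normc (z - w) <= normc z + normc w.
Proof. by rewrite -(normcN w); exact: normcD. Qed.

Lemma normc_triangle v z w : normc (z - w) <= normc (z - v) + normc (v - w).
Proof. by rewrite -(subrKA v); exact: normcD. Qed.

Lemma normc_ler_sub z w : normc z - normc w <= normc (z - w).
Proof. by rewrite lerBlDr -{1}(subrK w z); exact: normcD. Qed.

Lemma normcX z n : normc (z ^+ n) = normc z ^+ n.
Proof. by elim: n => [|n IH]; rewrite ?expr0 ?normc1 // !exprS normcM IH. Qed.

Lemma normc_div z w : normc (z / w) = normc z / normc w.
Proof. by rewrite normcM normcV. Qed.

Lemma normcC (x : R) : normc x%:C = `|x|.
Proof. by rewrite /= expr0n addr0 sqrtr_sqr. Qed.

Lemma normc_conj z : normc z^* = normc z.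
Proof. by case: z => a b; rewrite /= sqrrN. Qed.

Lemma normc_nat n : normc (n%:R : C) = n%:R.
Proof.
have -> : (n%:R : C) = (n%:R : R)%:C by rewrite rmorph_nat.
by rewrite normcC ger0_norm.
Qed.

Lemma normc_Re z : `|Re z| <= normc z.
Proof.
rewrite -(@ler_pXn2r _ 2) ?nnegrE // sqr_normcE real_normK ?num_real //.
by rewrite lerDl sqr_ge0.
Qed.

Lemma normc_Im z : `|Im z| <= normc z.
Proof.
rewrite -(@ler_pXn2r _ 2) ?nnegrE // sqr_normcE real_normK ?num_real //.
by rewrite lerDr sqr_ge0.
Qed.

Lemma normc_ReIm z : normc z <= `|Re z| + `|Im z|.
Proof.
rewrite -(@ler_pXn2r _ 2) ?nnegrE ?addr_ge0 // sqr_normcE.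
rewrite -[Re z ^+ 2]real_normK ?num_real // -[Im z ^+ 2]real_normK ?num_real //.
have := mulr_ge0 (normr_ge0 (Re z)) (normr_ge0 (Im z)); nra.
Qed.

Lemma mulc_conj z : z * z^* = (normc z ^+ 2)%:C :> C.
Proof. by apply: eqC; rewrite !ReImE ?sqr_normcE; ring. Qed.

(** * Topology of the plane by real epsilons, and compactness *)

Lemma nbhsCP z (P : set C) :
  nbhs z P <-> exists2 e : R, 0 < e & forall w, normc (w - z) < e -> P w.
Proof.
split.
  move/nbhs_ballP => [e e0 h].
  move: e0; rewrite /= ltcE /= => /andP[/eqP ei er].
  exists (Re e) => // w hw; apply: h; rewrite -ball_normE /ball_ /=.
  by rewrite normrC ltcE /= ei eqxx /= normcBC.
move=> [e e0 h]; apply/nbhs_ballP; exists e%:C; first by rewrite /= ltcR.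
move=> w; rewrite -ball_normE /ball_ /= normrC ltcR normcBC; exact: h.
Qed.

Lemma continuousCP (f : C -> C) z : {for z, continuous f} <->
  forall e : R, 0 < e -> exists2 d : R, 0 < d &
    forall w, normc (w - z) < d -> normc (f w - f z) < e.
Proof.
split=> [fz e e0|h].
  have /fz : nbhs (f z) [set w | normc (w - f z) < e] by apply/nbhsCP; exists e.
  by move=> /nbhsCP[d d0 hd]; exists d.
move=> P /nbhsCP[e e0 hP]; have [d d0 hd] := h e e0.
by apply/nbhsCP; exists d => // w /hd /hP.
Qed.

(** Compactness of a square gives a cluster point; speaking of arbitrarily late terms avoids the
    extraction of a subsequence. *)
Lemma bolzano_weierstrass (u : nat -> C) (M : R) : (forall n, normc (u n) <= M) ->
  exists p : C, forall (e : R) N, 0 < e -> exists2 n, (N <= n)%N & normc (u n - p) < e.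
Proof.
move=> uM.
have cK : compact ([set` `[(- M), M]] `*` [set` `[(- M), M]] : set (R * R)).
  by apply: compact_setX; exact: segment_compact.
have [|[a b] [_ hc]] := cK ((fun n => (Re (u n), Im (u n))) @ \oo) _.
  exists 0%N => // n _ /=; rewrite !in_itv /= -!ler_norml.
  by rewrite !(le_trans _ (uM n)) ?normc_Re ?normc_Im.
exists (a +i* b) => e N e0.
have e20 : 0 < e / 2 by rewrite divr_gt0.
have [] := hc [set x | exists2 n, (N <= n)%N & x = (Re (u n), Im (u n))]
    (ball (a, b) (e / 2)).
- by exists N => // n Nn; exists n.
- exact: nbhsx_ballx.
move=> [x y] [[n Nn [-> ->]]] [/= h1 h2]; exists n => //.
move: h1 h2; rewrite -!ball_normE /ball_ /= => h1 h2.
apply: le_lt_trans (normc_ReIm _) _.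
by rewrite !ReB !ImB /= distrC [X in _ + X]distrC; lra.
Qed.

Definition csequentially_closed (X : set C) := forall p : C,
  (forall e : R, 0 < e -> exists2 w, X w & normc (w - p) < e) -> X p.

Definition cont_at (u : C -> R) z := forall e : R, 0 < e ->
  exists2 d : R, 0 < d & forall w, normc (w - z) < d -> `|u w - u z| < e.

(** Bolzano-Weierstrass twice: a cluster point of points with [n < u z] contradicts continuity, so
    the supremum is finite, and a cluster point of a maximizing sequence attains it. *)
Lemma max_attained (X : set C) (M : R) (u : C -> R) :
  csequentially_closed X -> (forall z, X z -> normc z <= M) -> X !=set0 ->
  (forall z, X z -> cont_at u z) ->
  exists2 p, X p & forall z, X z -> u z <= u p.
Proof.
move=> Xc XM [x0 Xx0] ucont.
pose S := [set u z | z in X].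
have ubS : has_ubound S.
  apply: contrapT => nub.
  have /choice[s hs] : forall n : nat, exists z, X z /\ n%:R < u z.
    move=> n; apply: contrapT => h; apply: nub; exists n%:R => _ [z Xz <-].
    by rewrite leNgt; apply/negP => h'; apply: h; exists z.
  have [p hp] := bolzano_weierstrass (fun n => XM _ (hs n).1).
  have Xp : X p.
    by apply: Xc => e e0; have [n _ hn] := hp e 0%N e0; exists (s n) => //; exact: (hs n).1.
  have [d d0 hd] := ucont p Xp 1 ltr01.
  have [n Nn /hd] := hp d (Num.truncn (`|u p| + 1)).+1 d0.
  have := hs n; rewrite ltr_norml => -[_ h1] /andP[_ h2].
  have h3 : `|u p| + 1 < n%:R.
    have h := truncnS_gt (`|u p| + 1); apply: (lt_le_trans h).
    by rewrite ler_nat.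
  by have := ler_norm (u p); lra.
have nS : S !=set0 by exists (u x0), x0.
have /choice[s hs] : forall n : nat, exists z, X z /\ sup S - n.+1%:R^-1 < u z.
  move=> n; have n0 : 0 < n.+1%:R^-1 :> R by rewrite invr_gt0.
  by have [_ [z Xz <-] h] := sup_adherent n0 (conj nS ubS); exists z.
have [p hp] := bolzano_weierstrass (fun n => XM _ (hs n).1).
have Xp : X p.
  by apply: Xc => e e0; have [n _ hn] := hp e 0%N e0; exists (s n) => //; exact: (hs n).1.
exists p => // z Xz; apply: (@le_trans _ _ (sup S)); first by apply: ub_le_sup => //; exists z.
suff h : forall e : R, 0 < e -> sup S <= u p + e by apply/ler_addgt0Pr.
move=> e e0; have e20 : 0 < e / 2 by rewrite divr_gt0.
have [d d0 hd] := ucont p Xp _ e20.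
have [n Nn /hd] := hp d (Num.truncn ((e / 2)^-1)).+1 d0.
rewrite ltr_norml => /andP[_ h2]; have [_ h1] := hs n.
suff : n.+1%:R^-1 < e / 2 by move: h1; set q := n.+1%:R^-1; lra.
rewrite invf_plt ?posrE // (lt_trans (truncnS_gt _)) // ltr_nat.
exact: leq_trans Nn _.
Qed.

End ComplexModulus.
#[export] Hint Resolve normc_ge0 : core.

(** * Calculus of complex derivatives; compactness of closed disks *)

Section ComplexDerivative.
Context {R : realType}.
Local Notation C := (R[i]^o).
Implicit Types (z w v l m : C) (f g : C -> C).

(* An inductive wrapper: the products hidden in [{for z, continuous f}] would
   otherwise be explored by unification. *)
Variant ccont f z : Prop := Ccont of {for z, continuous f}.

Lemma ccontP f z : ccont f z <->
  forall e : R, 0 < e -> exists2 d : R, 0 < d &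
    forall w, normc (w - z) < d -> normc (f w - f z) < e.
Proof. by split=> [[/continuousCP//]|/continuousCP]. Qed.

Lemma ccont_id z : ccont id z. Proof. by split; exact: cvg_id. Qed.
Lemma ccont_cst (c : C) z : ccont (fun=> c) z. Proof. by split; exact: cst_continuous. Qed.
Lemma ccontD f g z : ccont f z -> ccont g z -> ccont (fun w => f w + g w) z.
Proof. by move=> [fc] [gc]; split; exact: (@continuousD _ C C f g z fc gc). Qed.
Lemma ccontM f g z : ccont f z -> ccont g z -> ccont (fun w => f w * g w) z.
Proof. by move=> [fc] [gc]; split; exact: (@continuousM _ C f g z fc gc). Qed.
Lemma ccontN f z : ccont f z -> ccont (fun w => - f w) z.
Proof. by move=> [fc]; split; exact: (@continuousN _ C C f z fc). Qed.
Lemma ccontB f g z : ccont f z -> ccont g z -> ccont (fun w => f w - g w) z.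
Proof. by move=> fc /ccontN; exact: ccontD. Qed.
Lemma ccontV f z : f z != 0 -> ccont f z -> ccont (fun w => (f w)^-1) z.
Proof. by move=> f0 [fc]; split; exact: (@continuousV _ C f z f0 fc). Qed.
Lemma ccont_comp f g z : ccont g z -> ccont f (g z) -> ccont (fun w => f (g w)) z.
Proof. by move=> [gc] [fc]; split; exact: (@continuous_comp C C C g f z gc fc). Qed.

(* Caratheodory's form of complex differentiability at a point, which turns the
   rules of calculus into algebra. *)
Definition cdiff f z l := exists2 phi : C -> C,
  (forall w, f w - f z = phi w * (w - z)) & phi z = l /\ ccont phi z.

Lemma cdiffP f z l : cdiff f z l <->
  forall e : R, 0 < e -> exists2 d : R, 0 < d & forall w, normc (w - z) < d ->
    normc (f w - f z - l * (w - z)) <= e * normc (w - z).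
Proof.
split=> [[phi fE [phiz /ccontP phic]] e e0|h].
  have [d d0 hd] := phic e e0; exists d => // w /hd /ltW hw.
  by rewrite fE -phiz -mulrBl normcM ler_wpM2r.
exists (fun w => if w == z then l else (f w - f z) / (w - z)).
  by move=> w; case: eqP => [->|/eqP wz]; rewrite ?subrr ?mulr0 // divfK ?subr_eq0.
split; first by rewrite eqxx.
apply/ccontP => e e0; have [d d0 hd] := h (e / 2) (divr_gt0 e0 (ltr0Sn _ _)).
exists d => // w /hd; rewrite eqxx; case: eqP => [->|/eqP wz] H.
  by rewrite subrr normc0.
have wz0 : w - z != 0 by rewrite subr_eq0.
have -> : (f w - f z) / (w - z) - l = (f w - f z - l * (w - z)) / (w - z).
  by field.
rewrite normc_div ltr_pdivrMr ?normc_gt0 //; apply: (le_lt_trans H).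
by rewrite ltr_pM2r ?normc_gt0 // ltr_pdivrMr // ltr_pMr // ltr1n.
Qed.

Lemma cdiff_cont f z l : cdiff f z l -> ccont f z.
Proof.
move=> [phi fE [_ phic]].
have -> : f = (fun w => phi w * (w - z) + f z) by apply/funext => w; rewrite -fE subrK.
apply: ccontD; last exact: ccont_cst.
by apply: ccontM => //; apply: ccontB; [exact: ccont_id|exact: ccont_cst].
Qed.

Lemma cdiff_near (d : R) g f z l : 0 < d -> (forall w, normc (w - z) < d -> f w = g w) ->
  cdiff f z l -> cdiff g z l.
Proof.
move=> d0 fg /cdiffP h; apply/cdiffP => e /h[d' d'0 hd'].
exists (Num.min d d'); first by rewrite lt_min d0.
move=> w; rewrite lt_min => /andP[h1 h2]; rewrite -!fg ?hd' ?subrr ?normc0 //.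
Qed.

Lemma cdiff_cst (c : C) z : cdiff (fun=> c) z 0.
Proof.
by exists (fun=> 0) => [w|]; [rewrite subrr mul0r|split=> //; exact: ccont_cst].
Qed.

Lemma cdiff_id z : cdiff id z 1.
Proof.
by exists (fun=> 1) => [w|]; [rewrite mul1r|split=> //; exact: ccont_cst].
Qed.

Lemma cdiffD f g z l m : cdiff f z l -> cdiff g z m -> cdiff (fun w => f w + g w) z (l + m).
Proof.
move=> [phi fE [phiz phic]] [psi gE [psiz psic]]; exists (fun w => phi w + psi w).
  by move=> w; rewrite mulrDl -fE -gE; ring.
by split; [rewrite phiz psiz|exact: ccontD].
Qed.

Lemma cdiffM f g z l m : cdiff f z l -> cdiff g z m ->
  cdiff (fun w => f w * g w) z (l * g z + f z * m).
Proof.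
move=> df dg; have gc := cdiff_cont dg.
move: df dg => [phi fE [phiz phic]] [psi gE [psiz psic]].
exists (fun w => phi w * g w + f z * psi w).
  move=> w; rewrite mulrDl -mulrA -[f z * _ * _]mulrA -gE.
  by rewrite mulrCA -[phi w * _]/(phi w * _) -fE; ring.
split; first by rewrite phiz psiz.
apply: ccontD; apply: ccontM => //; exact: ccont_cst.
Qed.

Lemma cdiff_comp f g z l m : cdiff g z m -> cdiff f (g z) l ->
  cdiff (fun w => f (g w)) z (l * m).
Proof.
move=> dg df; have gc := cdiff_cont dg.
move: df dg => [phi fE [phiz phic]] [psi gE [psiz psic]].
exists (fun w => phi (g w) * psi w).
  by move=> w; rewrite -mulrA -gE -fE.
split; first by rewrite phiz psiz.
apply: ccontM => //; exact: ccont_comp.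
Qed.

Lemma cdiff_inv z : z != 0 -> cdiff (fun w => w^-1) z (- (z ^+ 2)^-1).
Proof.
(* Caratheodory's factorization is required at every w, including 0 where the inverse takes a
   conventional value. There the inverse is replaced by the value 2/z of its tangent line at z, a
   change outside the disk of radius |z| about z. *)
move=> z0; apply: (@cdiff_near (normc z) (fun w => w^-1)
   (fun w => if w == 0 then z^-1 + z^-1 else w^-1)); first by rewrite normc_gt0.
  move=> w; case: eqP => // ->; rewrite sub0r normcN ltxx => //.
exists (fun w => if w == 0 then (z ^+ 2)^-1 * (-1) else - (z * w)^-1).
  move=> w; rewrite (negbTE z0); case: eqP => [->|/eqP w0]; field => //.
  by rewrite w0 z0.
rewrite (negbTE z0); split; first by rewrite expr2.
have h : ccont (fun w => - (z * w)^-1) z.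
  apply: ccontN; apply: ccontV; first by rewrite mulf_neq0.
  by apply: ccontM; [exact: ccont_cst|exact: ccont_id].
move/ccontP : h => h; apply/ccontP => e /h[d d0 hd].
exists (Num.min d (normc z)); first by rewrite lt_min d0 normc_gt0.
move=> w; rewrite lt_min (negbTE z0) => /andP[/hd h1].
by case: eqP => // ->; rewrite sub0r normcN ltxx.
Qed.

Lemma cdiffV f z l : f z != 0 -> cdiff f z l ->
  cdiff (fun w => (f w)^-1) z (- (f z ^+ 2)^-1 * l).
Proof. by move=> fz df; apply: cdiff_comp df _; exact: cdiff_inv. Qed.

Definition cderivable f z := exists l, cdiff f z l.

Lemma cderivable_cst c z : cderivable (fun=> c) z.
Proof. by exists 0; exact: cdiff_cst. Qed.
Lemma cderivable_id z : cderivable id z.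
Proof. by exists 1; exact: cdiff_id. Qed.
Lemma cderivableD f g z : cderivable f z -> cderivable g z -> cderivable (fun w => f w + g w) z.
Proof. by move=> [l ?] [m ?]; exists (l + m); exact: cdiffD. Qed.
Lemma cderivableM f g z : cderivable f z -> cderivable g z -> cderivable (fun w => f w * g w) z.
Proof. by move=> [l df] [m dg]; exact: (ex_intro _ _ (cdiffM df dg)). Qed.
Lemma cderivableN f z : cderivable f z -> cderivable (fun w => - f w) z.
Proof.
move=> [l h]; exists (0 * f z + (-1) * l); have := cdiffM (cdiff_cst (-1) z) h.
by under eq_fun do rewrite mulN1r.
Qed.
Lemma cderivableB f g z : cderivable f z -> cderivable g z -> cderivable (fun w => f w - g w) z.
Proof. by move=> ? ?; apply: cderivableD => //; exact: cderivableN. Qed.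
Lemma cderivableV f z : f z != 0 -> cderivable f z -> cderivable (fun w => (f w)^-1) z.
Proof. by move=> f0 [l df]; exact: (ex_intro _ _ (cdiffV f0 df)). Qed.
Lemma cderivable_div f g z : g z != 0 -> cderivable f z -> cderivable g z ->
  cderivable (fun w => f w / g w) z.
Proof. by move=> ? ? ?; apply: cderivableM => //; exact: cderivableV. Qed.
Lemma cderivable_comp f g z : cderivable g z -> cderivable f (g z) ->
  cderivable (fun w => f (g w)) z.
Proof. by move=> [l dg] [m df]; exact: (ex_intro _ _ (cdiff_comp dg df)). Qed.
Lemma cderivableX f z n : cderivable f z -> cderivable (fun w => f w ^+ n) z.
Proof.
move=> fz; elim: n => [|n IH]; first by under eq_fun do rewrite expr0; exact: cderivable_cst.
by under eq_fun do rewrite exprS; exact: cderivableM.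
Qed.
Lemma cderivable_prod (I : Type) (s : seq I) (P : pred I) (F : I -> C -> C) z :
  (forall i, P i -> cderivable (F i) z) ->
  cderivable (fun w => \prod_(i <- s | P i) F i w) z.
Proof.
move=> h; elim: s => [|i s IH]; first by under eq_fun do rewrite big_nil; exact: cderivable_cst.
under eq_fun do rewrite big_cons.
by case: (boolP (P i)) => // /h Fi; exact: cderivableM.
Qed.
Lemma dnbhsCP z (P : set C) :
  z^' P <-> exists2 e : R, 0 < e & forall w, w != z -> normc (w - z) < e -> P w.
Proof.
split=> [/nbhsCP[e e0 h]|[e e0 h]]; first by exists e => // w wz ?; apply: h.
by apply/nbhsCP; exists e => // w we /eqP wz; apply: h => //; apply/eqP.
Qed.

Lemma cdiff_cvg f z l : cdiff f z l <-> h^-1 *: (f (h + z) - f z) @[h --> (0 : C)^'] --> (l : C).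
Proof.
split=> [/cdiffP df P /nbhsCP[e e0 hP]|h].
  have [d d0 hd] := df (e / 2) (divr_gt0 e0 (ltr0Sn _ _)).
  apply/dnbhsCP; exists d => // h h0; rewrite subr0 => hh; apply: hP.
  have := hd (h + z); rewrite addrK => /(_ hh) H.
  have -> : h^-1 *: (f (h + z) - f z) - l = (f (h + z) - f z - l * h) / h.
    by rewrite /GRing.scale /=; field.
  rewrite normc_div ltr_pdivrMr ?normc_gt0 //; apply: (le_lt_trans H).
  by rewrite ltr_pM2r ?normc_gt0 // ltr_pdivrMr // ltr_pMr // ltr1n.
apply/cdiffP => e e0.
have /h /dnbhsCP[d d0 hd] : nbhs l [set w : C | normc (w - l) < e] by apply/nbhsCP; exists e.
exists d => // w wd; have [->|wz] := eqVneq w z; first by rewrite !subrr mulr0 subrr normc0 mulr0.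
have wz0 : w - z != 0 by rewrite subr_eq0.
have := hd (w - z) wz0; rewrite subr0 => /(_ wd) /=; rewrite subrK => H.
have -> : f w - f z - l * (w - z) = ((w - z)^-1 *: (f w - f z) - l) * (w - z).
  by rewrite /GRing.scale /=; field.
by rewrite normcM ler_wpM2r // ltW.
Qed.

Lemma derivable_cvgE f z : derivable f z 1 <-> cvg (h^-1 *: (f (h + z) - f z) @[h --> (0 : C)^']).
Proof.
rewrite /derivable.
suff -> : (fun h : C => h^-1 *: ((f \o shift z) (h *: (1 : C)) - f z)) =
  (fun h : C => h^-1 *: (f (h + z) - f z)) by [].
by apply/funext => h; rewrite /= /GRing.scale /= mulr1.
Qed.

Lemma cdiff_derive1 f z l : cdiff f z l -> derive1 f z = l.
Proof. by move/cdiff_cvg => h; exact: (cvg_lim _ h). Qed.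

Lemma derivable_cdiff f z : derivable f z 1 -> cdiff f z (derive1 f z).
Proof. by move/derivable_cvgE => h; apply/cdiff_cvg. Qed.

Lemma cderivable_cdiff f z : cderivable f z -> cdiff f z (derive1 f z).
Proof. by move=> [l h]; rewrite (cdiff_derive1 h). Qed.

Lemma cont_at_normc f z : ccont f z -> cont_at (fun w => normc (f w)) z.
Proof.
move/ccontP => h e /h[d d0 hd]; exists d => // w /hd; apply: le_lt_trans.
rewrite ler_norml normc_ler_sub andbT lerNl opprB normcBC; exact: normc_ler_sub.
Qed.

Definition cball (c : C) (r : R) : set C := [set z | normc (z - c) <= r].

Lemma cball_closed c (r : R) : csequentially_closed (cball c r).
Proof.
move=> p h; rewrite /cball /=; apply/ler_addgt0Pr => e /h[w wc wp].
by rewrite (le_trans (normc_triangle w _ _)) // normcBC addrC lerD // ltW.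
Qed.

Lemma cball_bounded c (r : R) z : cball c r z -> normc z <= r + normc c.
Proof. by move=> h; rewrite -(subrK c z); apply: le_trans (normcD _ _) _; rewrite lerD2r. Qed.

Lemma cball_center c (r : R) : 0 <= r -> cball c r c.
Proof. by rewrite /cball /= subrr normc0. Qed.

Lemma bounded_on_cball f c (r : R) : 0 <= r -> (forall z, cball c r z -> ccont f z) ->
  exists2 M : R, 0 < M & forall z, cball c r z -> normc (f z) <= M.
Proof.
move=> r0 fc.
have [|p _ hp] := max_attained (@cball_closed c r) (@cball_bounded c r)
  (u := fun z => normc (f z)) (ex_intro _ c (cball_center _ r0)).
  by move=> z /fc /cont_at_normc.
exists (normc (f p) + 1); first by have := normc_ge0 (f p); lra.
by move=> z /hp; lra.
Qed.

Lemma heine f c (r e : R) : (forall z, cball c r z -> ccont f z) -> 0 < e ->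
  exists2 d : R, 0 < d & forall z w, cball c r z -> cball c r w -> normc (z - w) < d ->
    normc (f z - f w) < e.
Proof.
move=> fc e0; apply: contrapT => hn.
have /choice[u hu] : forall n : nat, exists zw : C * C,
    [/\ cball c r zw.1, cball c r zw.2, normc (zw.1 - zw.2) < n.+1%:R^-1
      & e <= normc (f zw.1 - f zw.2)].
  move=> n; apply: contrapT => h; apply: hn; exists n.+1%:R^-1; first by rewrite invr_gt0.
  move=> z w zc wc zw; rewrite ltNge; apply/negP => H; apply: h; by exists (z, w).
have hu1 n : normc (u n).1 <= r + normc c by have [/cball_bounded] := hu n.
have [p hp] := bolzano_weierstrass hu1.
have pc : cball c r p.
  by apply: cball_closed => d /(hp _ 0%N)[n _ hn']; exists (u n).1 => //; have [] := hu n.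
have [d d0 hd] := (ccontP _ _).1 (fc p pc) _ (divr_gt0 e0 (ltr0Sn _ 1)).
have d20 : 0 < d / 2 by rewrite divr_gt0.
have [n nN hn'] := hp (d / 2) (Num.truncn ((d / 2)^-1)) d20.
have [_ _ h1 h2] := hu n.
have h3 : n.+1%:R^-1 <= d / 2.
  rewrite invf_ple ?posrE //; apply: (le_trans (ltW (truncnS_gt _))).
  by rewrite ler_nat ltnS.
have /hd H1 : normc ((u n).1 - p) < d by apply: lt_le_trans hn' _; lra.
have /hd H2 : normc ((u n).2 - p) < d.
  apply: le_lt_trans (normc_triangle (u n).1 _ _) _.
  by rewrite normcBC; move: h1 h3 hn'; set q := _^-1; lra.
have := normc_triangle (f p) (f (u n).1) (f (u n).2).
by rewrite (normcBC (f p)); lra.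
Qed.

Lemma cauchy_seq_cvg (u : nat -> C) :
  (forall e : R, 0 < e -> exists N, forall i j, (N <= i)%N -> (N <= j)%N -> normc (u i - u j) <= e) ->
  exists l, forall e : R, 0 < e -> exists N, forall n, (N <= n)%N -> normc (u n - l) <= e.
Proof.
move=> hC; have [N0 hN0] := hC 1 ltr01.
have h1 n : normc (u (N0 + n)%N) <= normc (u N0) + 1.
  rewrite -(subrK (u N0) (u (N0 + n)%N)) addrC.
  by apply: le_trans (normcD _ _) _; rewrite lerD2l hN0 // leq_addr.
have [l hl] := bolzano_weierstrass h1.
exists l => e e0; have e20 : 0 < e / 2 by rewrite divr_gt0.
have [N hN] := hC _ e20; exists N => n Nn.
have [k kN hk] := hl _ N e20.
apply: le_trans (normc_triangle (u (N0 + k)%N) _ _) _.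
have := hN n (N0 + k)%N Nn (leq_trans kN (leq_addl _ _)); lra.
Qed.

End ComplexDerivative.

(** * Integrals along segments as limits of trapezoidal sums *)

Section PathIntegral.
Context {R : realType}.
Local Notation C := (R[i]^o).
Implicit Types (x y z w a b c p : C) (f : C -> C) (r e : R).

(** Segments are only ever subdivided at midpoints, so this is the form of convexity that the
    estimates call for. *)
Definition midconvex (P : set C) := forall a b, P a -> P b -> P ((a + b) / 2).

Lemma normc_half z : normc (z / 2) = normc z / 2.
Proof. by rewrite normc_div normc_nat. Qed.

Lemma midl a b : (a + b) / 2 - a = (b - a) / 2. Proof. by field. Qed.
Lemma midr a b : b - (a + b) / 2 = (b - a) / 2. Proof. by field. Qed.

Lemma cball_midconvex c r : midconvex (cball c r).
Proof.
move=> a b; rewrite /cball /= => ac bc.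
have -> : (a + b) / 2 - c = ((a - c) + (b - c)) / 2 by field.
by rewrite normc_half; have := normcD (a - c) (b - c); lra.
Qed.

Lemma midconvexI (P Q : set C) : midconvex P -> midconvex Q -> midconvex (P `&` Q).
Proof. by move=> hP hQ a b [Pa Qa] [Pb Qb]; split; [exact: hP|exact: hQ]. Qed.

Lemma normc_le_eps0 z : (forall e, 0 < e -> normc z <= e) -> z = 0.
Proof.
move=> h; apply/eqP; rewrite -normc_eq0 eq_le normc_ge0 andbT.
by apply/ler_addgt0Pr => e e0; rewrite add0r; exact: h.
Qed.

(** The trapezoidal sum over 2^n equal pieces. Recursion at the midpoint makes additivity there
    immediate, and averaging the endpoint values makes the sum exact on affine functions. *)
Fixpoint trap f (n : nat) a b : C :=
  if n is n'.+1 then trap f n' a ((a + b) / 2) + trap f n' ((a + b) / 2) b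
  else (f a + f b) / 2 * (b - a).

Lemma trap_antisym f n a b : trap f n b a = - trap f n a b.
Proof.
elim: n a b => [|n IH] a b /=; first by ring.
by rewrite [b + a]addrC (IH ((a + b) / 2) b) (IH a) opprD [LHS]addrC.
Qed.

(** Since the rule is exact on affine functions, only the deviation of f from its affine
    approximation contributes. *)
Lemma trap_est f (P : set C) (al be : C) e n a b : midconvex P -> P a -> P b ->
  (forall z, P z -> normc (f z - (al * z + be)) <= e) ->
  normc (trap f n a b - (al * ((a + b) / 2) + be) * (b - a)) <= e * normc (b - a).
Proof.
move=> mP Pa Pb h; elim: n a b Pa Pb => [|n IH] a b Pa Pb /=.
  have -> : (f a + f b) / 2 * (b - a) - (al * ((a + b) / 2) + be) * (b - a) =
    ((f a - (al * a + be)) + (f b - (al * b + be))) / 2 * (b - a) by field.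
  rewrite normcM ler_wpM2r // normc_half.
  have := normcD (f a - (al * a + be)) (f b - (al * b + be)).
  by have := h _ Pa; have := h _ Pb; lra.
set m := (a + b) / 2; have Pm : P m by exact: mP.
have := IH _ _ Pa Pm; have := IH _ _ Pm Pb.
rewrite /m midl midr -/m !normc_half => h1 h2.
set u := (X in normc X).
have -> : u = (trap f n a m - (al * ((a + m) / 2) + be) * ((b - a) / 2)) +
   (trap f n m b - (al * ((m + b) / 2) + be) * ((b - a) / 2)).
  by rewrite /u /m; field.
by apply: le_trans (normcD _ _) _; lra.
Qed.

(** After n halvings the pieces are shorter than d. On such a piece both sums are within
    [e * normc (b - a)] of f a (b - a), by [trap_est] with a constant approximation; hence the
    factor 2. *)
Lemma trap_close f c r e (d : R) : 0 < d ->
  (forall z w, cball c r z -> cball c r w -> normc (z - w) < d -> normc (f z - f w) < e) ->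
  forall n k a b, cball c r a -> cball c r b -> normc (b - a) < d * 2 ^+ n ->
  normc (trap f (n + k) a b - trap f n a b) <= 2 * e * normc (b - a).
Proof.
move=> d0 h; elim=> [|n IH] k a b ca cb.
  rewrite expr0 mulr1 => ab.
  have mP := midconvexI (cball_midconvex (c := c) (r := r))
     (cball_midconvex (c := a) (r := normc (b - a))).
  have Pa : (cball c r `&` cball a (normc (b - a))) a.
    by split; [exact: ca|rewrite /cball /= subrr normc0 normc_ge0].
  have Pb : (cball c r `&` cball a (normc (b - a))) b by split=> //; rewrite /cball /=.
  have hP z : (cball c r `&` cball a (normc (b - a))) z -> normc (f z - (0 * z + f a)) <= e.
    move=> [cz az]; rewrite mul0r add0r ltW // h //; exact: le_lt_trans ab.
  have h1 := trap_est (0 + k) mP Pa Pb hP.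
  have h2 := trap_est 0 mP Pa Pb hP.
  apply: le_trans (normc_triangle ((0 * ((a + b) / 2) + f a) * (b - a)) _ _) _.
  by rewrite [X in _ + X]normcBC; lra.
rewrite exprS => ab; rewrite addSn.
set m := (a + b) / 2; have cm : cball c r m by exact: cball_midconvex.
have := IH k _ _ ca cm; have := IH k _ _ cm cb.
rewrite /m midl midr -/m !normc_half => h1 h2.
have ab2 : normc (b - a) / 2 < d * 2 ^+ n by move: ab; set q := 2 ^+ n; lra.
have {h1} h1 := h1 ab2; have {h2} h2 := h2 ab2.
change (normc (trap f (n + k) a m + trap f (n + k) m b - (trap f n a m + trap f n m b))
  <= 2 * e * normc (b - a)).
have -> : trap f (n + k) a m + trap f (n + k) m b - (trap f n a m + trap f n m b) =
  (trap f (n + k) a m - trap f n a m) + (trap f (n + k) m b - trap f n m b) by ring.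
by apply: le_trans (normcD _ _) _; lra.
Qed.

Lemma lt_pow2 (x : R) : exists n, x < 2 ^+ n.
Proof.
exists (Num.truncn `|x|).+1; apply: le_lt_trans (ler_norm x) _.
apply: lt_le_trans (truncnS_gt _) _; rewrite -natrX ler_nat.
exact: ltnW (ltn_expl _ _).
Qed.

Lemma trap_cvg f c r a b : (forall z, cball c r z -> ccont f z) ->
  cball c r a -> cball c r b ->
  exists l : C, forall e, 0 < e -> exists N, forall n, (N <= n)%N -> normc (trap f n a b - l) <= e.
Proof.
move=> fc ca cb; apply: cauchy_seq_cvg => e e0.
(* Chosen so that 2 e' |b - a| <= e/2; the summand 1 covers the case a = b. *)
pose e' := e / (4 * (normc (b - a) + 1)).
have ab0 : 0 < normc (b - a) + 1 by have := normc_ge0 (b - a); lra.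
have e'0 : 0 < e' by rewrite divr_gt0 // mulr_gt0.
have [d d0 hd] := heine fc e'0.
have [N hN] := lt_pow2 (normc (b - a) / d).
have {}hN : normc (b - a) < d * 2 ^+ N by rewrite mulrC -ltr_pdivrMr.
have H k : normc (trap f (N + k) a b - trap f N a b) <= e / 2.
  apply: le_trans (trap_close d0 hd k ca cb hN) _.
  rewrite /e' -subr_ge0.
  have -> : e / 2 - 2 * (e / (4 * (normc (b - a) + 1))) * normc (b - a) =
    e / (2 * (normc (b - a) + 1)) by field; rewrite gt_eqF.
  by rewrite divr_ge0 ?mulr_ge0 // ltW.
exists N => i j Ni Nj; have := H (i - N)%N; have := H (j - N)%N; rewrite !subnKC // => h1 h2.
apply: le_trans (normc_triangle (trap f N a b) _ _) _.
by rewrite [X in _ + X]normcBC; lra.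
Qed.

(* [I a b] is the integral of [f] along the segment from [a] to [b], the limit of the
   trapezoidal sums [trap f n a b].  The third property suffices for Goursat's lemma: an
   affine function integrates to its value at the midpoint times [b - a]. *)
Definition path_integral f c r (I : C -> C -> C) := [/\
  forall a b, cball c r a -> cball c r b -> I b a = - I a b,
  forall a b, cball c r a -> cball c r b -> I a b = I a ((a + b) / 2) + I ((a + b) / 2) b &
  forall (P : set C) (al be : C) e a b, midconvex P -> P `<=` cball c r -> P a -> P b ->
  (forall z, P z -> normc (f z - (al * z + be)) <= e) ->
  normc (I a b - (al * ((a + b) / 2) + be) * (b - a)) <= e * normc (b - a)].

Lemma path_integral_exists f c r : (forall z, cball c r z -> ccont f z) ->
  exists I, path_integral f c r I.
Proof.
move=> fc.
have /choice[I hI] : forall ab : C * C, exists l : C, cball c r ab.1 -> cball c r ab.2 ->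
    forall e, 0 < e -> exists N, forall n, (N <= n)%N -> normc (trap f n ab.1 ab.2 - l) <= e.
  move=> [a b]; have [ca|nca] := pselect (cball c r a); last by exists 0.
  have [cb|ncb] := pselect (cball c r b); last by exists 0.
  by have [l hl] := trap_cvg fc ca cb; exists l.
have {}hI a b : cball c r a -> cball c r b -> forall e, 0 < e ->
   exists N, forall n, (N <= n)%N -> normc (trap f n a b - I (a, b)) <= e.
  by move=> ca cb; exact: (hI (a, b)).
exists (fun a b => I (a, b)); split.
- move=> a b ca cb; apply/eqP; rewrite -addr_eq0; apply/eqP/normc_le_eps0 => e e0.
  have e20 : 0 < e / 2 by lra.
  have [N hN] := hI _ _ ca cb _ e20; have [N' hN'] := hI _ _ cb ca _ e20.
  have := hN _ (leq_maxl N N'); have := hN' _ (leq_maxr N N').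
  rewrite (trap_antisym f _ a b); set t := trap _ _ _ _ => h1 h2.
  have -> : I (b, a) + I (a, b) = - ((- t - I (b, a)) + (t - I (a, b))) by ring.
  by rewrite normcN; apply: le_trans (normcD _ _) _; lra.
- move=> a b ca cb; apply/eqP; rewrite -subr_eq0; apply/eqP/normc_le_eps0 => e e0.
  have cm : cball c r ((a + b) / 2) by exact: cball_midconvex.
  have e20 : 0 < e / 3 by lra.
  have [N hN] := hI _ _ ca cb _ e20; have [N1 hN1] := hI _ _ ca cm _ e20.
  have [N2 hN2] := hI _ _ cm cb _ e20; pose n := maxn N (maxn N1 N2).
  have := hN n.+1 (leqW (leq_maxl _ _)).
  have := hN1 n (leq_trans (leq_maxl _ _) (leq_maxr _ _)).
  have := hN2 n (leq_trans (leq_maxr _ _) (leq_maxr _ _)).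
  rewrite /=; set t1 := trap _ _ a _; set t2 := trap _ _ _ b => h2 h1 h.
  have -> : I (a, b) - (I (a, (a + b) / 2) + I ((a + b) / 2, b)) =
    (t1 - I (a, (a + b) / 2)) + (t2 - I ((a + b) / 2, b)) - (t1 + t2 - I (a, b)) by ring.
  apply: le_trans (normcB _ _) _.
  by have := normcD (t1 - I (a, (a + b) / 2)) (t2 - I ((a + b) / 2, b)); lra.
move=> P al be e a b mP Pc Pa Pb hP.
suff H : forall d, 0 < d ->
  normc (I (a, b) - (al * ((a + b) / 2) + be) * (b - a)) <= e * normc (b - a) + d.
  by apply/ler_addgt0Pr.
move=> d d0; have [N hN] := hI _ _ (Pc _ Pa) (Pc _ Pb) _ d0.
have := hN _ (leqnn N); have := trap_est N mP Pa Pb hP => h1 h2.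
apply: le_trans (normc_triangle (trap f N a b) _ _) _.
by rewrite [X in X + _]normcBC; lra.
Qed.

End PathIntegral.

(** * Goursat's lemma and local primitives *)

Section Goursat.
Context {R : realType}.
Local Notation C := (R[i]^o).
Implicit Types (x y z w a b c p : C) (f : C -> C) (r e : R).

Definition perimeter x y z : R := normc (y - x) + normc (z - y) + normc (x - z).

Lemma perimeter_ge0 x y z : 0 <= perimeter x y z.
Proof. by rewrite !addr_ge0 ?normc_ge0. Qed.

Lemma normc_mid a b p : normc ((a + b) / 2 - p) <= (normc (a - p) + normc (b - p)) / 2.
Proof.
have -> : (a + b) / 2 - p = ((a - p) + (b - p)) / 2 by field.
by rewrite normc_half ler_wpM2r ?invr_ge0 // normcD.
Qed.

Lemma perimeter_half x y z x' y' z' :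
  y' - x' = (y - x) / 2 -> z' - y' = (z - y) / 2 -> x' - z' = (x - z) / 2 ->
  perimeter x' y' z' = perimeter x y z / 2.
Proof. by rewrite /perimeter => -> -> ->; rewrite !normc_half; lra. Qed.

Lemma perimeterN x y z x' y' z' :
  y' - x' = - ((y - x) / 2) -> z' - y' = - ((z - y) / 2) -> x' - z' = - ((x - z) / 2) ->
  perimeter x' y' z' = perimeter x y z / 2.
Proof. by rewrite /perimeter => -> -> ->; rewrite !normcN !normc_half; lra. Qed.

Section Triangle.
Variables (f : C -> C) (c : C) (r : R) (I : C -> C -> C).
Hypothesis pI : path_integral f c r I.

Definition tri x y z := I x y + I y z + I z x.

(** The last triangle is the medial one, oriented so that its sides cancel the inner sides of the
    three corner triangles. *)
Lemma tri_split x y z : cball c r x -> cball c r y -> cball c r z ->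
  tri x y z = tri x ((x + y) / 2) ((z + x) / 2) + tri ((x + y) / 2) y ((y + z) / 2)
    + tri ((z + x) / 2) ((y + z) / 2) z + tri ((y + z) / 2) ((z + x) / 2) ((x + y) / 2).
Proof.
move=> cx cy cz; have [anti mid _] := pI; have mc := @cball_midconvex _ c r.
have cxy := mc _ _ cx cy; have cyz := mc _ _ cy cz; have czx := mc _ _ cz cx.
rewrite /tri (mid x y) // (mid y z) // (mid z x) //.
rewrite (anti ((x + y) / 2) ((z + x) / 2)) // (anti ((x + y) / 2) ((y + z) / 2)) //.
by rewrite (anti ((y + z) / 2) ((z + x) / 2)) //; ring.
Qed.

(** The square of the perimeter is the scaling preserved by subdivision: a quarter of the integral
    on half the perimeter. *)
Definition bad e (t : C * C * C) :=
  let: (x, y, z) := t in [/\ cball c r x, cball c r y, cball c r z &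
    e * perimeter x y z ^+ 2 < normc (tri x y z)].

Let per (t : C * C * C) := let: (x, y, z) := t in perimeter x y z.

(** One of the four triangles carries at least a quarter of the integral. The bound on the
    displacement of the first vertex will make the first vertices a Cauchy sequence. *)
Lemma bad_child e t : bad e t ->
  exists t', [/\ bad e t', per t' = per t / 2 & normc (t'.1.1 - t.1.1) <= per t].
Proof.
move: t => [[x y] z] /= [cx cy cz bt]; have mc := @cball_midconvex _ c r.
have cxy := mc _ _ cx cy; have cyz := mc _ _ cy cz; have czx := mc _ _ cz cx.
apply: contrapT => nb.
have p1 : perimeter x ((x + y) / 2) ((z + x) / 2) = perimeter x y z / 2.
  by apply: perimeter_half; field.
have p2 : perimeter ((x + y) / 2) y ((y + z) / 2) = perimeter x y z / 2.
  by apply: perimeter_half; field.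
have p3 : perimeter ((z + x) / 2) ((y + z) / 2) z = perimeter x y z / 2.
  by apply: perimeter_half; field.
have p4 : perimeter ((y + z) / 2) ((z + x) / 2) ((x + y) / 2) = perimeter x y z / 2.
  by apply: perimeterN; field.
have d1 : normc (x - x) <= perimeter x y z.
  by rewrite subrr normc0 perimeter_ge0.
have n1 := normc_ge0 (y - x); have n2 := normc_ge0 (z - y); have n3 := normc_ge0 (x - z).
have d2 : normc ((x + y) / 2 - x) <= perimeter x y z.
  by apply: le_trans (normc_mid _ _ _) _; rewrite subrr normc0 /perimeter; lra.
have d3 : normc ((z + x) / 2 - x) <= perimeter x y z.
  apply: le_trans (normc_mid _ _ _) _; rewrite subrr normc0 /perimeter.
  by rewrite (normcBC z x); lra.
have d4 : normc ((y + z) / 2 - x) <= perimeter x y z.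
  apply: le_trans (normc_mid _ _ _) _; rewrite /perimeter.
  by rewrite (normcBC z x); lra.
have N x' y' z' : cball c r x' -> cball c r y' -> cball c r z' ->
    perimeter x' y' z' = perimeter x y z / 2 -> normc (x' - x) <= perimeter x y z ->
    normc (tri x' y' z') <= e * perimeter x y z ^+ 2 / 4.
  move=> c1 c2 c3 pe dx; rewrite leNgt; apply/negP => h; apply: nb.
  exists (x', y', z'); split => //=; split => //; rewrite pe.
  by apply: le_lt_trans h; rewrite expr_div_n; lra.
have := N _ _ _ cx cxy czx p1 d1; have := N _ _ _ cxy cy cyz p2 d2.
have := N _ _ _ czx cyz cz p3 d3; have := N _ _ _ cyz czx cxy p4 d4.
move: bt; rewrite (tri_split cx cy cz).
set t1 := tri x _ _; set t2 := tri _ y _; set t3 := tri _ _ z; set t4 := tri _ _ _.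
move=> bt h4 h3 h2 h1.
have := normcD (t1 + t2 + t3) t4; have := normcD (t1 + t2) t3; have := normcD t1 t2.
lra.
Qed.

Lemma goursat : (forall z, cball c r z -> cderivable f z) ->
  forall x y z, cball c r x -> cball c r y -> cball c r z -> tri x y z = 0.
Proof.
move=> df x y z cx cy cz; apply: normc_le_eps0 => e0 e00; rewrite leNgt; apply/negP => hlt.
pose D := perimeter x y z.
have D0 : 0 <= D by exact: perimeter_ge0.
(* With this e the initial triangle is bad, as e D^2 < e0. *)
pose e := e0 / (D ^+ 2 + 1).
have D1 : 0 < D ^+ 2 + 1 by have := sqr_ge0 D; lra.
have e_gt0 : 0 < e by rewrite divr_gt0.
have b0 : bad e (x, y, z).
  split => //; apply: le_lt_trans hlt; rewrite -/D /e mulrAC ler_pdivrMr //.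
  by rewrite ler_pM2l //; lra.
have /choice[g hg] : forall t, exists t', bad e t ->
    [/\ bad e t', per t' = per t / 2 & normc (t'.1.1 - t.1.1) <= per t].
  move=> t; have [/bad_child[t' ?]|] := pselect (bad e t); by [exists t'|exists t].
pose s n := iter n g (x, y, z).
have bs n : bad e (s n) by elim: n => //= n /hg[].
have ps n : per (s n) = D / 2 ^+ n.
  elim: n => [|n IH]; first by rewrite expr0 divr1.
  by have [_ -> _] := hg _ (bs n); rewrite IH exprS; field.
have dist n k : normc ((s (n + k)%N).1.1 - (s n).1.1) <= 2 * D / 2 ^+ n - 2 * D / 2 ^+ (n + k).
  elim: k => [|k IH]; first by rewrite addn0 !subrr normc0.
  have [_ _ h1] := hg _ (bs (n + k)%N).
  rewrite addnS; apply: le_trans (normc_triangle (s (n + k)%N).1.1 _ _) _.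
  apply: le_trans (lerD h1 IH) _; rewrite ps exprS.
  set q := 2 ^+ (n + k); have q0 : q != 0 by rewrite expf_neq0.
  rewrite -subr_ge0; set L := (X in 0 <= X).
  suff -> : L = 0 by [].
  rewrite /L; field; rewrite q0 /= expf_neq0 //.
have dist' n m : (n <= m)%N -> normc ((s m).1.1 - (s n).1.1) <= 2 * D / 2 ^+ n.
  move=> nm; rewrite -(subnKC nm); apply: le_trans (dist _ _) _.
  by rewrite gerBl divr_ge0 ?mulr_ge0 ?exprn_ge0.
have [|p hp] := @cauchy_seq_cvg _ (fun n => (s n).1.1).
  move=> d d0; have [N hN] := lt_pow2 (4 * D / d).
  have hN' : 2 * D / 2 ^+ N <= d / 2.
    rewrite ler_pdivrMr ?exprn_gt0 //; move: hN; rewrite ltr_pdivrMr //.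
    set q := 2 ^+ N; lra.
  exists N => i j Ni Nj; apply: le_trans (normc_triangle (s N).1.1 _ _) _.
  have := dist' _ _ Ni; have := dist' _ _ Nj; rewrite (normcBC (s N).1.1); lra.
have csn n : [/\ cball c r (s n).1.1, cball c r (s n).1.2 & cball c r (s n).2].
  by have := bs n; case: (s n) => [[? ?] ?] [].
have cp : cball c r p.
  apply: cball_closed => d d0; have [N hN] := hp (d / 2) (divr_gt0 d0 (ltr0Sn _ _)).
  exists (s N).1.1; first by have [] := csn N.
  by apply: le_lt_trans (hN N (leqnn _)) _; lra.
have distp n : normc (p - (s n).1.1) <= 2 * D / 2 ^+ n.
  suff H : forall d : R, 0 < d -> normc (p - (s n).1.1) <= 2 * D / 2 ^+ n + d by apply/ler_addgt0Pr.
  move=> d d0; have [N hN] := hp d d0.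
  have := hN _ (leq_maxr n N); have := dist' _ _ (leq_maxl n N).
  have := normc_triangle (s (maxn n N)).1.1 p (s n).1.1.
  rewrite (normcBC p (s (maxn n N)).1.1); lra.
have [l /cdiffP dfp] := df p cp.
(* The limit p is within 2 Dn of the first vertex of the n-th triangle, whose perimeter is Dn. All
   relevant points are thus within 3 Dn of p, and the first order error there is at most (e/3) 3
   Dn. *)
have [d d0 hd] := dfp (e / 3) (divr_gt0 e_gt0 (ltr0Sn _ _)).
have [n hn] := lt_pow2 (3 * D / d).
have {}hn : 3 * (D / 2 ^+ n) < d.
  by move: hn; rewrite ltr_pdivrMr // mulrA ltr_pdivrMr ?exprn_gt0 // (mulrC d).
have := bs n; have := ps n; have := distp n.
case: (s n) => [[a b] b'] /= distn pern [ca cb cb' hb].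
pose Dn := D / 2 ^+ n.
have [anti mid est] := pI.
pose P := cball c r `&` cball a Dn.
have mP : midconvex P by apply: midconvexI; exact: cball_midconvex.
have Pc : P `<=` cball c r by move=> ? [].
have n1 := normc_ge0 (b - a); have n2 := normc_ge0 (b' - b); have n3 := normc_ge0 (a - b').
have Pa : P a by split => //; rewrite /cball /= subrr normc0 divr_ge0 // exprn_ge0.
have Pb : P b by split => //; rewrite /cball /= /Dn -pern /perimeter; lra.
have Pb' : P b'.
  by split => //; rewrite /cball /= /Dn -pern /perimeter (normcBC b' a); lra.
have hP w : P w -> normc (f w - (l * w + (f p - l * p))) <= e * Dn.
  move=> [_]; rewrite /cball /= => wa.
  have wp : normc (w - p) <= 3 * Dn.
    apply: le_trans (normc_triangle a _ _) _; rewrite (normcBC a p).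
    by move: distn wa; rewrite /Dn -!mulrA; lra.
  have -> : f w - (l * w + (f p - l * p)) = f w - f p - l * (w - p) by ring.
  apply: le_trans (hd w _) _; first by apply: le_lt_trans wp _; rewrite /Dn.
  by apply: le_trans (ler_wpM2l _ wp) _; [lra|rewrite /Dn; lra].
have := est _ _ _ _ _ _ mP Pc Pa Pb hP; have := est _ _ _ _ _ _ mP Pc Pb Pb' hP.
have := est _ _ _ _ _ _ mP Pc Pb' Pa hP.
set A1 := I b' a - _; set A2 := I b b' - _; set A3 := I a b - _ => h1 h2 h3.
(* The integrals of an affine function, given by midpoint values, cancel around the triangle; only
   the three errors remain, of total size e Dn^2, against badness. *)
suff triE : tri a b b' = A3 + A2 + A1.
  move: hb; apply/negP; rewrite -leNgt pern -/Dn triE expr2 mulrA.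
  apply: le_trans (_ : _ <= normc A3 + normc A2 + normc A1) _.
    by apply: le_trans (normcD _ _) _; rewrite lerD2r normcD.
  apply: le_trans (lerD (lerD h3 h2) h1) _.
  by rewrite -!mulrDr -/(perimeter a b b') pern.
by rewrite /tri /A1 /A2 /A3; field.
Qed.

End Triangle.

(* Applied to the first order expansion of [f] at a point, the estimate gives the second
   order Taylor expansion of [F] there, although the continuity of the derivative of
   [f] is not known at this stage. *)
Definition primitive_on f c r (F : C -> C) := forall (P : set C) (al be : C) e a b,
  midconvex P -> P `<=` cball c r -> P a -> P b ->
  (forall z, P z -> normc (f z - (al * z + be)) <= e) ->
  normc (F b - F a - (al * ((a + b) / 2) + be) * (b - a)) <= e * normc (b - a).

(** Integrate from the centre; by Goursat the increment of F is the integral along the segment from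
    a to b. *)
Lemma primitive_exists f c r : 0 <= r -> (forall z, cball c r z -> cderivable f z) ->
  exists F, primitive_on f c r F.
Proof.
move=> r0 df.
have [I pI] : exists I, path_integral f c r I.
  by apply: path_integral_exists => z /df [l /cdiff_cont].
exists (I c) => P al be e a b mP Pc Pa Pb hP; have [anti mid est] := pI.
have ca := Pc _ Pa; have cb := Pc _ Pb; have cc := cball_center c r0.
have := goursat pI df cc ca cb; rewrite /tri (anti c b) // => h.
suff -> : I c b - I c a = I a b by exact: est hP.
apply/eqP; rewrite -subr_eq0 -oppr_eq0; apply/eqP; rewrite -h; ring.
Qed.

End Goursat.

(** * The maximum principle from second order expansions *)

Section MaximumPrinciple.
Context {R : realType}.
Local Notation C := (R[i]^o).
Local Notation Re := complex.Re.
Local Notation Im := complex.Im.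
Implicit Types (x y z w a b c p h : C) (f F G : C -> C) (r e t : R) (u v : C -> R).

Lemma cont_atP u z : cont_at u z <-> {for z, continuous u}.
Proof.
split=> [h P /nbhs_ballP[e /= e0 hP]|h e e0].
  have [d d0 hd] := h e e0; apply/nbhsCP; exists d => // w /hd; rewrite distrC => H.
  exact: hP.
have /nbhsCP[d d0 hd] := h _ (nbhsx_ballx _ _ e0); exists d => // w /hd.
by rewrite /ball /= distrC.
Qed.

Lemma cont_atD u v z : cont_at u z -> cont_at v z -> cont_at (fun w => u w + v w) z.
Proof.
move=> /cont_atP hu /cont_atP hv; apply/cont_atP.
exact: (@continuousD R R C u v z hu hv).
Qed.

Lemma cont_atM u v z : cont_at u z -> cont_at v z -> cont_at (fun w => u w * v w) z.
Proof.
move=> /cont_atP hu /cont_atP hv; apply/cont_atP.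
exact: (@continuousM R C u v z hu hv).
Qed.

Lemma cont_at_cst t z : cont_at (fun=> t) z.
Proof. by move=> e e0; exists 1 => // w _; rewrite subrr normr0. Qed.

Lemma cont_at_sqr u z : cont_at u z -> cont_at (fun w => u w ^+ 2) z.
Proof. by move=> hu; under eq_fun do rewrite expr2; exact: cont_atM. Qed.

(** This pointwise regularity suffices to compare the mean of |G|^2 over four nearby points with its
    value at p, up to o(t^2). *)
Definition taylor2 G p := exists A B : C, forall e, 0 < e -> exists2 d : R, 0 < d &
  forall h, normc h < d -> normc (G (p + h) - G p - A * h - B * h ^+ 2) <= e * normc h ^+ 2.

Lemma taylor2_ccont G p : taylor2 G p -> ccont G p.
Proof.
move=> [A [B h]]; have [d d0 hd] := h 1 ltr01.
suff : cdiff G p A by move=> /cdiff_cont.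
apply/cdiffP => e e0.
pose K := normc B + 1; have K0 : 0 < K by have := normc_ge0 B; rewrite /K; lra.
exists (Num.min d (e / K)); first by rewrite lt_min d0 divr_gt0.
move=> w; rewrite lt_min => /andP[/hd + h2]; rewrite subrKC mul1r => h1.
have -> : G w - G p - A * (w - p) =
  (G w - G p - A * (w - p) - B * (w - p) ^+ 2) + B * (w - p) ^+ 2 by ring.
apply: le_trans (normcD _ _) _; apply: le_trans (lerD h1 (lexx _)) _.
rewrite normcM normcX -[X in X + _]mul1r -mulrDl [1 + _]addrC -/K expr2 mulrA ler_wpM2r //.
by rewrite mulrC -ler_pdivlMr // ltW.
Qed.

Lemma taylor2B G F p : taylor2 G p -> taylor2 F p -> taylor2 (fun z => G z - F z) p.
Proof.
move=> [A [B h1]] [A' [B' h2]]; exists (A - A'), (B - B') => e e0.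
have [d d0 hd] := h1 (e / 2) (divr_gt0 e0 (ltr0Sn _ _)).
have [d' d'0 hd'] := h2 (e / 2) (divr_gt0 e0 (ltr0Sn _ _)).
exists (Num.min d d'); first by rewrite lt_min d0.
move=> h; rewrite lt_min => /andP[/hd H1 /hd' H2].
have -> : G (p + h) - F (p + h) - (G p - F p) - (A - A') * h - (B - B') * h ^+ 2 =
  (G (p + h) - G p - A * h - B * h ^+ 2) - (F (p + h) - F p - A' * h - B' * h ^+ 2) by ring.
by apply: le_trans (normcB _ _) _; lra.
Qed.

Lemma taylor2Z a G p : taylor2 G p -> taylor2 (fun z => G z * a) p.
Proof.
move=> [A [B h1]]; exists (A * a), (B * a) => e e0.
have a0 : 0 < normc a + 1 by have := normc_ge0 a; lra.
have [d d0 hd] := h1 (e / (normc a + 1)) (divr_gt0 e0 a0).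
exists d => // h /hd H.
have -> : G (p + h) * a - G p * a - A * a * h - B * a * h ^+ 2 =
  (G (p + h) - G p - A * h - B * h ^+ 2) * a by ring.
rewrite normcM; apply: le_trans (ler_wpM2r (normc_ge0 _) H) _.
rewrite mulrAC ler_wpM2r ?exprn_ge0 // mulrAC ler_pdivrMr // ler_pM2l //.
by rewrite lerDl.
Qed.

Lemma taylor2_shift G (k : C) p : taylor2 G (p + k) -> taylor2 (fun z => G (z + k)) p.
Proof.
move=> [A [B h1]]; exists A, B => e /h1[d d0 hd]; exists d => // h /hd.
by rewrite (addrAC p h k).
Qed.

Lemma normc_xi t : normc (0 +i* t : C) = `|t|.
Proof. by rewrite /= expr0n add0r sqrtr_sqr. Qed.

(* Parseval on the four points [t, -t, i t, - i t]: the mixed terms cancel. *)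
Lemma four_point_parseval (g A B : C) t :
  let q (h : C) := normc (g + A * h + B * h ^+ 2) ^+ 2 in
  q t%:C + q (- t%:C) + q (0 +i* t) + q (- (0 +i* t)) =
  4 * (normc g ^+ 2 + normc A ^+ 2 * t ^+ 2 + normc B ^+ 2 * t ^+ 4).
Proof.
move=> q; rewrite /q !sqr_normcE !expr2 !ReImE /=; ring.
Qed.

(** By [four_point_parseval] the four-point mean of |G|^2 is at least its central value up to
    o(t^2), and q adds a definite multiple of t^2; so one of the four points beats the centre. *)
Lemma no_local_max G (q : C -> R) p (k d : R) : taylor2 G p -> 0 < k -> 0 < d ->
  (forall t, 4 * q p + 4 * k * t ^+ 2 <=
     q (p + t%:C) + q (p - t%:C) + q (p + (0 +i* t)) + q (p - (0 +i* t))) ->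
  exists2 h, normc h < d & normc (G p) ^+ 2 + q p < normc (G (p + h)) ^+ 2 + q (p + h).
Proof.
move=> [A [B tG]] k0 d0 hq; apply: contrapT => nh.
have {nh} H h : normc h < d ->
    normc (G (p + h)) ^+ 2 + q (p + h) <= normc (G p) ^+ 2 + q p.
  by move=> hd; rewrite leNgt; apply/negP => H; apply: nh; exists h.
pose K := normc (G p) + normc A + normc B + 1.
have K0 : 0 < K by rewrite /K ltr_wpDl // !addr_ge0.
pose e := k / (4 * K); have e0 : 0 < e by rewrite divr_gt0 ?mulr_gt0.
have [d' d'0 hd'] := tG e e0.
pose t := Num.min 1 (Num.min d d') / 2.
have m0 : 0 < Num.min 1 (Num.min d d') by rewrite !lt_min ltr01 d0.
have t0 : 0 < t by rewrite divr_gt0.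
have [t1 td td'] : [/\ t < 1, t < d & t < d'].
  have : t < Num.min 1 (Num.min d d') by rewrite /t; lra.
  by rewrite !lt_min => /andP[-> /andP[-> ->]].
have key h : normc h = t ->
    normc (G p + A * h + B * h ^+ 2) ^+ 2 - 2 * K * (e * t ^+ 2) <= normc (G (p + h)) ^+ 2.
  move=> ht; have := hd' h; rewrite ht => /(_ td') h1.
  set y := G p + A * h + B * h ^+ 2.
  have yK : normc y <= K.
    apply: le_trans (normcD _ _) _; apply: le_trans (lerD (normcD _ _) (lexx _)) _.
    rewrite (normcM A) (normcM B) normcX ht /K -addrA -[leRHS]addrA -[leRHS]addrA lerD2l.
    have At : normc A * t <= normc A by rewrite ler_piMr // ltW.
    have Bt : normc B * t ^+ 2 <= normc B by rewrite ler_piMr // exprn_ile1 // ltW.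
    by lra.
  have h2 : normc y - e * t ^+ 2 <= normc (G (p + h)).
    have -> : y = G (p + h) - (G (p + h) - G p - A * h - B * h ^+ 2) by rewrite /y; ring.
    by have := normcB (G (p + h)) (G (p + h) - G p - A * h - B * h ^+ 2); lra.
  have s0 : 0 <= e * t ^+ 2 by rewrite mulr_ge0 ?exprn_ge0 // ltW.
  have y0 := normc_ge0 y; have g0 := normc_ge0 (G (p + h)).
  move: s0 h2; set s := e * t ^+ 2 => s0 h2.
  suff : normc y ^+ 2 - 2 * normc y * s <= normc (G (p + h)) ^+ 2 by nra.
  have [ys|ys] := lerP s (normc y); nra.
have n1 : normc (t%:C : C) = t by rewrite normcC gtr0_norm.
have n2 : normc (- t%:C : C) = t by rewrite normcN.
have n3 : normc (0 +i* t : C) = t by rewrite normc_xi gtr0_norm.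
have n4 : normc (- (0 +i* t) : C) = t by rewrite normcN.
have := H _ (eq_ind_r (fun s => s < d) td n1); have := H _ (eq_ind_r (fun s => s < d) td n2).
have := H _ (eq_ind_r (fun s => s < d) td n3); have := H _ (eq_ind_r (fun s => s < d) td n4).
have := key _ n1; have := key _ n2; have := key _ n3; have := key _ n4.
have := four_point_parseval (G p) A B t; have := hq t => /=.
have A0 : 0 <= normc A ^+ 2 * t ^+ 2 by rewrite mulr_ge0 // sqr_ge0.
have B0 : 0 <= normc B ^+ 2 * t ^+ 4 by rewrite mulr_ge0 ?sqr_ge0 // exprn_ge0 // ltW.
have Ke : 2 * K * (e * t ^+ 2) = k * t ^+ 2 / 2.
  by rewrite /e; field; rewrite gt_eqF.
have kt : 0 < k * t ^+ 2 by rewrite mulr_gt0 ?exprn_gt0.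
rewrite Ke; move: A0 B0 kt; rewrite -mulrA.
move: (normc A ^+ 2 * t ^+ 2) (normc B ^+ 2 * t ^+ 4) (k * t ^+ 2) => a2 b2 kk.
lra.
Qed.

Lemma primitive_taylor2 f c r F p : primitive_on f c r F -> cderivable f p ->
  normc (p - c) < r -> taylor2 F p.
Proof.
move=> pF [l /cdiffP df] pc; exists (f p), (l / 2) => e e0.
have [d d0 hd] := df e e0.
have rp : 0 < r - normc (p - c) by rewrite subr_gt0.
exists (Num.min d (r - normc (p - c))); first by rewrite lt_min d0.
move=> h; rewrite lt_min => /andP[h1 h2].
have mP := midconvexI (cball_midconvex (c := c) (r := r))
  (cball_midconvex (c := p) (r := normc h)).
have := pF _ l (f p - l * p) (e * normc h) p (p + h) mP.
have -> : p + h - p = h by ring.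
have -> : F (p + h) - F p - (l * ((p + (p + h)) / 2) + (f p - l * p)) * h =
   F (p + h) - F p - f p * h - l / 2 * h ^+ 2 by field.
have -> : e * normc h ^+ 2 = e * normc h * normc h by rewrite expr2 mulrA.
apply.
- by move=> w [].
- by split; rewrite /cball /= ?subrr ?normc0 // ltW.
- split; rewrite /cball /=; last by rewrite addrAC subrr add0r.
  have -> : p + h - c = (p - c) + h by ring.
  by apply: le_trans (normcD _ _) _; lra.
move=> w [_]; rewrite /cball /= => wp.
have -> : f w - (l * w + (f p - l * p)) = f w - f p - l * (w - p) by ring.
apply: le_trans (hd _ (le_lt_trans wp h1)) _.
by rewrite ler_wpM2l // ltW.
Qed.

Lemma primitive_diff f c r F p (k : C) e : primitive_on f c r F ->
  cball c r p -> cball c r (p + k) -> k != 0 ->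
  (forall w, cball c r w -> normc (w - p) <= normc k -> normc (f w - f p) <= e) ->
  normc ((F (p + k) - F p) / k - f p) <= e.
Proof.
move=> pF pc pkc k0 hf.
have mP := midconvexI (cball_midconvex (c := c) (r := r))
  (cball_midconvex (c := p) (r := normc k)).
have := pF _ 0 (f p) e p (p + k) mP.
have -> : p + k - p = k by ring.
rewrite mul0r add0r => h.
have -> : (F (p + k) - F p) / k - f p = (F (p + k) - F p - f p * k) / k by field.
rewrite normc_div ler_pdivrMr ?normc_gt0 //; apply: h.
- by move=> w [].
- by split; rewrite /cball /= ?subrr ?normc0.
- by split; rewrite /cball //= addrAC subrr add0r.
by move=> w [cw pw]; rewrite mul0r add0r; exact: hf.
Qed.

(** This weight still has positive discrete Laplacian, yet on the circle of radius r/2 about p it is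
    smaller than e |w|^2 by e r^2 / 8; the loss keeps a maximum off that circle. *)
Lemma quad_weight (e : R) p z t :
  let q (w : C) := e * normc w ^+ 2 - e / 2 * normc (w - p) ^+ 2 in
  4 * q z + 4 * (e / 2) * t ^+ 2 =
     q (z + t%:C) + q (z - t%:C) + q (z + (0 +i* t)) + q (z - (0 +i* t)).
Proof.
move=> q; rewrite /q !sqr_normcE !ReImE /=; by field.
Qed.

(* The difference quotients of a primitive of [F] have second order Taylor expansions and
   converge to [F] locally uniformly; a quadratic perturbation of their modulus squared
   has no local maximum by [four_point_parseval]. *)
Lemma max_principle (X : set C) (M c0 : R) F : 0 <= c0 ->
  csequentially_closed X -> (forall z, X z -> normc z <= M) ->
  (forall z, X z -> ccont F z) ->
  (forall p, X p -> normc (F p) <= c0 \/ exists2 r : R, 0 < r &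
     cball p r `<=` X /\ forall z, cball p r z -> cderivable F z) ->
  forall z, X z -> normc (F z) <= c0.
Proof.
move=> c00 Xc XM Fc Xp z Xz.
have claim e : 0 < e -> normc (F z) ^+ 2 <= c0 ^+ 2 + e * M ^+ 2.
  move=> e0; pose u w := normc (F w) ^+ 2 + e * normc w ^+ 2.
  have [|p pX pmax] := @max_attained _ X M u Xc XM (ex_intro _ z Xz).
    move=> w Xw; apply: cont_atD; first by apply: cont_at_sqr; apply: cont_at_normc; exact: Fc.
    apply: cont_atM; first exact: cont_at_cst.
    by apply: cont_at_sqr; apply: cont_at_normc; exact: ccont_id.
  suff Fp : normc (F p) <= c0.
    have h1 : normc (F z) ^+ 2 <= u z by rewrite lerDl mulr_ge0 ?exprn_ge0 // ltW.
    apply: (le_trans h1); apply: (le_trans (pmax z Xz)).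
    apply: lerD; first by rewrite ler_sqr ?nnegrE ?normc_ge0.
    by rewrite ler_pM2l // ler_sqr ?nnegrE ?normc_ge0 ?XM // (le_trans (normc_ge0 p)) // XM.
  have [//|[r r0 [rX rd]]] := Xp p pX.
  exfalso.
  have [P pP] : exists P, primitive_on F p r P by exact: primitive_exists (ltW r0) rd.
  have [K K0 hK] := bounded_on_cball (ltW r0) (fun w wr => Fc _ (rX w wr)).
  (* If |G - F| <= eta and |F| <= K, then |G|^2 and |F|^2 differ by at most eta (2K + 1) <= e r^2 /
     32. Two such errors, at m and at p, stay below the gap e r^2 / 8. *)
  pose eta := Num.min 1 (e * r ^+ 2 / 32 / (2 * K + 1)).
  have K1 : 0 < 2 * K + 1 by lra.
  have r2 : 0 < r ^+ 2 by rewrite exprn_gt0.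
  have eta0 : 0 < eta by rewrite lt_min ltr01 divr_gt0 // divr_gt0 // mulr_gt0.
  have eta1 : eta <= 1 by rewrite ge_min lexx.
  have etaK : eta * (2 * K + 1) <= e * r ^+ 2 / 32.
    by rewrite -ler_pdivlMr // ge_min lexx orbT.
  have [d d0 hd] := heine (fun w wr => Fc _ (rX w wr)) eta0.
  pose k : C := (Num.min (d / 2) (r / 4))%:C.
  have nk : normc k = Num.min (d / 2) (r / 4).
    by rewrite normcC gtr0_norm // lt_min !divr_gt0.
  have kd : normc k < d by rewrite nk gt_min; apply/orP; left; lra.
  have kr : normc k <= r / 4 by rewrite nk ge_min lexx orbT.
  have k0 : k != 0 by rewrite -normc_gt0 nk lt_min !divr_gt0.
  pose G w := (P (w + k) - P w) / k.
  have inr w : cball p (r / 2) w -> normc (w - p) < r /\ normc (w + k - p) < r.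
    rewrite /cball /= => h; split; first lra.
    have -> : w + k - p = (w - p) + k by ring.
    by apply: le_lt_trans (normcD _ _) _; lra.
  have tG w : cball p (r / 2) w -> taylor2 G w.
    move=> /inr[h1 h2]; apply: taylor2Z; apply: taylor2B.
      by apply: taylor2_shift; exact: primitive_taylor2 pP (rd _ (ltW h2)) h2.
    exact: primitive_taylor2 pP (rd _ (ltW h1)) h1.
  have GF w : cball p (r / 2) w -> `|normc (G w) ^+ 2 - normc (F w) ^+ 2| <= e * r ^+ 2 / 32.
    move=> wp; have [h1 h2] := inr w wp.
    have h3 : normc (G w - F w) <= eta.
      apply: primitive_diff pP (ltW h1) (ltW h2) k0 _ => v vp vw.
      by apply: ltW; apply: hd => //; [exact: ltW|exact: le_lt_trans kd].
    have h4 := hK w (ltW h1).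
    apply: le_trans _ etaK.
    have h5 := normc_ler_sub (G w) (F w); have h6 := normc_ler_sub (F w) (G w).
    rewrite normcBC in h6; have h7 := normc_ge0 (G w); have h8 := normc_ge0 (F w).
    rewrite ler_norml; apply/andP; split; nra.
  pose q w := e * normc w ^+ 2 - e / 2 * normc (w - p) ^+ 2.
  pose W w := normc (G w) ^+ 2 + q w.
  have [|m mp mmax] := @max_attained _ (cball p (r / 2)) _ W (@cball_closed _ _ _)
      (@cball_bounded _ _ _) (ex_intro _ p (cball_center _ (ltW (divr_gt0 r0 (ltr0Sn _ 1))))).
    move=> w wp; apply: cont_atD.
      by apply: cont_at_sqr; apply: cont_at_normc; exact: taylor2_ccont (tG w wp).
    have -> : q = (fun x => e * normc x ^+ 2 + (- (e / 2)) * normc (x - p) ^+ 2).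
      by apply/funext => x; rewrite /q; lra.
    apply: cont_atD; apply: cont_atM; try exact: cont_at_cst;
      apply: cont_at_sqr; apply: cont_at_normc; first exact: ccont_id.
    by apply: ccontB; [exact: ccont_id|exact: ccont_cst].
  (* An interior maximum of W is excluded by [no_local_max]. On the bounding circle, the comparison
     with the maximality of u at p gives the contradiction. *)
  have mr : normc (m - p) = r / 2.
    apply/eqP; rewrite eq_le mp leNgt; apply/negP => mlt.
    have ml0 : 0 < r / 2 - normc (m - p) by rewrite subr_gt0.
    have [|h hlt] := no_local_max (q := q) (tG m mp) (divr_gt0 e0 (ltr0Sn _ 1)) ml0.
      by move=> t; rewrite /q; have /= <- := quad_weight e p m t.
    rewrite ltNge => /negP; apply; apply: mmax; rewrite /cball /=.
    have -> : m + h - p = (m - p) + h by ring.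
    by apply: le_trans (normcD _ _) _; lra.
  have pp : cball p (r / 2) p by apply: cball_center; rewrite ltW // divr_gt0.
  have := mmax p pp; rewrite /W /q mr subrr normc0 expr0n mulr0 subr0.
  have Xm : X m by apply: rX; rewrite /cball /= mr; lra.
  have := pmax m Xm; rewrite /u.
  have := GF p pp; have := GF m mp; rewrite !ler_norml => /andP[g1 g2] /andP[g3 g4].
  move: g1 g2 g3 g4; rewrite expr_div_n.
  move: (normc (G p) ^+ 2) (normc (F p) ^+ 2) (normc (G m) ^+ 2) (normc (F m) ^+ 2)
     (e * normc p ^+ 2) (e * normc m ^+ 2) => x1 x2 x3 x4 x5 x6 g1 g2 g3 g4 h1.
  have -> : e / 2 * (r ^+ 2 / 2 ^+ 2) = e * r ^+ 2 / 8 by field.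
  have : 0 < e * r ^+ 2 by rewrite mulr_gt0.
  by move: g1 g2 g3 g4; move: (e * r ^+ 2) => er; lra.
rewrite -(@ler_sqr R) ?nnegrE ?normc_ge0 //; apply/ler_addgt0Pr => e e0.
have M0 : 0 < M ^+ 2 + 1 by have := sqr_ge0 M; lra.
apply: le_trans (claim _ (divr_gt0 e0 M0)) _; rewrite lerD2l mulrAC ler_pdivrMr //.
by rewrite ler_pM2l //; lra.
Qed.

End MaximumPrinciple.

(** * Schwarz's lemma, Cauchy's estimates, differentiability of the derivative *)

Section CauchyEstimates.
Context {R : realType}.
Local Notation C := (R[i]^o).
Implicit Types (x y z w a b c p h : C) (f F G : C -> C) (r e t M : R).

Lemma bernoulli (x : R) n : 0 <= x -> 1 + x *+ n <= (1 + x) ^+ n.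
Proof.
move=> x0; elim: n => [|n IH]; first by rewrite mulr0n addr0 expr0.
rewrite exprS mulrS; have h : 0 <= x *+ n by rewrite mulrn_wge0.
have : (1 + x) * (1 + x *+ n) <= (1 + x) * (1 + x) ^+ n by rewrite ler_wpM2l // addr_ge0.
by apply: le_trans; nra.
Qed.

(** Limits in an exponent are taken in this form, both in Schwarz's lemma and in the final
    contradiction of Privalov's theorem. *)
Lemma bounded_powers_le1 (x K : R) : (forall n, x ^+ n <= K) -> x <= 1.
Proof.
move=> h; rewrite leNgt; apply/negP => x1.
have x10 : 0 < x - 1 by lra.
pose n := (Num.truncn (K / (x - 1))).+1.
have := h n; apply/negP; rewrite -ltNge.
have := @bernoulli (x - 1) n (ltW x10); have -> : 1 + (x - 1) = x by lra.
apply: lt_le_trans; have := truncnS_gt (K / (x - 1)); rewrite -/n ltr_pdivrMr //.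
by rewrite -mulr_natl; lra.
Qed.

(* The maximum principle is applied to [f ^+ n.+1 / (z - c) ^+ n], which tends to 0 at [c],
   with [n] tending to infinity: this avoids removing the singularity of [f / (z - c)]. *)
Lemma schwarz f c r M : 0 < r -> 0 < M -> f c = 0 ->
  (forall z, normc (z - c) < r -> cderivable f z) ->
  (forall z, normc (z - c) < r -> normc (f z) <= M) ->
  forall z, normc (z - c) < r -> normc (f z) <= M * normc (z - c) / r.
Proof.
move=> r0 M0 fc0 df fM z zr.
have [->|zc] := eqVneq z c; first by rewrite fc0 subrr normc0 mulr0 mul0r.
set t := normc (z - c) in zr *; have t0 : 0 < t by rewrite normc_gt0 subr_eq0.
have claim (rho : R) n : t < rho -> rho < r ->
    normc (f z) ^+ n.+1 / t ^+ n <= M ^+ n.+1 / rho ^+ n.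
  move=> trho rhor; have rho0 : 0 < rho by exact: lt_trans trho.
  have [l /cdiffP dfc] : cderivable f c by apply: df; rewrite subrr normc0.
  have [d d0 hd] := dfc 1 ltr01.
  pose L := normc l + 1; have L0 : 0 < L by have := normc_ge0 l; rewrite /L; lra.
  have fL w : normc (w - c) < d -> normc (f w) <= L * normc (w - c).
    move=> /hd; rewrite fc0 subr0 => h.
    have -> : f w = (f w - l * (w - c)) + l * (w - c) by ring.
    by apply: le_trans (normcD _ _) _; rewrite normcM /L; lra.
  pose c0 := M ^+ n.+1 / rho ^+ n.
  have c00 : 0 < c0 by rewrite divr_gt0 ?exprn_gt0.
  (* The inner radius of the annulus: small enough that |f| <= L |w - c| applies and gives |V| <=
     L^(n+1) m <= c0 there, and at most t so that z stays in the annulus. *)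
  pose m := Num.min (d / 2) (Num.min t (c0 / L ^+ n.+1)).
  have m0 : 0 < m by rewrite !lt_min t0 !divr_gt0 ?exprn_gt0.
  have md : m < d by rewrite gt_min; apply/orP; left; lra.
  have mt : m <= t by rewrite !ge_min lexx orbT.
  have mL : L ^+ n.+1 * m <= c0.
    by rewrite mulrC -ler_pdivlMr ?exprn_gt0 // !ge_min lexx !orbT.
  pose X : set C := [set w | m <= normc (w - c) <= rho].
  pose V w := f w ^+ n.+1 / (w - c) ^+ n.
  have Xwc w : X w -> w - c != 0.
    by move=> /andP[h _]; rewrite -normc_gt0; exact: lt_le_trans h.
  have Vd w : w - c != 0 -> normc (w - c) < r -> cderivable V w.
    move=> wc wr; apply: cderivable_div; first by rewrite expf_neq0.
      by apply: cderivableX; exact: df.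
    by apply: cderivableX; apply: cderivableB; [exact: cderivable_id|exact: cderivable_cst].
  have nV w : normc (V w) = normc (f w) ^+ n.+1 / normc (w - c) ^+ n.
    by rewrite /V normc_div !normcX.
  rewrite -[leLHS]nV; apply: (@max_principle _ X (rho + normc c)); first exact: ltW.
  - move=> p hp; apply/andP; split; rewrite leNgt; apply/negP.
      rewrite -subr_gt0 => /hp[w /andP[w1 w2] wp].
      by have := normc_triangle p w c; lra.
    rewrite -subr_gt0 => /hp[w /andP[w1 w2] wp].
    by have := normc_triangle w p c; rewrite (normcBC p w); lra.
  - by move=> w /andP[_ h]; rewrite -(subrK c w); apply: le_trans (normcD _ _) _; rewrite lerD2r.
  - move=> w Xw; have [l' h] : cderivable V w; last exact: cdiff_cont h.
    by apply: Vd; [exact: Xwc|case/andP: Xw => _ h; exact: le_lt_trans rhor].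
  - move=> p /[dup] Xp /andP[mp prho]; have p0 := Xwc p Xp.
    have np0 : 0 < normc (p - c) by rewrite normc_gt0.
    have [pe|pne] := eqVneq (normc (p - c)) rho.
      left; rewrite nV pe ler_wpM2r ?invr_ge0 ?exprn_ge0 ?(ltW rho0) //.
      rewrite ler_pXn2r ?nnegrE ?normc_ge0 ?(ltW M0) // fM // pe //.
    have [pm|pnm] := eqVneq (normc (p - c)) m.
      left; rewrite nV; apply: le_trans mL; rewrite ler_pdivrMr ?exprn_gt0 //.
      have /fL : normc (p - c) < d by rewrite pm.
      rewrite pm -mulrA -exprS -exprMn => h.
      by rewrite ler_pXn2r ?nnegrE ?normc_ge0 ?mulr_ge0 // ltW.
    have h1 : normc (p - c) < rho by rewrite lt_neqAle pne.
    have h2 : m < normc (p - c) by rewrite lt_neqAle eq_sym pnm.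
    right; exists (Num.min ((rho - normc (p - c)) / 2) ((normc (p - c) - m) / 2)).
      by rewrite lt_min !divr_gt0 // subr_gt0.
    have sub w : cball p (Num.min ((rho - normc (p - c)) / 2) ((normc (p - c) - m) / 2)) w -> X w.
      rewrite /cball /= le_min => /andP[w1 w2]; apply/andP; split.
        by have := normc_triangle w p c; rewrite (normcBC p w); lra.
      by have := normc_triangle p w c; lra.
    split => // w /sub Xw; apply: Vd; first exact: Xwc.
    by case/andP: Xw => _ h; exact: le_lt_trans rhor.
  by rewrite /X /= mt ltW.
have claim2 (rho : R) : t < rho -> rho < r -> normc (f z) * rho <= M * t.
  move=> trho rhor; have rho0 : 0 < rho by exact: lt_trans trho.
  have Mt0 : 0 < M * t by rewrite mulr_gt0.
  suff : normc (f z) * rho / (M * t) <= 1 by rewrite ler_pdivrMr // mul1r.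
  (* By [claim] the power of exponent n + 1 is at most rho / t, whatever n; the entry 1 covers
     exponent 0. *)
  apply: (@bounded_powers_le1 _ (Num.max 1 (rho / t))) => -[|n].
    by rewrite expr0 le_max lexx.
  rewrite le_max; apply/orP; right.
  have := claim rho n trho rhor; rewrite ler_pdivrMr ?exprn_gt0 // => h.
  rewrite expr_div_n !exprMn ler_pdivrMr ?mulr_gt0 ?exprn_gt0 //.
  have h' := ler_wpM2r (exprn_ge0 n.+1 (ltW rho0)) h; apply: (le_trans h').
  suff -> : M ^+ n.+1 / rho ^+ n * t ^+ n * rho ^+ n.+1 =
     rho / t * (M ^+ n.+1 * t ^+ n.+1) by [].
  rewrite 2![in RHS]exprS [rho ^+ n.+1]exprS [M ^+ n.+1]exprS; field.
  by rewrite gt_eqF //= expf_neq0 // gt_eqF.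
rewrite ler_pdivlMr //; apply/ler_addgt0Pr => e e0.
have K0 : 0 < normc (f z) + 1 by have := normc_ge0 (f z); lra.
pose rho := Num.max ((t + r) / 2) (r - e / (normc (f z) + 1)).
have rho1 : t < rho by rewrite lt_max; apply/orP; left; lra.
have ee : 0 < e / (normc (f z) + 1) by rewrite divr_gt0.
have rho2 : rho < r by rewrite gt_max; apply/andP; split; lra.
have := claim2 rho rho1 rho2.
have h : r - rho <= e / (normc (f z) + 1).
  by rewrite lerBlDr -lerBlDl le_max lexx orbT.
have h2 : (r - rho) * normc (f z) <= e.
  apply: (@le_trans _ _ ((r - rho) * (normc (f z) + 1))).
    by rewrite ler_wpM2l ?lerDl // subr_ge0 ltW.
  by rewrite -ler_pdivlMr.
move: h2; rewrite mulrBl (mulrC r) (mulrC rho); lra.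
Qed.

Lemma cauchy_lipschitz f c r M : 0 < r ->
  (forall z, normc (z - c) < r -> cderivable f z) ->
  (forall z, normc (z - c) < r -> normc (f z) <= M) ->
  forall z, normc (z - c) < r -> normc (f z - f c) <= 2 * M / r * normc (z - c).
Proof.
move=> r0 df fM z zr; have cr : normc (c - c) < r by rewrite subrr normc0.
have M0 : 0 <= M by apply: le_trans (fM c cr).
have H e : 0 < e -> normc (f z - f c) * r <= 2 * M * normc (z - c) + e.
  (* The slack s makes the bound 2M + s positive even if M = 0, and costs at most e because |z - c|
     < r. *)
  move=> e0; pose s := e / (r + 1); have s0 : 0 < s by rewrite divr_gt0 //; lra.
  have M10 : 0 < 2 * M + s by lra.
  have := @schwarz (fun w => f w - f c) c r (2 * M + s) r0 M10 (subrr _) _ _ z zr.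
  rewrite ler_pdivlMr // => h; apply: (le_trans (h _ _)).
  - by move=> w wr; apply: cderivableB; [exact: df|exact: cderivable_cst].
  - by move=> w wr; apply: le_trans (normcB _ _) _; have := fM w wr; have := fM c cr; lra.
  rewrite mulrDl lerD2l /s mulrAC ler_pdivrMr; last lra.
  by rewrite ler_pM2l //; lra.
rewrite mulrAC ler_pdivlMr //; apply/ler_addgt0Pr; exact: H.
Qed.

Lemma cauchy_estimate f c r M l : 0 < r ->
  (forall z, normc (z - c) < r -> cderivable f z) ->
  (forall z, normc (z - c) < r -> normc (f z) <= M) ->
  cdiff f c l -> normc l <= 2 * M / r.
Proof.
move=> r0 df fM /cdiffP dl; apply/ler_addgt0Pr => e e0.
have [d d0 hd] := dl e e0; pose t := Num.min d r / 2.
have m0 : 0 < Num.min d r by rewrite lt_min d0.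
have t0 : 0 < t by rewrite divr_gt0.
have [td tr] : t < d /\ t < r.
  have : t < Num.min d r by rewrite /t; lra.
  by rewrite lt_min => /andP[].
have nt : normc (c + t%:C - c) = t by rewrite addrAC subrr add0r normcC gtr0_norm.
have := hd (c + t%:C); rewrite nt => /(_ td) h1.
have := cauchy_lipschitz r0 df fM (z := c + t%:C); rewrite nt => /(_ tr) h2.
rewrite -(ler_pM2r t0) mulrDl.
have -> : normc l * t = normc (l * (c + t%:C - c)) by rewrite normcM nt.
have -> : l * (c + t%:C - c) =
   (f (c + t%:C) - f c) - (f (c + t%:C) - f c - l * (c + t%:C - c)) by ring.
by apply: le_trans (normcB _ _) _; exact: lerD.
Qed.

Lemma lipschitz_on_cball f c r : 0 < r -> (forall z, cball c (2 * r) z -> cderivable f z) ->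
  exists2 L, 0 < L & forall z w, cball c r z -> normc (w - z) < r ->
    normc (f w - f z) <= L * normc (w - z).
Proof.
move=> r0 df; have r20 : 0 <= 2 * r by lra.
have [M M0 hM] := bounded_on_cball r20 (fun z zr => let: ex_intro _ h := df z zr in cdiff_cont h).
have sub z w : cball c r z -> normc (w - z) < r -> cball c (2 * r) w.
  by rewrite /cball /= => h1 h2; have := normc_triangle z w c; lra.
exists (2 * M / r); first by rewrite divr_gt0 // mulr_gt0.
move=> z w zr; apply: cauchy_lipschitz => //.
  by move=> v vz; exact: df (sub _ _ zr vz).
by move=> v vz; exact: hM (sub _ _ zr vz).
Qed.

Lemma cdiffB f G z l m : cdiff f z l -> cdiff G z m -> cdiff (fun w => f w - G w) z (l - m).
Proof.
move=> df dG; have := cdiffD df (cdiffM (cdiff_cst (-1) z) dG).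
by under eq_fun do rewrite mulN1r; rewrite mul0r add0r mulN1r.
Qed.

Lemma cdiff_quotient f z h : h != 0 -> cderivable f z -> cderivable f (z + h) ->
  cdiff (fun w => (f (w + h) - f w) / h) z ((derive1 f (z + h) - derive1 f z) / h).
Proof.
move=> h0 /cderivable_cdiff dz /cderivable_cdiff dh.
have sh : cdiff (fun w => w + h) z 1.
  by have := cdiffD (cdiff_id z) (cdiff_cst h z); rewrite addr0.
have d1 := cdiff_comp sh dh; rewrite mulr1 in d1.
have := cdiffM (cdiffB d1 dz) (cdiff_cst h^-1 z).
by rewrite mulr0 addr0.
Qed.

(* The difference quotients [(F (. + h) - F) / h] of a primitive [F] of [f] are
   uniformly Cauchy as [h -> 0]; two applications of Cauchy's estimate transfer this to
   the difference quotients of the derivative of [f]. *)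
Lemma cderivable_derive1 f c (r0 : R) : 0 < r0 -> (forall z, cball c r0 z -> cderivable f z) ->
  cderivable (derive1 f) c.
Proof.
move=> r00 df; have [F pF] : exists F, primitive_on f c r0 F.
  exact: primitive_exists (ltW r00) df.
(* Room for the Lipschitz bound on radius 4 r, which uses the disk of radius 8 r, and for the two
   later losses of radius r together with the shift by h. *)
pose r := r0 / 8; have r_gt0 : 0 < r by rewrite divr_gt0.
have r0E : r0 = 8 * r by rewrite /r; lra.
have [L L0 hL] : exists2 L : R, 0 < L & forall z w, cball c (4 * r) z ->
    normc (w - z) < 4 * r -> normc (f w - f z) <= L * normc (w - z).
  apply: lipschitz_on_cball; first by lra.
  by move=> z; rewrite /cball /= => h; apply: df; rewrite /cball /= r0E; lra.
pose D (G : C -> C) h z := (G (z + h) - G z) / h.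
have est1 h z : h != 0 -> normc h < r -> cball c (3 * r) z ->
    normc (D F h z - f z) <= L * normc h.
  move=> h0 hr; rewrite /cball /= => zc; apply: primitive_diff pF _ _ h0 _.
  - by rewrite /cball /= r0E; lra.
  - rewrite /cball /= r0E; have -> : z + h - c = (z - c) + h by ring.
    by apply: le_trans (normcD _ _) _; lra.
  move=> w _ wz; apply: le_trans (hL _ _ _ _) _; [by rewrite /cball /=; lra|by lra|].
  by rewrite ler_pM2l.
have dF z : normc (z - c) < r0 -> cdiff F z (f z).
  move=> zc; apply/cdiffP => e e0.
  have fz : ccont f z by have [l /cdiff_cont] := df z (ltW zc).
  have [d d0 hd] := (ccontP f z).1 fz e e0.
  have rz : 0 < r0 - normc (z - c) by rewrite subr_gt0.
  exists (Num.min d (r0 - normc (z - c))); first by rewrite lt_min d0.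
  move=> w; rewrite lt_min => /andP[w1 w2].
  have [->|wz] := eqVneq w z; first by rewrite !subrr mulr0 subrr normc0 mulr0.
  have wz0 : w - z != 0 by rewrite subr_eq0.
  have := primitive_diff (k := w - z) (e := e) pF (ltW zc) _ wz0.
  rewrite subrKC => h.
  have -> : F w - F z - f z * (w - z) = ((F w - F z) / (w - z) - f z) * (w - z) by field.
  rewrite normcM ler_wpM2r //; apply: h.
    by rewrite /cball /=; have := normc_triangle z w c; lra.
  by move=> v _ vz; apply: ltW; apply: hd; exact: le_lt_trans w1.
have dDF h z : h != 0 -> normc h < r -> normc (z - c) < 3 * r ->
    cdiff (D F h) z (D f h z).
  move=> h0 hr zc; have h1 : normc (z - c) < r0 by rewrite r0E; lra.
  have h2 : normc (z + h - c) < r0.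
    by rewrite r0E addrAC; apply: le_lt_trans (normcD _ _) _; lra.
  have := @cdiff_quotient F z h h0 (ex_intro _ _ (dF _ h1)) (ex_intro _ _ (dF _ h2)).
  by rewrite (cdiff_derive1 (dF _ h1)) (cdiff_derive1 (dF _ h2)).
have dDf h z : h != 0 -> normc h < r -> normc (z - c) < 3 * r ->
    cdiff (D f h) z (D (derive1 f) h z).
  move=> h0 hr zc; apply: cdiff_quotient => //; apply: df; rewrite /cball /= r0E; first lra.
  by rewrite addrAC; apply: le_trans (normcD _ _) _; lra.
(* Two quotients of F differ by at most 2 L d by [est1]. Each use of Cauchy's estimate
   differentiates once and costs a factor 2 / r: 4 L d / r here, 8 L d / r^2 in [est3]. *)
have est2 h (k : C) (d : R) : h != 0 -> k != 0 -> normc h < r -> normc k < r -> normc h <= d ->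
    normc k <= d -> forall z, cball c r z -> normc (D f h z - D f k z) <= 4 * L * d / r.
  move=> h0 k0 hr kr hd kd z; rewrite /cball /= => zc.
  have sub w : normc (w - z) < r -> normc (w - c) < 3 * r.
    by move=> wz; have := normc_triangle z w c; lra.
  have -> : 4 * L * d / r = 2 * (2 * L * d) / r by ring.
  apply: (@cauchy_estimate (fun w => D F h w - D F k w) z) => //.
  - move=> w /sub wc; apply: cderivableB; first by exists (D f h w); exact: dDF.
    by exists (D f k w); exact: dDF.
  - move=> w /sub /ltW wc; apply: le_trans (normc_triangle (f w) _ _) _.
    rewrite (normcBC (f w)); have := est1 h w h0 hr wc; have := est1 k w k0 kr wc.
    have := ler_wpM2l (ltW L0) hd; have := ler_wpM2l (ltW L0) kd; lra.
  have zr : normc (z - z) < r by rewrite subrr normc0.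
  exact: cdiffB (dDF h z h0 hr (sub _ zr)) (dDF k z k0 kr (sub _ zr)).
have est3 h (k : C) (d : R) : h != 0 -> k != 0 -> normc h < r -> normc k < r -> normc h <= d ->
    normc k <= d -> normc (D (derive1 f) h c - D (derive1 f) k c) <= 8 * L / r ^+ 2 * d.
  move=> h0 k0 hr kr hd kd.
  have sub w : normc (w - c) < r -> normc (w - c) < 3 * r by lra.
  have -> : 8 * L / r ^+ 2 * d = 2 * (4 * L * d / r) / r by field; rewrite gt_eqF.
  apply: (@cauchy_estimate (fun w => D f h w - D f k w) c) => //.
  - move=> w /sub wc; apply: cderivableB; first by exists (D (derive1 f) h w); exact: dDf.
    by exists (D (derive1 f) k w); exact: dDf.
  - by move=> w /ltW wc; exact: est2.
  have cr : normc (c - c) < r by rewrite subrr normc0.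
  exact: cdiffB (dDf h c h0 hr (sub _ cr)) (dDf k c k0 kr (sub _ cr)).
pose K := 8 * L / r ^+ 2; have K0 : 0 < K by rewrite divr_gt0 ?mulr_gt0 ?exprn_gt0.
pose s n : C := (r / n.+2%:R)%:C.
have ns n : normc (s n) = r / n.+2%:R by rewrite normcC gtr0_norm // divr_gt0.
have s0 n : s n != 0 by rewrite -normc_gt0 ns divr_gt0.
have sr n : normc (s n) < r by rewrite ns ltr_pdivrMr // ltr_pMr // ltr1n.
have slim (d : R) : 0 < d -> exists N, forall n, (N <= n)%N -> normc (s n) <= d.
  move=> d0; exists (Num.truncn (r / d)).+1 => n Nn; rewrite ns ler_pdivrMr //.
  rewrite mulrC -ler_pdivrMr //; apply: le_trans (ltW (truncnS_gt _)) _.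
  by rewrite ler_nat (leq_trans Nn) // ltnW.
have [|l hl] := @cauchy_seq_cvg _ (fun n => D (derive1 f) (s n) c).
  move=> e e0; have [N hN] := slim (e / K) (divr_gt0 e0 K0); exists N => i j Ni Nj.
  apply: le_trans (est3 _ _ _ (s0 i) (s0 j) (sr i) (sr j) (hN _ Ni) (hN _ Nj)) _.
  by rewrite -/K mulrC divfK // gt_eqF.
exists l; apply/cdiffP => e e0.
exists (Num.min r (e / K / 2)); first by rewrite lt_min r_gt0 divr_gt0 // divr_gt0.
move=> w; rewrite lt_min => /andP[w1 w2].
have [->|wc] := eqVneq w c; first by rewrite !subrr mulr0 subrr normc0 mulr0.
have wc0 : w - c != 0 by rewrite subr_eq0.
suff h : normc (D (derive1 f) (w - c) c - l) <= e.
  have -> : derive1 f w - derive1 f c - l * (w - c) =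
     (D (derive1 f) (w - c) c - l) * (w - c).
    by rewrite /D subrKC; move: (derive1 f w) (derive1 f c) => u v; field.
  by rewrite normcM ler_wpM2r.
have eK : 0 < e / K / 2 by rewrite divr_gt0 // divr_gt0.
have [N1 hN1] := slim _ eK; have [N2 hN2] := hl (e / 2) (divr_gt0 e0 (ltr0Sn _ 1)).
pose n := maxn N1 N2.
apply: le_trans (normc_triangle (D (derive1 f) (s n) c) _ _) _.
have := est3 _ _ _ wc0 (s0 n) w1 (sr n) (ltW w2) (hN1 n (leq_maxl _ _)).
have := hN2 n (leq_maxr _ _).
have -> : 8 * L / r ^+ 2 * (e / K / 2) = e / 2.
  by rewrite -/K; field; rewrite gt_eqF.
lra.
Qed.

End CauchyEstimates.

(** * Schwarz-Pick, Harnack and Julia inequalities *)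

Section SchwarzPick.
Context {R : realType}.
Local Notation C := (R[i]^o).
Local Notation Re := complex.Re.
Local Notation Im := complex.Im.
Implicit Types (z w a b u : C) (f p phi : C -> C) (e K M : R).

Definition disk_holo f := forall z, normc z < 1 -> cderivable f z.

Lemma normc_sqr_lt1 z : (normc z < 1) = (0 < 1 - normc z ^+ 2).
Proof. by rewrite subr_gt0 expr_lt1. Qed.

(** Divided by the first term, it computes 1 minus the squared modulus of the disk automorphism
    vanishing at a. *)
Lemma pick_identity a z :
  normc (1 - a^* * z) ^+ 2 - normc (z - a) ^+ 2 = (1 - normc a ^+ 2) * (1 - normc z ^+ 2).
Proof. rewrite !sqr_normcE !ReImE; ring. Qed.

Lemma normc_le_of_sqr z w : normc z ^+ 2 <= normc w ^+ 2 -> normc z <= normc w.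
Proof. by rewrite ler_sqr ?nnegrE. Qed.

Lemma pick_denom_gt0 a z : normc a < 1 -> normc z < 1 -> 0 < normc (1 - a^* * z) ^+ 2.
Proof.
rewrite !normc_sqr_lt1 => a1 z1; have := pick_identity a z.
by have := mulr_gt0 a1 z1; have := sqr_ge0 (normc (z - a)); lra.
Qed.

Lemma pick_denom_neq0 a z : normc a < 1 -> normc z < 1 -> 1 - a^* * z != 0.
Proof.
move=> a1 z1; apply/negP => /eqP h; have := pick_denom_gt0 a1 z1.
by rewrite h normc0 expr0n ltxx.
Qed.

Lemma pick_factor_lt1 a z : normc a < 1 -> normc z < 1 ->
  normc ((z - a) / (1 - a^* * z)) < 1.
Proof.
move=> a1 z1; rewrite normc_sqr_lt1 normc_div expr_div_n.
have d0 := pick_denom_gt0 a1 z1; rewrite subr_gt0 ltr_pdivrMr // mul1r -subr_gt0 pick_identity.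
by rewrite mulr_gt0 // -normc_sqr_lt1.
Qed.

Lemma pick_factor_diff a z : normc a < 1 -> normc z < 1 ->
  cderivable (fun w => (w - a) / (1 - a^* * w)) z.
Proof.
move=> a1 z1; apply: cderivable_div; first exact: pick_denom_neq0.
  by apply: cderivableB; [exact: cderivable_id|exact: cderivable_cst].
apply: cderivableB; first exact: cderivable_cst.
by apply: cderivableM; [exact: cderivable_cst|exact: cderivable_id].
Qed.

(** Schwarz's lemma for [phi] composed with the automorphism T, which sends 0 to a. *)
Lemma schwarz_pick0 phi a z : disk_holo phi -> (forall w, normc w < 1 -> normc (phi w) <= 1) ->
  normc a < 1 -> phi a = 0 -> normc z < 1 ->
  normc (phi z) <= normc ((z - a) / (1 - a^* * z)).
Proof.
move=> dphi phi1 a1 phia z1.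
have na1 : normc (- a) < 1 by rewrite normcN.
pose T u := (u + a) / (1 + a^* * u).
have TE : T = fun u => (u - (- a)) / (1 - (- a)^* * u).
  apply/funext => u; rewrite /T opprK; congr (_ / _).
  by apply: eqC; rewrite !ReImE; ring.
have T1 u : normc u < 1 -> normc (T u) < 1 by rewrite TE; exact: pick_factor_lt1.
have zE : T ((z - a) / (1 - a^* * z)) = z.
  have d0 := pick_denom_neq0 a1 z1.
  have d1 : 1 - a^* * a != 0 by exact: pick_denom_neq0.
  rewrite /T; field; rewrite d0 /=.
  have -> : 1 - a^* * z + a^* * (z - a) = 1 - a^* * a by ring.
  exact: d1.
have := @schwarz _ (fun u => phi (T u)) 0 1 1 ltr01 ltr01.
have -> : T 0 = a by rewrite /T mulr0 addr0 divr1 add0r.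
move=> /(_ phia) h.
have {}h := h _ _ ((z - a) / (1 - a^* * z)); rewrite zE subr0 mul1r divr1 in h.
apply: h; last exact: pick_factor_lt1.
  move=> u; rewrite subr0 => u1; apply: cderivable_comp; first by rewrite TE; exact: pick_factor_diff.
  by apply: dphi; exact: T1.
by move=> u; rewrite subr0 => u1; apply: phi1; exact: T1.
Qed.

(** Clearing denominators by [pick_identity] gives a form in which a can be sent to the boundary, as
    is done in [julia]. *)
Lemma schwarz_pick f a z : disk_holo f -> (forall w, normc w < 1 -> normc (f w) < 1) ->
  normc a < 1 -> normc z < 1 ->
  (1 - normc a ^+ 2) * (1 - normc z ^+ 2) * normc (1 - (f a)^* * f z) ^+ 2 <=
  (1 - normc (f a) ^+ 2) * (1 - normc (f z) ^+ 2) * normc (1 - a^* * z) ^+ 2.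
Proof.
move=> df f1 a1 z1; have fa1 := f1 a a1; have fz1 := f1 z z1.
pose phi w := (f w - f a) / (1 - (f a)^* * f w).
have h : normc (phi z) <= normc ((z - a) / (1 - a^* * z)).
  apply: schwarz_pick0 => //.
  - move=> w w1; apply: (@cderivable_comp _ (fun v => (v - f a) / (1 - (f a)^* * v)) f).
      exact: df.
    by apply: pick_factor_diff => //; exact: f1.
  - by move=> w w1; apply: ltW; apply: pick_factor_lt1 => //; exact: f1.
  - by rewrite /phi subrr mul0r.
have d1 := pick_denom_gt0 a1 z1; have d2 := pick_denom_gt0 fa1 fz1.
have : normc (phi z) ^+ 2 <= normc ((z - a) / (1 - a^* * z)) ^+ 2.
  by rewrite ler_sqr ?nnegrE.
rewrite !normc_div !expr_div_n ler_pdivrMr // mulrAC ler_pdivlMr // => H.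
rewrite -!pick_identity; move: H.
move: (normc (1 - a^* * z) ^+ 2) (normc (1 - (f a)^* * f z) ^+ 2) (normc (z - a) ^+ 2)
  (normc (f z - f a) ^+ 2) => A B x y; lra.
Qed.

(** A Cayley map takes the half plane to the disk and p a to 0. Schwarz-Pick with pseudo-hyperbolic
    distance rho then gives |q| <= Re (p a) (1 + rho) / (1 - rho) <= 4 Re (p a) / (1 - rho^2).
    Adding a small e first makes the real part strictly positive. *)
Lemma harnack p a z : disk_holo p -> (forall w, normc w < 1 -> 0 <= Re (p w)) ->
  normc a < 1 -> normc z < 1 ->
  normc (p z - (0 +i* Im (p a))) * ((1 - normc a ^+ 2) * (1 - normc z ^+ 2)) <=
  4 * Re (p a) * normc (1 - a^* * z) ^+ 2.
Proof.
move=> dp p0 a1 z1.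
set W := (X in _ * X <= _); set V := normc (1 - _) ^+ 2.
have V0 : 0 < V by exact: pick_denom_gt0.
have W0 : 0 < W by rewrite mulr_gt0 // -normc_sqr_lt1.
set q := p z - _.
have key e : 0 < e -> normc (q + e%:C) * W <= 4 * (Re (p a) + e) * V.
  move=> e0; pose P w := p w + e%:C.
  have P0 w : normc w < 1 -> 0 < Re (P w) by move=> /p0; rewrite /P ReD ReC; lra.
  have dP : disk_holo P by move=> w w1; apply: cderivableD; [exact: dp|exact: cderivable_cst].
  have nd w : normc w < 1 -> P w + (P a)^* != 0.
    move=> w1; apply/negP => /eqP h.
    have : Re (P w + (P a)^*) = 0 by rewrite h.
    by rewrite ReD ReJ; have := P0 w w1; have := P0 a a1; lra.
  have id4 w : normc (P w + (P a)^*) ^+ 2 - normc (P w - P a) ^+ 2 = 4 * Re (P w) * Re (P a).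
    by rewrite !sqr_normcE !ReImE; ring.
  pose phi w := (P w - P a) / (P w + (P a)^*).
  have h : normc (phi z) <= normc ((z - a) / (1 - a^* * z)).
    apply: schwarz_pick0 => //.
    - move=> w w1; apply: cderivable_div; first exact: nd.
        by apply: cderivableB; [exact: dP|exact: cderivable_cst].
      by apply: cderivableD; [exact: dP|exact: cderivable_cst].
    - move=> w w1; rewrite /phi normc_div ler_pdivrMr ?normc_gt0 ?nd // mul1r.
      apply: normc_le_of_sqr; rewrite -subr_ge0 id4 !mulr_ge0 // ltW //; exact: P0.
    - by rewrite /phi subrr mul0r.
  set rho := normc ((z - a) / (1 - a^* * z)) in h.
  have rho1 : rho < 1 by exact: pick_factor_lt1.
  have rho0 : 0 <= rho by exact: normc_ge0.
  have rhoE : (1 - rho ^+ 2) * V = W.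
    by rewrite /rho /W -pick_identity -/V normc_div expr_div_n -/V; field; rewrite gt_eqF.
  pose al := Re (P a); have al0 : 0 < al by exact: P0.
  have q1 : P z - P a = (q + e%:C) - al%:C.
    by apply: eqC; rewrite /q /al /P !ReImE /=; ring.
  have q2 : P z + (P a)^* = (q + e%:C) + al%:C.
    by apply: eqC; rewrite /q /al /P !ReImE /=; ring.
  have nal : normc (al%:C : C) = al by rewrite normcC gtr0_norm.
  have h2 : normc (q + e%:C) - al <= rho * (normc (q + e%:C) + al).
    apply: (@le_trans _ _ (normc (P z - P a))).
      by rewrite q1; have := normc_ler_sub (q + e%:C) al%:C; rewrite nal.
    apply: (@le_trans _ _ (rho * normc (P z + (P a)^*))).
      by move: h; rewrite /phi normc_div ler_pdivrMr ?normc_gt0 ?nd.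
    by rewrite ler_wpM2l // q2; have := normcD (q + e%:C) al%:C; rewrite nal.
  have -> : Re (p a) + e = al by rewrite /al /P ReD.
  rewrite -rhoE mulrA ler_pM2r //.
  have := normc_ge0 (q + e%:C); move: h2; move: (normc (q + e%:C)) => Q h2 Q0.
  have h3 : Q * (1 - rho) <= al * (1 + rho) by lra.
  have h4 : Q * (1 - rho) * (1 + rho) <= al * (1 + rho) * (1 + rho).
    by rewrite ler_wpM2r //; lra.
  have h5 : (1 + rho) * (1 + rho) <= 4 by nra.
  by have := ler_wpM2l (ltW al0) h5; lra.
apply/ler_addgt0Pr => e e0.
pose s := e / (W + 4 * V); have WV : 0 < W + 4 * V by lra.
have s0 : 0 < s by rewrite divr_gt0.
have sE : s * W + 4 * s * V = e by rewrite /s; field; rewrite gt_eqF.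
have := key s s0.
have : normc q <= normc (q + s%:C) + s.
  have -> : q = (q + s%:C) - s%:C by ring.
  rewrite addrK; apply: le_trans (_ : normc ((q + s%:C) - s%:C) <= _).
    by rewrite addrK.
  by apply: le_trans (normcB _ _) _; rewrite normcC gtr0_norm.
move=> h1 h2; have := ler_wpM2r (ltW W0) h1; rewrite mulrDl; lra.
Qed.

(* [f] does not contract the hyperbolic distance to [zeta] too much along some
   sequence tending to [zeta]. *)
Definition julia_hyp f (zeta : C) K := forall d : R, 0 < d -> exists2 z,
  normc z < 1 & normc (z - zeta) < d /\ 1 - normc (f z) ^+ 2 <= K * (1 - normc z ^+ 2).

Lemma one_sub_sqr_le z (zeta : C) : normc zeta = 1 -> normc z < 1 ->
  1 - normc z ^+ 2 <= 2 * normc (z - zeta).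
Proof.
move=> zt z1; have := normc_ler_sub zeta z; rewrite zt (normcBC zeta).
by have := normc_ge0 z; nra.
Qed.

(** Apply Schwarz-Pick to z and points a tending to zeta, with om a cluster value of f a. The
    hypothesis bounds 1 - |f a|^2 by K (1 - |a|^2), and the vanishing factor 1 - |a|^2 cancels. *)
Lemma julia f zeta K : disk_holo f -> (forall w, normc w < 1 -> normc (f w) < 1) ->
  normc zeta = 1 -> 0 < K -> julia_hyp f zeta K ->
  exists2 om, normc om = 1 & forall z, normc z < 1 ->
   (1 - normc z ^+ 2) * normc (om - f z) ^+ 2 <=
    K * (1 - normc (f z) ^+ 2) * normc (zeta - z) ^+ 2.
Proof.
move=> df f1 zt K0 jh.
have /choice[s hs] : forall n : nat, exists z, [/\ normc z < 1, normc (z - zeta) < n.+1%:R^-1 &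
    1 - normc (f z) ^+ 2 <= K * (1 - normc z ^+ 2)].
  move=> n; have n0 : 0 < n.+1%:R^-1 :> R by rewrite invr_gt0.
  by have [z z1 [h1 h2]] := jh _ n0; exists z.
have s1 n : normc (s n) < 1 by have [] := hs n.
have [om hom] := bolzano_weierstrass (fun n => ltW (f1 _ (s1 n))).
have {hom} near e : 0 < e -> exists a, [/\ normc a < 1, normc (a - zeta) < e,
    normc (f a - om) < e & 1 - normc (f a) ^+ 2 <= K * (1 - normc a ^+ 2)].
  move=> e0; have [n Nn hn] := hom e (Num.truncn e^-1).+1 e0.
  have [a1 h1 h2] := hs n; exists (s n); split => //.
  apply: (lt_le_trans h1); rewrite invf_ple ?posrE //.
  apply: le_trans (ltW (truncnS_gt _)) _; rewrite ler_nat; exact: leqW.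
(* Along the sequence 1 - |f a| <= K (1 - |a|^2), which tends to 0. *)
have om1 : normc om = 1.
  apply/eqP; rewrite eq_le; apply/andP; split; apply/ler_addgt0Pr => e e0.
    have [a [a1 _ h _]] := near e e0; have := f1 a a1.
    by have := normc_ler_sub om (f a); rewrite (normcBC om); lra.
  have e'0 : 0 < e / (2 * K + 1) by rewrite divr_gt0 //; lra.
  have [a [a1 h1 h2 h3]] := near _ e'0.
  have h4 := one_sub_sqr_le zt a1; have h5 := normc_ler_sub (f a) om.
  have h6 : normc (f a) ^+ 2 <= normc (f a).
    by rewrite expr2 ler_piMr // ltW // f1.
  have h7 : K * (1 - normc a ^+ 2) <= K * (2 * (e / (2 * K + 1))).
    by rewrite ler_pM2l //; lra.
  have h8 : K * (2 * (e / (2 * K + 1))) + e / (2 * K + 1) = e.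
    by field; rewrite gt_eqF //; lra.
  lra.
exists om => // z z1.
(* Distances to the unimodular points om and zeta thus become limits of the denominators in
   Schwarz-Pick. *)
have conj_dist (u v : C) : normc u = 1 -> normc (u - v) = normc (1 - u^* * v).
  move=> u1; have -> : u - v = u * (1 - u^* * v).
    by rewrite mulrBr mulr1 mulrA mulc_conj u1 expr1n mul1r.
  by rewrite normcM u1 mul1r.
rewrite (conj_dist om (f z) om1) (conj_dist zeta z zt).
have z2 : 0 < 1 - normc z ^+ 2 by rewrite -normc_sqr_lt1.
have fz2 : 0 < 1 - normc (f z) ^+ 2 by rewrite -normc_sqr_lt1 f1.
have le2 (u v : C) : normc u <= 1 -> normc v <= 1 -> normc (1 - u^* * v) <= 2.
  move=> u1 v1; apply: le_trans (normcB _ _) _; rewrite normc1 normcM normc_conj.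
  by have := normc_ge0 u; have := normc_ge0 v; nra.
have fz1 := ltW (f1 z z1).
have X2 := le2 om (f z) _ fz1; have Y2 := le2 zeta z _ (ltW z1).
rewrite om1 in X2; rewrite zt in Y2; have {}X2 := X2 (lexx _); have {}Y2 := Y2 (lexx _).
(* Replacing f a by om and a by zeta changes each denominator by at most e. As both limits X, Y are
   at most 2 and e <= 1, (X - e)^2 >= X^2 - 4e when X >= e, and (Y + e)^2 <= Y^2 + 5e. *)
have key e : 0 < e -> e <= 1 ->
    (1 - normc z ^+ 2) * (normc (1 - om^* * f z) ^+ 2 - 4 * e) <=
    K * (1 - normc (f z) ^+ 2) * (normc (1 - zeta^* * z) ^+ 2 + 5 * e).
  move=> e0 e1; have [a [a1 h1 h2 h3]] := near e e0.
  have a2 : 0 < 1 - normc a ^+ 2 by rewrite -normc_sqr_lt1.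
  have := schwarz_pick df f1 a1 z1.
  have d1 : normc (1 - om^* * f z) - e <= normc (1 - (f a)^* * f z).
    have -> : 1 - (f a)^* * f z = (1 - om^* * f z) - (f a - om)^* * f z.
      by rewrite rmorphB; ring.
    have := normc_ler_sub (1 - om^* * f z) ((f a - om)^* * f z).
    rewrite normcM normc_conj; have := normc_ge0 (f a - om); have := normc_ge0 (f z); nra.
  have d2 : normc (1 - a^* * z) <= normc (1 - zeta^* * z) + e.
    have -> : 1 - a^* * z = (1 - zeta^* * z) - (a - zeta)^* * z.
      by rewrite rmorphB; ring.
    apply: le_trans (normcB _ _) _; rewrite lerD2l normcM normc_conj.
    by have := normc_ge0 (a - zeta); have := normc_ge0 z; nra.
  move: d1 d2 X2 Y2; have := normc_ge0 (1 - om^* * f z); have := normc_ge0 (1 - zeta^* * z).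
  have := normc_ge0 (1 - a^* * z); have := normc_ge0 (1 - (f a)^* * f z).
  move: (normc (1 - om^* * f z)) (normc (1 - zeta^* * z)) (normc (1 - a^* * z))
     (normc (1 - (f a)^* * f z)) => X Y Yn Xn Xn0 Yn0 Y0 X0 d1 d2 X2 Y2 sp.
  have Xs : X ^+ 2 - 4 * e <= Xn ^+ 2.
    have [Xe|Xe] := lerP e X; nra.
  have Ys : Yn ^+ 2 <= Y ^+ 2 + 5 * e by nra.
  move: a2 h3 sp z2 fz2; move: (1 - normc a ^+ 2) (1 - normc z ^+ 2) (1 - normc (f z) ^+ 2)
     (1 - normc (f a) ^+ 2) => A Z F FA a2 h3 sp z2 fz2.
  have s1' : A * (Z * Xn ^+ 2) <= A * (K * F * Yn ^+ 2).
    rewrite mulrA; apply: (le_trans sp).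
    have -> : A * (K * F * Yn ^+ 2) = (K * A) * (F * Yn ^+ 2) by ring.
    rewrite -mulrA ler_wpM2r // mulr_ge0 ?sqr_ge0 //; exact: ltW.
  rewrite ler_pM2l // in s1'.
  apply: (@le_trans _ _ (Z * Xn ^+ 2)); first by rewrite ler_pM2l.
  by apply: (le_trans s1'); rewrite ler_pM2l // mulr_gt0.
move: key; move: (normc (1 - om^* * f z) ^+ 2) (normc (1 - zeta^* * z) ^+ 2) => X Y key.
apply/ler_addgt0Pr => e e0.
pose Q := 4 * (1 - normc z ^+ 2) + 5 * (K * (1 - normc (f z) ^+ 2)).
have Q0 : 0 < Q by rewrite addr_gt0 // mulr_gt0 // mulr_gt0.
pose t := Num.min 1 (e / Q).
have sQ : t * Q <= e by rewrite -ler_pdivlMr // ge_min lexx orbT.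
have := key t; rewrite lt_min ltr01 divr_gt0 // ge_min lexx => /(_ isT isT).
move: sQ; rewrite /Q; move: (1 - normc z ^+ 2) (K * (1 - normc (f z) ^+ 2)) => Z F; nra.
Qed.

End SchwarzPick.

(** * Rules for angular limits *)

Section AngularLimit.
Context {R : realType}.
Local Notation C := (R[i]^o).
Implicit Types (z w u l m : C) (f g h : C -> C) (e M K : R).

Lemma unit_diskE z : unit_disk z <-> normc z < 1.
Proof. by rewrite /unit_disk /= normrC -[1]/(1%:C) ltcR. Qed.

Lemma unit_circleE z : unit_circle z <-> normc z = 1.
Proof.
rewrite /unit_circle /= normrC -[1]/(1%:C); split=> [/complexI//|-> //].
Qed.

Lemma stolz_regionE z (zeta : C) M :
  stolz_region zeta M z <-> normc z < 1 /\ normc (z - zeta) < M * (1 - normc z).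
Proof.
rewrite /stolz_region /= unit_diskE !normrC.
have -> : M%:C * (1 - (normc z)%:C) = (M * (1 - normc z))%:C :> C.
  by rewrite rmorphM rmorphB rmorph1.
by rewrite ltcR.
Qed.

Lemma angular_limitP g (zeta : C) l : angular_limit g zeta l <->
  forall M e, 1 < M -> 0 < e -> exists2 d : R, 0 < d & forall z, normc z < 1 ->
    normc (z - zeta) < M * (1 - normc z) -> normc (z - zeta) < d -> normc (g z - l) < e.
Proof.
split=> [h M e M1 e0|h M M1 P /nbhsCP[e e0 hP]].
  have /(h M M1)/nbhsCP[d d0 hd] : nbhs l [set w : C | normc (w - l) < e] by apply/nbhsCP; exists e.
  by exists d => // z z1 zM zd; apply: hd => //; apply/stolz_regionE.
have [d d0 hd] := h M e M1 e0; apply/nbhsCP; exists d => // z zd /stolz_regionE[z1 zM].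
by apply: hP; exact: hd.
Qed.

Lemma angular_limit_ext g h (zeta : C) l : (forall z, normc z < 1 -> g z = h z) ->
  angular_limit g zeta l -> angular_limit h zeta l.
Proof.
move=> gh /angular_limitP H; apply/angular_limitP => M e M1 e0.
by have [d d0 hd] := H M e M1 e0; exists d => // z z1 zM zd; rewrite -gh //; exact: hd.
Qed.

Lemma angular_limitD g h (zeta : C) l m : angular_limit g zeta l -> angular_limit h zeta m ->
  angular_limit (fun z => g z + h z) zeta (l + m).
Proof. by move=> gl hm M M1; exact: (cvgD (gl M M1) (hm M M1)). Qed.

Lemma angular_limitB g h (zeta : C) l m : angular_limit g zeta l -> angular_limit h zeta m ->
  angular_limit (fun z => g z - h z) zeta (l - m).
Proof. by move=> gl hm M M1; exact: (cvgB (gl M M1) (hm M M1)). Qed.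

Lemma angular_limitM g h (zeta : C) l m : angular_limit g zeta l -> angular_limit h zeta m ->
  angular_limit (fun z => g z * h z) zeta (l * m).
Proof. by move=> gl hm M M1; exact: (cvgM (gl M M1) (hm M M1)). Qed.

Lemma angular_limitV g (zeta : C) l : l != 0 -> angular_limit g zeta l ->
  angular_limit (fun z => (g z)^-1) zeta l^-1.
Proof. by move=> l0 gl M M1; exact: (cvgV l0 (gl M M1)). Qed.

Lemma angular_limit_normc g (zeta : C) l : angular_limit g zeta l ->
  angular_limit (fun z => (normc (g z))%:C) zeta (normc l)%:C.
Proof. by move=> gl M M1; exact: (cvg_norm (gl M M1)). Qed.

Lemma angular_limit_cst (zeta : C) l : angular_limit (fun=> l) zeta l.
Proof. by move=> M M1; exact: cvg_cst. Qed.

Lemma angular_limit_id (zeta : C) : angular_limit id zeta zeta.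
Proof.
by apply/angular_limitP => M e M1 e0; exists e.
Qed.

End AngularLimit.

(** * The Julia-Caratheodory theorem *)

Section JuliaCaratheodory.
Context {R : realType}.
Local Notation C := (R[i]^o).
Local Notation Re := complex.Re.
Local Notation Im := complex.Im.
Implicit Types (z w u l m om zeta : C) (f g h p : C -> C) (e M K : R).

Lemma Re_realM (x : R) z : Re (x%:C * z) = x * Re z.
Proof. by case: z => a b /=; ring. Qed.

Lemma Re_div z w : Re (z / w) = (Re z * Re w + Im z * Im w) / normc w ^+ 2.
Proof. by rewrite sqr_normcE; case: z w => [a b] [c d] /=; ring. Qed.

(** This is the Poisson kernel with pole [om], evaluated at w. *)
Lemma Re_cayley om w : normc om = 1 ->
  Re ((om + w) / (om - w)) = (1 - normc w ^+ 2) / normc (om - w) ^+ 2.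
Proof.
move=> om1; rewrite Re_div; congr (_ / _).
have : normc om ^+ 2 = 1 by rewrite om1 expr1n.
rewrite !sqr_normcE !ReImE => <-; ring.
Qed.

Lemma sub_circle_neq0 om w : normc om = 1 -> normc w < 1 -> om - w != 0.
Proof.
move=> om1 w1; rewrite subr_eq0; apply/eqP => h.
by move: w1; rewrite -h om1 ltxx.
Qed.

Lemma cayley_holo f om : normc om = 1 -> disk_holo f ->
  (forall z, normc z < 1 -> normc (f z) < 1) ->
  disk_holo (fun z => (om + f z) / (om - f z)).
Proof.
move=> om1 df f1 z z1; apply: cderivable_div; first by apply: sub_circle_neq0 => //; exact: f1.
  by apply: cderivableD; [exact: cderivable_cst|exact: df].
by apply: cderivableB; [exact: cderivable_cst|exact: df].
Qed.

(* Harnack's inequality centred at a point where [Re p] is much smaller than the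
   Poisson kernel. *)
Lemma angular_limit_small_re p zeta : normc zeta = 1 -> disk_holo p ->
  (forall z, normc z < 1 -> 0 <= Re (p z)) ->
  (forall e, 0 < e -> exists2 a, normc a < 1 &
     Re (p a) * normc (zeta - a) ^+ 2 <= e * (1 - normc a ^+ 2)) ->
  angular_limit (fun z => (zeta - z) * p z) zeta 0.
Proof.
move=> zt dp p0 hp; apply/angular_limitP => M e M1 e0.
have M0 : 0 < M by lra.
(* The 64 absorbs the 4 of [harnack], the 4 from |1 - conj(a) z|^2 <= 4 |zeta - a|^2, and leaves e /
   (4 M) as target. *)
have [a a1 ha] := hp (e / (64 * M)) (divr_gt0 e0 (mulr_gt0 (ltr0Sn _ _) M0)).
have d0 : 0 < normc (zeta - a) by rewrite normc_gt0; exact: sub_circle_neq0.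
pose b := `|Im (p a)|; have b0 : 0 <= b by exact: normr_ge0.
have b1 : 0 < 2 * (b + 1) by lra.
exists (Num.min (normc (zeta - a)) (e / (2 * (b + 1)))); first by rewrite lt_min d0 divr_gt0.
move=> z z1 zM; rewrite lt_min subr0 => /andP[zd1 zd2].
have := harnack dp p0 a1 z1; set q := p z - _.
have z2 : 1 - normc z <= 1 - normc z ^+ 2.
  by rewrite lerD2l lerN2 expr2 ler_piMr // ltW.
have a2 : 0 < 1 - normc a ^+ 2 by rewrite -normc_sqr_lt1.
have dist : normc (1 - a^* * z) <= 2 * normc (zeta - a).
  have -> : 1 - a^* * z = zeta * (zeta - a)^* - a^* * (z - zeta).
    have : zeta * zeta^* = 1 by rewrite mulc_conj zt expr1n.
    by rewrite rmorphB mulrBr => ->; ring.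
  apply: le_trans (normcB _ _) _; rewrite !normcM !normc_conj zt mul1r.
  by have := normc_ge0 (z - zeta); have := normc_ge0 a; nra.
move=> hq.
have nz0 := normc_ge0 (z - zeta).
have q1 : normc q * (1 - normc z ^+ 2) * (1 - normc a ^+ 2) <= e / (4 * M) * (1 - normc a ^+ 2).
  rewrite -mulrA (mulrC (1 - normc z ^+ 2)); apply: (le_trans hq).
  have h1 : normc (1 - a^* * z) ^+ 2 <= 4 * normc (zeta - a) ^+ 2.
    by have := normc_ge0 (1 - a^* * z); nra.
  apply: (@le_trans _ _ (4 * Re (p a) * (4 * normc (zeta - a) ^+ 2))).
    by rewrite ler_wpM2l // mulr_ge0 // p0.
  have -> : e / (4 * M) = 16 * (e / (64 * M)) by field; rewrite gt_eqF.
  by move: ha; move: (e / (64 * M)) (normc (zeta - a) ^+ 2) (Re (p a)) => x y v; lra.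
rewrite ler_pM2r // in q1.
have q2 : normc (z - zeta) * normc q <= e / 4.
  apply: (@le_trans _ _ (M * (1 - normc z ^+ 2) * normc q)).
    apply: ler_wpM2r; first exact: normc_ge0.
    apply: (@le_trans _ _ (M * (1 - normc z))); first exact: ltW.
    by rewrite ler_pM2l.
  have -> : e / 4 = M * (e / (4 * M)) by field; rewrite gt_eqF.
  by rewrite -mulrA ler_pM2l // mulrC.
(* The imaginary part of p a is fixed once a is, so closeness of z to zeta makes its contribution
   small. *)
have q3 : normc (z - zeta) * b <= e / 2.
  apply: (@le_trans _ _ (e / (2 * (b + 1)) * (b + 1))).
    by apply: ler_pM => //; [exact: ltW|lra].
  by rewrite le_eqVlt; apply/orP; left; apply/eqP; field; rewrite gt_eqF //; lra.
rewrite normcM (normcBC zeta).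
have -> : p z = q + (0 +i* Im (p a)) by rewrite /q subrK.
have := ler_wpM2l nz0 (normcD q (0 +i* Im (p a))).
by rewrite normc_xi mulrDr -/b; lra.
Qed.

(** Compare the Cayley transforms U of f and V of the identity. The largest multiple be V is
    subtracted from U that keeps the real part nonnegative, so the remainder is small against the
    Poisson kernel somewhere, and (zeta - z)(U - be V) has angular limit 0. All limits are read off
    from this. *)
Lemma julia_caratheodory f zeta K : disk_holo f ->
  (forall z, normc z < 1 -> normc (f z) < 1) -> normc zeta = 1 -> 0 < K -> julia_hyp f zeta K ->
  exists om l (be : R), [/\ normc om = 1, 0 < be, normc l = be^-1,
    angular_limit (fun z => (f z - om) / (z - zeta)) zeta l &
    angular_limit (fun z => ((1 - normc (f z) ^+ 2) / (1 - normc z ^+ 2))%:C) zeta be^-1%:C].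
Proof.
move=> df f1 zt K0 jh; have [om om1 hJ] := julia df f1 zt K0 jh.
pose U z := (om + f z) / (om - f z); pose V z := (zeta + z) / (zeta - z).
have z2 z : normc z < 1 -> 0 < 1 - normc z ^+ 2 by rewrite -normc_sqr_lt1.
have nf z : normc z < 1 -> 0 < normc (om - f z).
  by move=> z1; rewrite normc_gt0; apply: sub_circle_neq0 => //; exact: f1.
have nz z : normc z < 1 -> 0 < normc (zeta - z).
  by move=> z1; rewrite normc_gt0; exact: sub_circle_neq0.
have ReV z : normc z < 1 -> 0 < Re (V z).
  by move=> z1; rewrite /V Re_cayley // divr_gt0 ?exprn_gt0 ?z2 ?nz.
pose S := [set Re (U z) / Re (V z) | z in [set z | normc z < 1]].
have S0 : S !=set0 by exists (Re (U 0) / Re (V 0)); exists 0; rewrite // /mkset normc0.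
have lbS : lbound S K^-1.
  move=> _ [z /= z1 <-]; rewrite ler_pdivlMr ?ReV // /U /V !Re_cayley //.
  rewrite ler_pdivlMr ?exprn_gt0 ?nf // -mulrA ler_pdivrMl //.
  by rewrite mulrAC ler_pdivrMr ?exprn_gt0 ?nz //; exact: hJ.
have hinf : has_inf S by split => //; exists K^-1.
(* Julia's inequality is exactly the lower bound 1/K for the ratios in S, whence be > 0. *)
pose be := inf S.
have beK : K^-1 <= be by exact: lb_le_inf.
have be0 : 0 < be by apply: lt_le_trans beK; rewrite invr_gt0.
pose p z := U z - be%:C * V z.
have Rep z : Re (p z) = Re (U z) - be * Re (V z).
  by rewrite /p ReB Re_realM.
have dp : disk_holo p.
  move=> z z1; apply: cderivableB; first exact: (cayley_holo om1 df f1).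
  apply: cderivableM; first exact: cderivable_cst.
  apply: (cayley_holo (f := id) zt _ _ z1) => // w w1; exact: cderivable_id.
have p0 z : normc z < 1 -> 0 <= Re (p z).
  move=> z1; rewrite Rep subr_ge0 -ler_pdivlMr ?ReV //.
  by apply: ge_inf; [exists K^-1|exists z].
have hp e : 0 < e -> exists2 a, normc a < 1 &
     Re (p a) * normc (zeta - a) ^+ 2 <= e * (1 - normc a ^+ 2).
  move=> e0; have [_ [a a1 <-] h] := inf_adherent e0 hinf; exists a => //.
  rewrite -ler_pdivlMr ?exprn_gt0 ?nz // -mulrA -Re_cayley // -/(V a) Rep.
  move: h; rewrite -/be ltr_pdivrMr ?ReV //; lra.
have lim0 := angular_limit_small_re zt dp p0 hp.
have zt0 : zeta != 0 by rewrite -normc_gt0 zt.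
have be0C : be%:C != 0 :> C by rewrite -normc_gt0 normcC normr_gt0 gt_eqF.
have om0 : om != 0 by rewrite -normc_gt0 om1.
(* By the definitions of U, V and p this equals 2 om (zeta - z) / (om - f z), the inverse difference
   quotient up to a constant. *)
pose E z := (zeta - z) + ((zeta - z) * p z + be%:C * (zeta + z)).
have limz : angular_limit (fun z => zeta - z) zeta 0.
  have := angular_limitB (@angular_limit_cst _ zeta zeta) (@angular_limit_id _ zeta).
  by rewrite subrr.
have limE : angular_limit E zeta (be%:C * (zeta + zeta)).
  have := angular_limitD limz (angular_limitD lim0 (angular_limitM
    (@angular_limit_cst _ zeta be%:C)
    (angular_limitD (@angular_limit_cst _ zeta zeta) (@angular_limit_id _ zeta)))).
  by rewrite !add0r.
pose l := (om + om) * (be%:C * (zeta + zeta))^-1.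
have two0 : (1 + 1 : C) != 0 by rewrite -[1 + 1]/(2%:R : C) pnatr_eq0.
have zz0 : zeta + zeta != 0.
  have -> : zeta + zeta = zeta * (1 + 1) by ring.
  by rewrite mulf_neq0.
have nl : normc l = be^-1.
  rewrite /l !(normcM, normcV) normcC gtr0_norm //.
  have -> : om + om = om * 2%:R by ring.
  have -> : zeta + zeta = zeta * 2%:R by ring.
  by rewrite !normcM normc_nat om1 zt !mul1r; field; rewrite gt_eqF.
have limg : angular_limit (fun z => (f z - om) / (z - zeta)) zeta l.
  have ext z : normc z < 1 -> (om + om) * (E z)^-1 = (f z - om) / (z - zeta).
    move=> z1.
    have h1 : om - f z != 0 by rewrite -normc_gt0 nf.
    have h2 : zeta - z != 0 by rewrite -normc_gt0 nz.
    have EE : E z = (om + om) * ((zeta - z) / (om - f z)).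
      by rewrite /E /p /U /V; field; rewrite h1 h2.
    have h3 : om + om != 0.
      have -> : om + om = om * (1 + 1) by ring.
      by rewrite mulf_neq0.
    rewrite EE -[f z - om]opprB -[z - zeta]opprB invrN mulrNN.
    by field; rewrite h1 h2 h3.
  have E0 : be%:C * (zeta + zeta) != 0 by rewrite mulf_neq0.
  have := angular_limitM (@angular_limit_cst _ zeta (om + om)) (angular_limitV E0 limE).
  by move/(angular_limit_ext ext).
(* Here |zeta - z|^2 / (1 - |z|^2) <= M |zeta - z| in the Stolz region, so [lim0] controls Re p
   relative to the Poisson kernel. *)
have limr : angular_limit (fun z => (be + Re (p z) / Re (V z))%:C) zeta be%:C.
  apply/angular_limitP => M e M1 e0; have M0 : 0 < M by lra.
  have [d d0 hd] := (angular_limitP _ _ _).1 lim0 M (e / M) M1 (divr_gt0 e0 M0).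
  exists d => // z z1 zM zd; have := hd z z1 zM zd; rewrite subr0 normcM => h.
  have -> : (be + Re (p z) / Re (V z))%:C - be%:C = (Re (p z) / Re (V z))%:C :> C.
    by rewrite -rmorphB addrAC subrr add0r.
  rewrite normcC ger0_norm; last by rewrite divr_ge0 ?p0 // ltW // ReV.
  rewrite ltr_pdivrMr ?ReV // /V Re_cayley // mulrA ltr_pdivlMr ?exprn_gt0 ?nz //.
  have zz : 1 - normc z <= 1 - normc z ^+ 2.
    by rewrite lerD2l lerN2 expr2 ler_piMr // ltW.
  move: h; rewrite ltr_pdivlMr // => h.
  have Rp : Re (p z) <= normc (p z) by apply: le_trans (normc_Re _); exact: ler_norm.
  apply: (@le_lt_trans _ _ (normc (zeta - z) * normc (p z) * normc (zeta - z))).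
    move: (normc (zeta - z)) (normc (p z)) Rp => x y xy.
    have -> : x * y * x = y * x ^+ 2 by ring.
    by rewrite ler_wpM2r // sqr_ge0.
  apply: (@le_lt_trans _ _ (normc (zeta - z) * normc (p z) * (M * (1 - normc z ^+ 2)))).
    rewrite ler_wpM2l ?mulr_ge0 // normcBC (le_trans (ltW zM)) // ler_pM2l //.
  by rewrite mulrA ltr_pM2r // z2.
suff limq : angular_limit (fun z => ((1 - normc (f z) ^+ 2) / (1 - normc z ^+ 2))%:C) zeta
    be^-1%:C.
  exact: (ex_intro _ om (ex_intro _ l (ex_intro _ be (And5 om1 be0 nl limg limq)))).
(* The boundary ratio is the squared modulus of the difference quotient times Re U / Re V, with
   limit be^-2 be. *)
have := angular_limitM (angular_limitM (angular_limit_normc limg) (angular_limit_normc limg)) limr.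
have -> : (normc l)%:C * (normc l)%:C * be%:C = be^-1%:C :> C.
  by rewrite nl -!rmorphM; congr (_%:C); field; rewrite gt_eqF.
apply/angular_limit_ext => z z1; rewrite -!rmorphM; congr (_%:C).
have v0 := ReV z z1.
have -> : be + Re (p z) / Re (V z) = Re (U z) / Re (V z) by rewrite Rep; field; rewrite gt_eqF.
rewrite /U /V !Re_cayley // normc_div (normcBC (f z)) (normcBC z).
by field; rewrite !gt_eqF ?nf ?nz ?z2.
Qed.

End JuliaCaratheodory.

(** * Distortion, angular derivatives and the Julia hypothesis *)

Section HyperbolicDistortion.
Context {R : realType}.
Local Notation C := (R[i]^o).
Implicit Types (z w u l m om zeta : C) (f g h : C -> C) (e M K : R).

(** Cauchy's estimate for f - om - l (w - zeta) on the disk of radius (1 - |z|) / 2 about z, which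
    lies in the wider Stolz region of aperture 2M + 1. *)
Lemma angular_limit_derive1 f zeta om l : disk_holo f -> normc zeta = 1 ->
  angular_limit (fun z => (f z - om) / (z - zeta)) zeta l ->
  angular_limit (derive1 f) zeta l.
Proof.
move=> df zt /angular_limitP lim; apply/angular_limitP => M e M1 e0.
have M2 : 1 < 2 * M + 1 by lra.
have M10 : 0 < M + 1 by lra.
pose e' := e / (8 * (M + 1)); have e'0 : 0 < e' by rewrite divr_gt0 // mulr_gt0.
have [d d0 hd] := lim _ _ M2 e'0.
exists (d / 2); first by rewrite divr_gt0.
move=> z z1 zM zd.
pose r := (1 - normc z) / 2; have r0 : 0 < r by rewrite divr_gt0 // subr_gt0.
have zr : 1 - normc z <= normc (z - zeta).
  by have := normc_ler_sub zeta z; rewrite zt (normcBC zeta).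
have geo w : normc (w - z) < r -> [/\ normc w < 1,
    normc (w - zeta) < (2 * M + 1) * (1 - normc w), normc (w - zeta) < d &
    normc (w - zeta) <= (M + 1) * (1 - normc z)].
  move=> wz; have h1 := normc_ler_sub w z; have h2 := normc_triangle z w zeta.
  have h3 : normc w <= normc z + r by lra.
  have h4 : M * r <= M * (1 - normc w).
    by rewrite ler_pM2l; [rewrite /r in h3 *; lra|lra].
  by rewrite /r in wz h3 h4; split; lra.
pose k w := (f w - om) - l * (w - zeta).
have dk w : normc w < 1 -> cdiff k w (derive1 f w - l).
  move=> w1; have d1 := cderivable_cdiff (df w w1).
  have d2 := cdiffB d1 (cdiff_cst om w); rewrite subr0 in d2.
  have d3 := cdiffM (cdiff_cst l w) (cdiffB (cdiff_id w) (cdiff_cst zeta w)).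
  have := cdiffB d2 d3.
  by rewrite mul0r add0r subr0 mulr1.
have kb w : normc (w - z) < r -> normc (k w) <= e' * ((M + 1) * (1 - normc z)).
  move=> /geo[w1 wM wd wz]; have h := hd w w1 wM wd.
  have w0 : w - zeta != 0 by rewrite -oppr_eq0 opprB; exact: sub_circle_neq0.
  have -> : k w = ((f w - om) / (w - zeta) - l) * (w - zeta) by rewrite /k; field.
  rewrite normcM; apply: ler_pM => //; exact: ltW.
have := cauchy_estimate (f := k) (c := z) r0 _ kb (dk z z1).
have dk' w : normc (w - z) < r -> cderivable k w.
  by move=> /geo[w1 _ _ _]; exists (derive1 f w - l); exact: dk.
move=> /(_ dk') h; apply: (le_lt_trans h).
have -> : 2 * (e' * ((M + 1) * (1 - normc z))) / r = e / 2.
  by rewrite /e' /r; field; rewrite !gt_eqF // subr_gt0.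
by lra.
Qed.

Definition distortion f z : R := normc (derive1 f z) * ((1 - normc z ^+ 2) / (1 - normc (f z) ^+ 2)).

Lemma distortionE f z :
  (1 - `|z| ^+ 2) * (`|derive1 f z| / (1 - `|f z| ^+ 2)) = (distortion f z)%:C :> C.
Proof.
rewrite /distortion !normrC; move: (normc (derive1 f z)) (normc z) (normc (f z)) => x y v.
rewrite rmorphM fmorph_div !rmorphB !rmorphXn !rmorph1; ring.
Qed.

(** Both |f'| and (1 - |f|^2) / (1 - |z|^2) have angular limit 1/be, and the distortion is their
    quotient. *)
Lemma distortion_limit f zeta K : disk_holo f -> (forall z, normc z < 1 -> normc (f z) < 1) ->
  normc zeta = 1 -> 0 < K -> julia_hyp f zeta K ->
  [/\ has_finite_angular_derivative f zeta,
      exists2 om : C, unit_circle om & angular_limit f zeta om &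
      angular_limit (fun z => (distortion f z)%:C) zeta 1].
Proof.
move=> df f1 zt K0 jh.
have [om [l [be [om1 be0 nl lim1 lim2]]]] := julia_caratheodory df f1 zt K0 jh.
have uom : unit_circle om by apply/unit_circleE.
split.
- by exists om; [exact: uom|exists l].
- exists om; first exact: uom.
  have h := angular_limitB (@angular_limit_id _ zeta) (@angular_limit_cst _ zeta zeta).
  have := angular_limitD (angular_limitM lim1 h) (@angular_limit_cst _ zeta om).
  rewrite subrr mulr0 add0r; apply/angular_limit_ext => z z1.
  have z0 : z - zeta != 0 by rewrite -oppr_eq0 opprB; exact: sub_circle_neq0.
  by rewrite divfK // subrK.
have be0C : be^-1%:C != 0 :> C by rewrite -normc_gt0 normcC normr_gt0 gt_eqF // invr_gt0.
have lim3 := angular_limit_normc (angular_limit_derive1 df zt lim1).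
have e1 : (normc l)%:C / be^-1%:C = 1 :> C by rewrite nl divff.
have := angular_limitM lim3 (angular_limitV be0C lim2).
rewrite e1; apply/angular_limit_ext => z z1; rewrite /distortion.
move: (normc (derive1 f z)) (1 - normc (f z) ^+ 2) (1 - normc z ^+ 2) => x y v.
by rewrite [RHS]rmorphM !fmorph_div invf_div.
Qed.

Lemma stolz_radius zeta (t M : R) : normc zeta = 1 -> 0 < t < 1 -> 1 < M ->
  let z : C := (1 - t)%:C * zeta in
  [/\ normc z < 1, normc z = 1 - t, normc (z - zeta) = t & normc (z - zeta) < M * (1 - normc z)].
Proof.
move=> zt /andP[t0 t1] M1 z.
have nz : normc z = 1 - t by rewrite normcM zt mulr1 normcC gtr0_norm //; lra.
have nzz : normc (z - zeta) = t.
  have -> : z - zeta = (- t)%:C * zeta by rewrite /z rmorphB rmorph1 rmorphN; ring.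
  by rewrite normcM zt mulr1 normcC normrN gtr0_norm.
by rewrite nz nzz; split => //; [lra|nra].
Qed.

(** Points on the radius suffice: there |f z - om| <= (|l| + 1)(1 - |z|), and 1 - |f|^2 <= 2 (1 -
    |f|) explains the factor 2 in K. *)
Lemma finite_angular_derivative_julia f zeta :
  (forall z, normc z < 1 -> normc (f z) < 1) -> normc zeta = 1 ->
  has_finite_angular_derivative f zeta -> exists2 K, 0 < K & julia_hyp f zeta K.
Proof.
move=> f1 zt [om /unit_circleE om1 [l /angular_limitP lim]].
have [d d0 hd] := lim 2 1 (ltr1n _ 2) ltr01.
have K0 : 0 < 2 * (normc l + 1) by have := normc_ge0 l; lra.
exists (2 * (normc l + 1)) => // s s0.
pose t := Num.min (1 / 2) (Num.min d s) / 2.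
have m0 : 0 < Num.min (1 / 2) (Num.min d s) by rewrite !lt_min d0 s0 divr_gt0.
have t0 : 0 < t by rewrite divr_gt0.
have [t1 td ts] : [/\ t < 1, t < d & t < s].
  have : t < Num.min (1 / 2) (Num.min d s) by rewrite /t; lra.
  by rewrite !lt_min => /andP[? /andP[-> ->]]; split => //; lra.
have t01 : 0 < t < 1 by rewrite t0.
have [z1 nz nzz zM] := stolz_radius zt t01 (ltr1n R 2).
move: z1 nz nzz zM; set z := (1 - t)%:C * zeta => z1 nz nzz zM.
exists z => //; split; first by rewrite nzz.
have := hd z z1 zM; rewrite nzz => /(_ td) h.
have z0 : z - zeta != 0 by rewrite -normc_gt0 nzz.
have h1 : normc ((f z - om) / (z - zeta)) <= normc l + 1.
  have := normc_ler_sub ((f z - om) / (z - zeta)) l; lra.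
rewrite normc_div nzz ler_pdivrMr // in h1.
have h2 := normc_ler_sub om (f z); rewrite om1 (normcBC om) in h2.
have fz1 := f1 z z1; have fz0 := normc_ge0 (f z); have l0 := normc_ge0 l.
rewrite nz.
have h3 : 1 - normc (f z) ^+ 2 <= 2 * (normc l + 1) * t by nra.
apply: (le_trans h3); rewrite ler_pM2l //; nra.
Qed.

(** One fixed aperture: the negation then supplies points of a single Stolz region, tending to zeta,
    at which |g| stays below some N. *)
Definition angular_blowup g zeta M := forall N : R, exists2 d : R, 0 < d &
  forall z, normc z < 1 -> normc (z - zeta) < M * (1 - normc z) ->
    normc (z - zeta) < d -> N <= normc (g z).

(** Where |f'| < N and the distortion exceeds 1/2, the quotient (1 - |f|^2) / (1 - |z|^2) is below 2
    (|N| + 1). *)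
Lemma distortion_julia f zeta M : 1 < M ->
  (forall z, normc z < 1 -> normc (f z) < 1) ->
  angular_limit (fun z => (distortion f z)%:C) zeta 1 ->
  ~ angular_blowup (derive1 f) zeta M -> exists2 K, 0 < K & julia_hyp f zeta K.
Proof.
move=> M1 f1 /angular_limitP lim nb.
have /existsNP[N hN] := nb.
have [d d0 hd] := lim M (1 / 2) M1 (divr_gt0 ltr01 (ltr0Sn _ 1)).
have K0 : 0 < 2 * (`|N| + 1) by have := normr_ge0 N; lra.
exists (2 * (`|N| + 1)) => // s s0.
apply: contrapT => nz; apply: hN.
exists (Num.min d s); first by rewrite lt_min d0.
move=> z z1 zM; rewrite lt_min => /andP[zd zs]; rewrite leNgt; apply/negP => hz.
apply: nz; exists z => //; split => //.
have := hd z z1 zM zd; rewrite -[1]/(1%:C : C) -rmorphB normcC ltr_norml => /andP[h _].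
have fz : 0 < 1 - normc (f z) ^+ 2 by rewrite -normc_sqr_lt1 f1.
have z2 : 0 < 1 - normc z ^+ 2 by rewrite -normc_sqr_lt1.
have {h} : 1 / 2 < distortion f z by lra.
rewrite /distortion mulrA ltr_pdivlMr // => h.
have h2 : normc (derive1 f z) * (1 - normc z ^+ 2) <= (`|N| + 1) * (1 - normc z ^+ 2).
  by rewrite ler_pM2r // ltW // (lt_le_trans hz) // (le_trans (ler_norm N)) // lerDl.
lra.
Qed.

End HyperbolicDistortion.

(** * Quantitative polar coordinates near the unit circle *)

Section CirclePoints.
Context {R : realType}.
Local Notation C := (R[i]^o).
Local Notation Re := complex.Re.
Local Notation Im := complex.Im.
Local Notation cp := (@circle_point R).
Implicit Types (x y s t u h : R) (z w xi : C).

Lemma abs_sin_le x : `|sin x| <= `|x|.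
Proof.
wlog x0 : x / 0 <= x => [H|].
  have [/H//|x0] := leP 0 x; have := H (- x); rewrite sinN !normrN; apply; lra.
have [|c _] := @MVT_segment R sin cos 0 x x0 (fun y _ => is_derive_sin y).
  by apply: continuous_subspaceT => y; exact: continuous_sin.
rewrite sin0 !subr0 => ->; rewrite normrM ler_piMl //; exact: cos_max.
Qed.

Lemma abs_cos_sub1_le x : `|cos x - 1| <= `|x|.
Proof.
wlog x0 : x / 0 <= x => [H|].
  have [/H//|x0] := leP 0 x; have := H (- x); rewrite cosN normrN; apply; lra.
have [|c _] := @MVT_segment R cos (fun y => - sin y) 0 x x0 (fun y _ => is_derive_cos y).
  by apply: continuous_subspaceT => y; exact: continuous_cos.
rewrite cos0 subr0 => ->; rewrite normrM normrN ler_piMl //; exact: sin_max.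
Qed.

(** Mean value theorem, with cos 1 the minimum of cosine on [0, 1]; this is the origin of the
    constant [c1] below. *)
Lemma abs_sin_ge x : `|x| <= 1 -> cos 1 * `|x| <= `|sin x|.
Proof.
wlog x0 : x / 0 <= x => [H|].
  have [/H//|x0] := leP 0 x; have := H (- x); rewrite sinN !normrN; apply; lra.
rewrite ger0_norm // => x1.
have [|c] := @MVT_segment R sin cos 0 x x0 (fun y _ => is_derive_sin y).
  by apply: continuous_subspaceT => y; exact: continuous_sin.
rewrite in_itv /= sin0 !subr0 => /andP[c0 cx] ->.
apply: le_trans (ler_norm _); rewrite ler_wpM2r //.
have pi2 := @pi_ge2 R.
have [->|c1] := eqVneq c 1; first by [].
apply: ltW; rewrite ltr_cos ?in_itv /=; [|by apply/andP; split; lra|by apply/andP; split; lra].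
by rewrite lt_neqAle c1 (le_trans cx).
Qed.

Lemma cos1_le1 : cos 1 <= 1 :> R. Proof. exact: cos_le1. Qed.

Lemma Re_cp t : Re (cp t) = cos t. Proof. by []. Qed.
Lemma Im_cp t : Im (cp t) = sin t. Proof. by []. Qed.

Lemma normc_cp t : normc (cp t) = 1.
Proof.
by apply/eqP; rewrite -(@eqrXn2 _ 2) ?normc_ge0 // sqr_normcE Re_cp Im_cp cos2Dsin2 expr1n.
Qed.

Lemma cpD s t : cp s * cp t = cp (s + t).
Proof. by apply: eqC; rewrite ?ReM ?ImM !Re_cp !Im_cp ?cosD ?sinD //; ring. Qed.

Lemma cp_conj s t : cp s * (cp t)^* = cp (s - t).
Proof.
by apply: eqC; rewrite ?ReM ?ImM ?ReJ ?ImJ !Re_cp !Im_cp ?cosB ?sinB //; ring.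
Qed.

Lemma cp0 : cp 0 = 1. Proof. by rewrite /circle_point cos0 sin0. Qed.

Lemma dist_cp_rot xi t : normc (xi - cp t) = normc (xi * (cp t)^* - 1).
Proof.
have -> : xi * (cp t)^* - 1 = (xi - cp t) * (cp t)^*.
  by rewrite mulrBl cp_conj subrr cp0.
by rewrite normcM normc_conj normc_cp mulr1.
Qed.

Lemma dist_cp_le s t : normc (cp s - cp t) <= 2 * `|s - t|.
Proof.
rewrite dist_cp_rot cp_conj; apply: le_trans (normc_ReIm _) _.
rewrite ReB ImB Re_cp Im_cp Re1 Im1 subr0.
by have := abs_sin_le (s - t); have := abs_cos_sub1_le (s - t); lra.
Qed.

(** The imaginary part alone is (1 - h)(1 - y) sin(s - t), and the first two factors have product at
    least 1/4. *)
Lemma pick_denom_cp_ge s t h y : `|s - t| <= 1 -> 0 <= h <= 1 / 2 -> 0 <= y <= 1 / 2 ->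
  cos 1 * `|s - t| / 4 <= normc (1 - ((1 - h)%:C * cp s)^* * ((1 - y)%:C * cp t)).
Proof.
move=> st /andP[h0 h1] /andP[y0 y1].
have c1 := @cos1_gt0 R.
apply: le_trans (normc_Im _).
have -> : Im (1 - ((1 - h)%:C * cp s)^* * ((1 - y)%:C * cp t)) = (1 - h) * (1 - y) * sin (s - t).
  by rewrite sinB !(ImB, ImM, ReM, ReJ, ImJ) /=; ring.
rewrite normrM ger0_norm; last by rewrite mulr_ge0; lra.
have hy : 1 / 4 <= (1 - h) * (1 - y) by nra.
have := abs_sin_ge st; have := mulr_ge0 (ltW c1) (normr_ge0 (s - t)).
move: (cos 1 * `|s - t|) (`|sin (s - t)|) => p q; nra.
Qed.

(** After rotation to t = 0, closeness to 1 forces a positive real part, so the arcsine of the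
    imaginary part is an argument. It is at most 1 in absolute value because the imaginary part is
    below cos 1 <= sin 1. *)
Lemma polar_near xi t : normc xi = 1 -> normc (xi - cp t) < cos 1 ->
  exists2 s, xi = cp s & cos 1 * `|s - t| <= normc (xi - cp t).
Proof.
move=> xi1 xit; have c1 := @cos1_gt0 R; have c1' := cos1_le1.
pose w := xi * (cp t)^*.
have w1 : normc w = 1 by rewrite normcM normc_conj normc_cp xi1 mulr1.
have wxi : w * cp t = xi.
  by rewrite /w -mulrA [(cp t)^* * _]mulrC cp_conj subrr cp0 mulr1.
rewrite dist_cp_rot -/w in xit *.
have Rew : 0 < Re w.
  have := normc_Re (w - 1); rewrite ReB Re1 ler_norml => /andP[h _]; lra.
have Imw : `|Im w| <= normc (w - 1).
  by have := normc_Im (w - 1); rewrite ImB Im1 subr0.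
have w2 : Re w ^+ 2 = 1 - Im w ^+ 2.
  by have := sqr_normcE w; rewrite w1 expr1n => ->; rewrite addrK.
have b1 : -1 <= Im w <= 1 by rewrite -ler_norml; lra.
pose s := asin (Im w).
have ss : sin s = Im w by apply: asinK; rewrite in_itv.
have sc : cos s = Re w.
  by rewrite cos_asin // -w2 sqrtr_sqr gtr0_norm.
exists (s + t); first by rewrite -cpD -wxi; congr (_ * _); apply: eqC.
rewrite addrK; apply: (le_trans _ (Imw)); rewrite -ss.
have [s1|s1] := leP `|s| 1; first exact: abs_sin_ge.
exfalso; have := abs_sin_ge (x := 1); rewrite normr1 mulr1 lexx => /(_ isT).
have pi2 : 1 <= pi / 2 :> R by exact: pihalf_ge1.
have sgt0 : 0 < sin 1 :> R by apply: sin2_gt0; rewrite ltr01 ltr1n.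
rewrite gtr0_norm // => sin1; move: s1; rewrite lter_normr => /orP s1.
have sI : s \in `[- (pi / 2), pi / 2]%R.
  by rewrite in_itv /= asin_geNpi2 // asin_lepi2.
case: s1 => s1.
  have : sin 1 < sin s by rewrite ltr_sin // in_itv /=; apply/andP; split; lra.
  by rewrite ss; have := ler_norm (Im w); lra.
have : sin s < sin (- 1).
  by rewrite ltr_sin ?in_itv /=; [lra|exact: sI|apply/andP; split; lra].
by rewrite ss sinN; have := ler_norm (- Im w); rewrite normrN; lra.
Qed.

End CirclePoints.

(** * Elementary bounds for products and grid sums *)

Section Products.
Context {R : realType}.

(** Substitutes for comparison with the exponential of minus the sum: the upper bound 1 / (1 + sum)
    serves on the sides of the sawtooth, the lower bound 1 - sum at its centre. *)
Lemma prod_one_sub (I : Type) (s : seq I) (P : pred I) (u : I -> R) :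
  (forall i, P i -> 0 <= u i <= 1) ->
  [/\ 0 <= \prod_(i <- s | P i) (1 - u i) <= 1,
      \prod_(i <- s | P i) (1 - u i) * (1 + \sum_(i <- s | P i) u i) <= 1 &
      1 - \sum_(i <- s | P i) u i <= \prod_(i <- s | P i) (1 - u i)].
Proof.
move=> hu; elim: s => [|i s [/andP[IH0 IH0'] IH1 IH2]].
  by rewrite !big_nil addr0 mulr1 subr0 ler01 lexx.
have S0 : 0 <= \sum_(i <- s | P i) u i.
  by apply: sumr_ge0 => j /hu /andP[].
rewrite !big_cons; case: (boolP (P i)) => [/hu /andP[u0 u1]|_]; last by rewrite IH0 IH0'.
move: IH0 IH0' IH1 IH2 S0; set p := \prod_(_ <- _ | _) _; set S := \sum_(_ <- _ | _) _.
move: (u i) u0 u1 p S => v v0 v1 p S p0 p1 h1 h2 S0; split; last by nra.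
  by apply/andP; split; nra.
have h3 : (1 - v) * p * (1 + (v + S)) = p * (1 + S) - v * (p * (v + S)) by ring.
by rewrite h3; have := mulr_ge0 v0 (mulr_ge0 p0 (addr_ge0 v0 S0)); lra.
Qed.

Lemma sum_range_ge (n k0 m : nat) (P : pred nat) (u : nat -> R) (c : R) :
  (forall k, P k -> 0 <= u k) -> (k0 + m <= n)%N ->
  (forall k, (k0 <= k < k0 + m)%N -> P k /\ c <= u k) ->
  m%:R * c <= \sum_(0 <= k < n | P k) u k.
Proof.
move=> u0 kmn hc.
rewrite big_mkcond (@big_cat_nat _ _ _ k0 0 n) //=; last by rewrite (leq_trans _ kmn) // leq_addr.
rewrite (@big_cat_nat _ _ _ (k0 + m) k0 n) ?leq_addr //=.
have pos k : 0 <= (if P k then u k else 0) by case: ifPn => // /u0.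
have mid : m%:R * c <= \sum_(k0 <= k < k0 + m) (if P k then u k else 0).
  have -> : m%:R * c = \sum_(k0 <= k < k0 + m) c.
    by rewrite sumr_const_nat addKn mulr_natl.
  by apply: ler_sum_nat => k /hc[-> ].
have h1 : 0 <= \sum_(0 <= k < k0) (if P k then u k else 0) by apply: sumr_ge0 => k _; exact: pos.
have h2 : 0 <= \sum_(k0 + m <= k < n) (if P k then u k else 0).
  by apply: sumr_ge0 => k _; exact: pos.
lra.
Qed.

(* An interval of length [L >= 2 h] contains at least [L / (2 h)] grid points. *)
Lemma sum_grid_ge (n : nat) (P : pred nat) (u : nat -> R) (x0 h al L c : R) :
  0 < h -> 2 * h <= L -> 0 <= c -> x0 <= al -> al + L < x0 + n%:R * h ->
  (forall k, P k -> 0 <= u k) ->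
  (forall k, al <= x0 + k%:R * h <= al + L -> P k /\ c * h <= u k) ->
  L / 2 * c <= \sum_(0 <= k < n | P k) u k.
Proof.
move=> h0 hL c0 xal aln u0 hu.
have ge0 : 0 <= (al - x0) / h by rewrite divr_ge0 ?subr_ge0 // ltW.
have Lh0 : 0 <= L / h by rewrite divr_ge0 //; lra.
pose k0 := (Num.truncn ((al - x0) / h)).+1; pose m := Num.truncn (L / h).
have k0l : al <= x0 + k0%:R * h.
  by have := truncnS_gt ((al - x0) / h); rewrite ltr_pdivrMr // /k0; lra.
have k0u : x0 + k0%:R * h <= al + h.
  have := truncn_itv ge0 => /andP[+ _]; rewrite ler_pdivlMr // /k0 -natr1; lra.
have ml : m%:R * h <= L.
  by have := truncn_itv Lh0 => /andP[+ _]; rewrite ler_pdivlMr.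
have mu : L < m%:R * h + h.
  by have := truncnS_gt (L / h); rewrite ltr_pdivrMr // -natr1 mulrDl mul1r.
have m0 : (0 < m)%N.
  rewrite lt0n; apply/eqP => me; move: mu; rewrite me mul0r; lra.
apply: (@le_trans _ _ (m%:R * (c * h))).
  have hm : L / 2 <= m%:R * h by lra.
  by have := ler_wpM2r c0 hm; lra.
have range k : (k0 <= k < k0 + m)%N -> al <= x0 + k%:R * h <= al + L.
  move=> /andP[kk0 km].
  have e1 : (k0%:R : R) <= k%:R by rewrite ler_nat.
  have e2 : (k%:R : R) + 1 <= k0%:R + m%:R by rewrite natr1 -natrD ler_nat.
  have f1 := ler_wpM2r (ltW h0) e1; have f2 := ler_wpM2r (ltW h0) e2.
  by apply/andP; split; lra.
apply: (@sum_range_ge n k0 m) => //; last by move=> k /range /hu.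
have /range /andP[_ hk] : (k0 <= k0 + m.-1 < k0 + m)%N.
  by rewrite leq_addr ltn_add2l ltn_predL.
rewrite leqNgt; apply/negP => hn.
have e1 : (n%:R : R) <= (k0 + m.-1)%:R by rewrite ler_nat -ltnS -addnS prednK.
by have := ler_wpM2r (ltW h0) e1; lra.
Qed.

End Products.

(** * Blaschke product over the gaps and the sawtooth estimate *)

Section Sawtooth.
Context {R : realType}.
Local Notation C := (R[i]^o).
Local Notation cp := (@circle_point R).
Implicit Types (s t y h : R) (z w p a : C) (K : set R).

(** One minus the squared modulus of the Blaschke factor. For a at height h it resembles h times a
    Poisson kernel, so a sum over nodes spaced by h imitates the harmonic measure of the arcs below
    them. *)
Definition blaschke_defect a z : R :=
  (1 - normc a ^+ 2) * (1 - normc z ^+ 2) / normc (1 - a^* * z) ^+ 2.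

Lemma blaschke_factor_sqr a z : normc a < 1 -> normc z < 1 ->
  normc ((z - a) / (1 - a^* * z)) ^+ 2 = 1 - blaschke_defect a z.
Proof.
move=> a1 z1; rewrite /blaschke_defect -pick_identity normc_div expr_div_n.
by field; rewrite normc_eq0; exact: pick_denom_neq0.
Qed.

Lemma blaschke_defect_itv a z : normc a < 1 -> normc z < 1 -> 0 <= blaschke_defect a z <= 1.
Proof.
move=> a1 z1; apply/andP; split.
  by rewrite divr_ge0 ?sqr_ge0 // mulr_ge0 // ltW // -normc_sqr_lt1.
by have := sqr_ge0 (normc ((z - a) / (1 - a^* * z))); rewrite blaschke_factor_sqr //; lra.
Qed.

Definition node (h t : R) : C := (1 - h)%:C * cp t.

Lemma normc_node h t : 0 <= h <= 1 -> normc (node h t) = 1 - h.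
Proof. by move=> /andP[h0 h1]; rewrite normcM normc_cp mulr1 normcC ger0_norm // subr_ge0. Qed.

Lemma defect_ge h t z (D : R) : 0 < h <= 1 / 2 -> normc z < 1 -> normc (cp t - z) + h <= D ->
  h * (1 - normc z) / D ^+ 2 <= blaschke_defect (node h t) z.
Proof.
move=> /andP[h0 h1] z1 zD; have z0 := normc_ge0 z.
have D0 : 0 < D by have := normc_ge0 (cp t - z); lra.
have nd : normc (node h t) < 1 by rewrite normc_node; lra.
have d0 := pick_denom_gt0 nd z1.
have dD : normc (1 - (node h t)^* * z) <= D.
  apply: le_trans zD; have -> : 1 - (node h t)^* * z = (cp t)^* * ((cp t - z) + h%:C * z).
    have ct : (cp t)^* * cp t = 1 by rewrite mulrC cp_conj subrr cp0.
    have key (N : C) : N = (1 - h)%:C * (cp t)^* ->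
        1 - N * z = (cp t)^* * (cp t - z + h%:C * z).
      by move=> ->; rewrite mulrDr mulrBr ct rmorphB rmorph1; ring.
    by apply: key; apply: eqC; rewrite !ReImE /=; ring.
  rewrite normcM normc_conj normc_cp mul1r; apply: le_trans (normcD _ _) _.
  by rewrite lerD2l normcM normcC gtr0_norm // ler_piMr // ltW.
rewrite ler_pdivrMr ?exprn_gt0 // /blaschke_defect.
rewrite mulrAC ler_pdivlMr //; apply: ler_pM.
- by rewrite mulr_ge0 //; lra.
- exact: sqr_ge0.
- by apply: ler_pM; rewrite ?normc_node //; nra.
by rewrite ler_sqr ?nnegrE ?normc_ge0 ?(ltW D0).
Qed.

Lemma defect_le h t z (E : R) : 0 < h <= 1 / 2 -> normc z < 1 -> 0 < E ->
  E <= normc (1 - (node h t)^* * z) ->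
  blaschke_defect (node h t) z <= h * (4 * (1 - normc z) / E ^+ 2).
Proof.
move=> /andP[h0 h1] z1 E0 hE; have z0 := normc_ge0 z.
have E2 : E ^+ 2 <= normc (1 - (node h t)^* * z) ^+ 2.
  by rewrite ler_sqr ?nnegrE ?normc_ge0 ?(ltW E0).
have E20 : 0 < E ^+ 2 by rewrite exprn_gt0.
rewrite /blaschke_defect ler_pdivrMr; last exact: lt_le_trans E2.
apply: (@le_trans _ _ (h * (4 * (1 - normc z) / E ^+ 2) * E ^+ 2)).
  have -> : h * (4 * (1 - normc z) / E ^+ 2) * E ^+ 2 = (2 * h) * (2 * (1 - normc z)).
    by field; rewrite gt_eqF.
  by rewrite normc_node; [apply: ler_pM; nra|lra].
rewrite ler_wpM2l // mulr_ge0 ?divr_ge0 ?mulr_ge0 //; lra.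
Qed.

Lemma normc_prod (I : Type) (r : seq I) (P : pred I) (F : I -> C) :
  normc (\prod_(i <- r | P i) F i) = \prod_(i <- r | P i) normc (F i).
Proof. by apply: (big_morph (@normc R)); [exact: normcM|exact: normc1]. Qed.

Section Grid.
Variables (x0 h : R) (n : nat) (P : pred nat).
Hypothesis h01 : 0 < h <= 1 / 2.

Let nd k := node h (x0 + k%:R * h).

Definition blaschke z : C := \prod_(0 <= k < n | P k) ((z - nd k) / (1 - (nd k)^* * z)).

Let nd1 k : normc (nd k) < 1.
Proof. by move/andP: h01 => [? ?]; rewrite normc_node; lra. Qed.

Let S z := \sum_(0 <= k < n | P k) blaschke_defect (nd k) z.

Lemma blaschke_bounds z : normc z < 1 -> [/\ normc (blaschke z) <= 1,
  normc (blaschke z) ^+ 2 * (1 + S z) <= 1 & 1 - S z <= normc (blaschke z) ^+ 2].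
Proof.
move=> z1.
have e : normc (blaschke z) ^+ 2 = \prod_(0 <= k < n | P k) (1 - blaschke_defect (nd k) z).
  rewrite normc_prod -prodrXl; apply: eq_bigr => k _; exact: blaschke_factor_sqr.
have [//|/andP[p0 p1] p2 p3] := @prod_one_sub R _ (index_iota 0 n) P (fun k => blaschke_defect (nd k) z).
  by move=> k _; exact: blaschke_defect_itv.
split; rewrite ?e //.
by rewrite -(@ler_pXn2r _ 2) ?nnegrE // expr1n e.
Qed.

Lemma blaschke_holo : disk_holo blaschke.
Proof.
move=> z z1; apply: cderivable_prod => k _; exact: pick_factor_diff.
Qed.

End Grid.

(* To be applied with [c1 = cos 1]. *)
Variable c1 : R.
Hypotheses (c10 : 0 < c1) (c11 : c1 <= 1).
Hypothesis polar : forall (xi : C) t, normc xi = 1 -> normc (xi - cp t) < c1 ->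
  exists2 s, xi = cp s & c1 * `|s - t| <= normc (xi - cp t).
Hypothesis denom_ge : forall s t h y, `|s - t| <= 1 -> 0 <= h <= 1 / 2 -> 0 <= y <= 1 / 2 ->
  c1 * `|s - t| / 4 <= normc (1 - (node h s)^* * node y t).

(* The nodes of the Blaschke product [B] lie at height [h] above the cells of a grid in
   [|t - x| <= lam rho] which miss [K].  The sum of their defects is at least [q0] on the
   part of the boundary of the sawtooth region off its bottom, and at most [q0 / 2] at the
   point at height [kap rho] above [x] if the cells near [x] have total length at most
   [eps rho]. *)
Definition lam : R := 8 / c1.
Definition q0 : R := 1 / (20 * 20).
Definition kap : R := c1 ^+ 2 * q0 / (32 * 64 * lam).
Definition eps : R := kap * q0 / 16.

Lemma q0_gt0 : 0 < q0. Proof. by rewrite divr_gt0 ?mulr_gt0. Qed.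
Lemma q0_le : q0 <= 1 / 2. Proof. by rewrite /q0; lra. Qed.

Lemma lam_c1 : lam * c1 = 8. Proof. by rewrite /lam; field; rewrite gt_eqF. Qed.
Lemma lam_ge8 : 8 <= lam. Proof. by rewrite /lam ler_pdivlMr // ler_piMr. Qed.
Lemma kap_gt0 : 0 < kap.
Proof.
have l8 := lam_ge8; have l0 : 0 < lam by lra.
by rewrite /kap; apply: divr_gt0; apply: mulr_gt0 => //; [exact: exprn_gt0|exact: q0_gt0].
Qed.
Lemma kap_le : kap <= 1 / 2.
Proof.
have l8 := lam_ge8; have l0 : 0 < lam by lra.
rewrite /kap ler_pdivrMr; last by apply: mulr_gt0.
have c12 : c1 ^+ 2 <= 1 by rewrite exprn_ile1 // ltW.
have c120 : 0 <= c1 ^+ 2 by exact: sqr_ge0.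
have := q0_le; have := q0_gt0; move: c12 c120; move: (c1 ^+ 2) q0 => a b; nra.
Qed.

Section Estimate.
Variables (x rho dl h : R) (n : nat) (K : set R).
Hypotheses (rho0 : 0 < rho) (rho1 : rho <= c1 / 8) (dl0 : 0 < dl) (dlk : dl < kap * rho).
Hypotheses (h0 : 0 < h) (hdl : h <= dl / 8) (nh : n%:R * h = 2 * lam * rho).
Hypothesis KI : forall t, K t -> `|t - x| <= rho.

Let x0 := x - lam * rho.
Definition free_cell k := `[< forall s, x0 + k%:R * h <= s < x0 + k%:R * h + h -> ~ K s >].

Let dl_rho : dl < rho.
Proof. by have := kap_le; have := rho0; have := dlk; nra. Qed.
Let lamrho : lam * rho <= 1.
Proof.
have := lam_ge8 => l8; have : lam * rho <= lam * (c1 / 8) by rewrite ler_wpM2l //; lra.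
by rewrite mulrA lam_c1; lra.
Qed.
Let h01 : 0 < h <= 1 / 2.
Proof. by rewrite h0 /=; have := dl_rho; have := rho1; have := hdl; have := c11; lra. Qed.

Let B := blaschke x0 h n free_cell.
Let S z := \sum_(0 <= k < n | free_cell k) blaschke_defect (node h (x0 + k%:R * h)) z.

Let defect0 z k : normc z < 1 -> 0 <= blaschke_defect (node h (x0 + k%:R * h)) z.
Proof.
move=> z1; have /andP[hh0 hh1] := h01.
have nd1 : normc (node h (x0 + k%:R * h)) < 1 by rewrite normc_node; lra.
by have /andP[] := blaschke_defect_itv nd1 z1.
Qed.

(** On the top, cells just beyond the interval containing K are free. On a sloping side, the cells
    next to the radial projection of p are free over a length comparable to y, because K stays at
    distance 4 y from p. Either family has a definite share of the Poisson mass of p. *)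
Lemma tent_sum p : normc p < 1 -> dl <= 1 - normc p <= rho ->
  (exists2 t, K t & normc (p - cp t) <= 4 * (1 - normc p)) ->
  (1 - normc p = rho \/ forall t, K t -> 4 * (1 - normc p) <= normc (p - cp t)) ->
  q0 <= S p.
Proof.
move=> p1 /andP[yd yr] [t Kt pt]; have := KI Kt; rewrite ler_norml => /andP[tx1 tx2].
have := dl_rho; have := h0; have := hdl; have := rho1; have := c11; have := c10; have := dl0.
move=> dl0' c10' c11' rho1' hdl' h0' dlr'.
have rl : 8 * rho <= lam * rho by rewrite ler_wpM2r ?lam_ge8 // ltW.
set y := 1 - normc p in yd yr pt *.
have y0 : 0 < y by lra.
case=> [yrho|yK].
  (* Free cells over an interval of length rho / 2, at distance at most 10 rho from p, contribute
     (rho / 4) / (100 rho); this fixes [q0]. The other case gives the larger value 1/36. *)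
  have -> : q0 = (rho / 2) / 2 * ((100 * rho)^-1).
    by rewrite /q0; field; rewrite gt_eqF.
  apply: (@sum_grid_ge R n free_cell _ x0 h (x + 5 / 4 * rho)) => //.
  - by lra.
  - by rewrite invr_ge0; lra.
  - by rewrite /x0; lra.
  - by rewrite nh /x0; lra.
  - by move=> k _; exact: defect0.
  move=> k /andP[k1 k2]; split.
    apply/asboolP => s /andP[s1 s2] /KI; rewrite ler_norml => /andP[_ s3]; lra.
  have D : normc (cp (x0 + k%:R * h) - p) + h <= 10 * rho.
    apply: le_trans (lerD (normc_triangle (cp t) _ _) (lexx _)) _.
    rewrite (normcBC (cp t)); have := dist_cp_le (x0 + k%:R * h) t.
    have : `|x0 + k%:R * h - t| <= 11 / 4 * rho by rewrite ler_norml; apply/andP; split; lra.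
    rewrite yrho in pt; lra.
  apply: le_trans (defect_ge h01 p1 D); rewrite -/y yrho.
  rewrite le_eqVlt; apply/orP; left; apply/eqP; field; rewrite gt_eqF //.
have np : 0 < normc p by rewrite /y in yr; lra.
pose xi : C := ((normc p)^-1)%:C * p.
have xi1 : normc xi = 1.
  by rewrite normcM normcC gtr0_norm ?invr_gt0 // mulVf // gt_eqF.
have pxi : p = (normc p)%:C * xi.
  by rewrite /xi mulrA -rmorphM divff ?gt_eqF // mul1r.
have xip : normc (xi - p) = y.
  rewrite {1}pxi; have -> : xi - (normc p)%:C * xi = y%:C * xi.
    by rewrite /y rmorphB rmorph1; ring.
  by rewrite normcM xi1 mulr1 normcC gtr0_norm.
have xit : normc (xi - cp t) <= 5 * y.
  by apply: le_trans (normc_triangle p _ _) _; rewrite xip; lra.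
have [tau xitau tt] : exists2 tau, xi = cp tau & c1 * `|tau - t| <= normc (xi - cp t).
  by apply: polar => //; lra.
have taut : `|tau - t| <= 5 / c1 * rho.
  rewrite mulrAC ler_pdivlMr // mulrC; lra.
(* The reason for lam = 8 / c1: the argument tau of the radial projection, and the cells used beside
   it, remain inside the grid. *)
have lc : 5 / c1 * rho = 5 / 8 * (lam * rho) by rewrite /lam; field; rewrite gt_eqF.
rewrite lc ler_norml in taut; move/andP: taut => [ta1 ta2].
have near s : `|s - tau| <= y -> normc (p - cp s) <= y + 2 * `|s - tau|.
  move=> sy; apply: le_trans (normc_triangle xi _ _) _.
  by rewrite (normcBC p) xip xitau lerD2l distrC; exact: dist_cp_le.
apply: (@le_trans _ _ ((y / 2) / 2 * (9 * y)^-1)).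
  have -> : y / 2 / 2 / (9 * y) = 1 / 36 by field; rewrite gt_eqF.
  by rewrite /q0; lra.
apply: (@sum_grid_ge R n free_cell _ x0 h tau) => //.
- by lra.
- by rewrite invr_ge0; lra.
- by rewrite /x0; lra.
- by rewrite nh /x0; lra.
- by move=> k _; exact: defect0.
move=> k /andP[k1 k2]; split.
  apply/asboolP => s /andP[s1 s2] Ks; have := yK s Ks.
  have sy : `|s - tau| <= y by rewrite ler_norml; apply/andP; split; lra.
  by have := near s sy; lra.
have D : normc (cp (x0 + k%:R * h) - p) + h <= 3 * y.
  have sy : `|x0 + k%:R * h - tau| <= y / 2 by rewrite ler_norml; apply/andP; split; lra.
  have sy' : `|x0 + k%:R * h - tau| <= y by lra.
  by rewrite normcBC; have := near _ sy'; lra.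
apply: le_trans (defect_ge h01 p1 D); rewrite -/y.
by rewrite le_eqVlt; apply/orP; left; apply/eqP; field; rewrite gt_eqF.
Qed.

Definition near_cell k := (x - rho < x0 + k%:R * h) && (x0 + k%:R * h + h <= x + rho).

(** A near cell has defect at most 4 h / y0, and such free cells have small total length. A far cell
    is at distance at least rho / 2 from x, much more than the height y0 = kap rho, so its defect
    carries the small factor kap. *)
Lemma center_sum : \sum_(0 <= k < n | free_cell k && near_cell k) h <= eps * rho ->
  S (node (kap * rho) x) <= q0 / 2.
Proof.
move=> hsum; set z0 := node _ x; pose y0 := kap * rho.
have k0 := kap_gt0; have k1 := kap_le; have l8 := lam_ge8.
have := dl_rho; have := h0; have := hdl; have := rho1; have := c11; have := c10; have := dl0.
move=> dl0' c10' c11' rho1' hdl' h0' dlr'.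
have y00 : 0 < y0 by rewrite mulr_gt0.
have y01 : y0 <= 1 / 2 by rewrite /y0; nra.
have nz : normc z0 = 1 - y0 by rewrite normc_node // -/y0; lra.
have z1 : normc z0 < 1 by rewrite nz; lra.
have nz1 : 1 - normc z0 = y0 by rewrite nz; lra.
pose Cf := 256 * kap / (c1 ^+ 2 * rho).
have Cf0 : 0 <= Cf.
  by apply: divr_ge0; apply: mulr_ge0; rewrite ?ler0n ?sqr_ge0 ?(ltW k0) ?(ltW rho0).
have bound k : (k < n)%N -> blaschke_defect (node h (x0 + k%:R * h)) z0 <=
    (4 / y0) * (if near_cell k then h else 0) + Cf * h.
  move=> kn; case: ifPn => [_|].
    apply: (@le_trans _ _ (4 / y0 * h)); last by rewrite lerDl mulr_ge0 // ltW.
    have E : y0 <= normc (1 - (node h (x0 + k%:R * h))^* * z0).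
      have := normc_ler_sub 1 ((node h (x0 + k%:R * h))^* * z0).
      rewrite normc1 normcM normc_conj normc_node ?nz; last by move/andP: h01 => [? ?]; lra.
      nra.
    apply: le_trans (defect_le h01 z1 y00 E) _; rewrite nz1.
    by rewrite le_eqVlt; apply/orP; left; apply/eqP; field; rewrite gt_eqF.
  rewrite /near_cell negb_and -!leNgt -ltNge => far; rewrite mulr0 add0r.
  have kh : k%:R * h <= 2 * (lam * rho).
    by rewrite mulrA -nh ler_wpM2r ?(ltW h0) // ler_nat ltnW.
  have kh0 : 0 <= k%:R * h by rewrite mulr_ge0 // ltW.
  have d1 : `|x0 + k%:R * h - x| <= 1.
    by have := lamrho; rewrite ler_norml /x0; lra.
  have d2 : rho / 2 <= `|x0 + k%:R * h - x|.
    rewrite ler_normr; case/orP: far => far; apply/orP; [right|left]; lra.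
  have hh : 0 <= h <= 1 / 2 by move/andP: h01 => [? ?]; apply/andP; split; lra.
  have yy : 0 <= y0 <= 1 / 2 by rewrite y01 ltW.
  have E := denom_ge d1 hh yy.
  have E' : c1 * rho / 8 <= normc (1 - (node h (x0 + k%:R * h))^* * z0).
    apply: le_trans E; have := ler_wpM2l (ltW c10) d2; lra.
  have E0 : 0 < c1 * rho / 8 by rewrite divr_gt0 // mulr_gt0.
  apply: le_trans (defect_le h01 z1 E0 E') _; rewrite nz1 /Cf /y0.
  by rewrite le_eqVlt; apply/orP; left; apply/eqP; field; rewrite !gt_eqF.
apply: (@le_trans _ _ (\sum_(0 <= k < n | free_cell k)
    ((4 / y0) * (if near_cell k then h else 0) + Cf * h))).
  rewrite /S big_nat_cond [leRHS]big_nat_cond; apply: ler_sum => k /andP[/andP[_ kn] _]; exact: bound.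
rewrite big_split /= -mulr_sumr -big_mkcondr /=.
(* With n h = 2 lam rho the total is 512 kap lam / c1^2, and [kap] is defined to make this q0 /
   4. *)
have s2 : \sum_(0 <= k < n | free_cell k) Cf * h <= q0 / 4.
  apply: (@le_trans _ _ (\sum_(0 <= k < n) Cf * h)).
    rewrite big_mkcond /=; apply: ler_sum => k _; case: ifP => // _.
    by rewrite mulr_ge0 // ltW.
  rewrite sumr_const_nat subn0.
  have -> : Cf * h *+ n = Cf * (n%:R * h) by rewrite -[_ *+ n]mulr_natl; ring.
  rewrite nh /Cf.
  rewrite le_eqVlt; apply/orP; left; apply/eqP; rewrite /kap; field.
  by rewrite !gt_eqF //; lra.
(* Here 4 eps / kap = q0 / 4, which is how [eps] is chosen. *)
have s1 : 4 / y0 * \sum_(0 <= k < n | free_cell k && near_cell k) h <= q0 / 4.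
  apply: (@le_trans _ _ (4 / y0 * (eps * rho))).
    by rewrite ler_wpM2l // divr_ge0 // ltW.
  rewrite /y0 /eps le_eqVlt; apply/orP; left; apply/eqP; field.
  by rewrite !gt_eqF.
by apply: le_trans (lerD s1 s2) _; lra.
Qed.

(* The maximum principle for [B ^+ m / g] on the sawtooth region of the points at distance
   at most [4 (1 - |z|)] from [K] with [dl <= 1 - |z| <= rho].  On its bottom
   [1 - |z| = dl] one has [N <= |g|]; on the rest of its boundary [|B| ^+ 2 <= (1 + q0)^-1]
   by [tent_sum], and [1 <= |g|].  At the centre, [|B|] is close to 1. *)
Lemma sawtooth_estimate (g : C -> C) (N : R) (m : nat) (t0 : R) :
  (forall t, (forall e : R, 0 < e -> exists2 s, K s & `|s - t| < e) -> K t) ->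
  K t0 -> `|t0 - x| <= kap * rho -> disk_holo g ->
  (forall t z, K t -> normc z < 1 -> normc (z - cp t) < 5 * (1 - normc z) ->
     1 - normc z <= rho -> 1 <= normc (g z)) ->
  (forall t z, K t -> normc z < 1 -> normc (z - cp t) < 5 * (1 - normc z) ->
     1 - normc z <= dl -> N <= normc (g z)) ->
  0 < N -> (1 + q0) ^+ m <= N ^+ 2 ->
  \sum_(0 <= k < n | free_cell k && near_cell k) h <= eps * rho ->
  ((1 - q0 / 2) * (1 + q0)) ^+ m <= normc (g (node (kap * rho) x)) ^+ 2.
Proof.
move=> Kc Kt0 t0x dg g1 gN N0 Nm hsum; set z0 := node _ x.
have k0 := kap_gt0; have k1 := kap_le; have q00 := q0_gt0; have q01 := q0_le.
have := dl_rho; have := rho1; have := c11; have := c10; have := dl0; have := dlk.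
move=> dlk' dl0' c10' c11' rho1' dlr'.
have y00 : 0 < kap * rho by rewrite mulr_gt0.
have yrho : kap * rho <= rho by nra.
have nz : normc z0 = 1 - kap * rho by rewrite normc_node //; lra.
(* Aperture 4 with closed inequalities keeps the region inside the open horns of aperture 5 on which
   g is bounded below. *)
pose X : set C := [set z | dl <= 1 - normc z <= rho /\
   exists2 t, K t & normc (z - cp t) <= 4 * (1 - normc z)].
have X1 z : X z -> normc z < 1 by move=> [/andP[h1 _] _]; lra.
have Xg z : X z -> 1 <= normc (g z).
  move=> /[dup] /X1 z1 [/andP[h1 h2] [t Kt zt]]; apply: (g1 t) => //; lra.
have Xc : csequentially_closed X.
  move=> p hp; split.
    apply/andP; split; rewrite leNgt; apply/negP; rewrite -subr_gt0 => /hp[w [/andP[w1 w2] _] wp].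
      by have := normc_ler_sub p w; rewrite (normcBC p); lra.
    by have := normc_ler_sub w p; lra.
  have near (e : R) : 0 < e -> exists2 t, K t & normc (p - cp t) <= 4 * (1 - normc p) + e.
    move=> e0; have e5 : 0 < e / 5 by lra.
    have [w [_ [t Kt wt]] wp] := hp _ e5; exists t => //.
    have := normc_triangle w p (cp t); have := normc_ler_sub p w; rewrite (normcBC p); lra.
  have /choice[u hu] : forall k : nat, exists t, K t /\
      normc (p - cp t) <= 4 * (1 - normc p) + k.+1%:R^-1.
    move=> k; have k0' : 0 < k.+1%:R^-1 :> R by rewrite invr_gt0.
    by have [t Kt ht] := near _ k0'; exists t.
  have ub k : normc ((u k)%:C : C) <= `|x| + rho.
    rewrite normcC; have := KI (hu k).1.
    by have := ler_normD (u k - x) x; rewrite subrK; lra.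
  have [c hc] := bolzano_weierstrass ub; pose t := complex.Re c.
  have ut k : `|u k - t| <= normc ((u k)%:C - c).
    by apply: le_trans (normc_Re _); rewrite ReB.
  exists t.
    apply: Kc => e e0; have [k _ hk] := hc e 0%N e0; exists (u k); first exact: (hu k).1.
    exact: le_lt_trans hk.
  apply/ler_addgt0Pr => e e0; have e4 : 0 < e / 4 by rewrite divr_gt0.
  have [k kN hk] := hc (e / 4) (Num.truncn ((e / 4)^-1)).+1 e4.
  have k1' : k.+1%:R^-1 <= e / 4.
    rewrite invf_ple ?posrE //; apply: le_trans (ltW (truncnS_gt _)) _.
    by rewrite ler_nat; exact: leqW.
  have := (hu k).2; have := normc_triangle (cp (u k)) p (cp t).
  have := dist_cp_le (u k) t; have := ut k; move: k1' hk; set q := _^-1; lra.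
have Bh : disk_holo B by exact: blaschke_holo.
have Bb z : normc z < 1 -> [/\ normc (B z) <= 1, normc (B z) ^+ 2 * (1 + S z) <= 1 &
   1 - S z <= normc (B z) ^+ 2] by exact: blaschke_bounds.
pose F z := B z ^+ m / g z.
have nF z : normc (F z) ^+ 2 = (normc (B z) ^+ 2) ^+ m / normc (g z) ^+ 2.
  by rewrite /F normc_div normcX expr_div_n -!exprM mulnC.
have gn0 z : X z -> g z != 0.
  by move=> /Xg gz; rewrite -normc_gt0; lra.
have Fd z : X z -> cderivable F z.
  move=> Xz; apply: cderivable_div; first exact: gn0.
    by apply: cderivableX; apply: Bh; exact: X1.
  by apply: dg; exact: X1.
pose th : R := ((1 + q0) ^+ m)^-1.
have q10 : 0 < (1 + q0) ^+ m by rewrite exprn_gt0 //; lra.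
have th0 : 0 < th by rewrite invr_gt0.
pose cc := Num.sqrt th.
have Fle z : normc (F z) ^+ 2 <= th -> normc (F z) <= cc.
  move=> hF; rewrite -(@ler_pXn2r _ 2) ?nnegrE ?sqrtr_ge0 ?normc_ge0 //.
  by rewrite sqr_sqrtr // ltW.
have Fge1 z (a : R) : X z -> normc (B z) ^+ 2 <= a -> a ^+ m <= th -> normc (F z) <= cc.
  move=> Xz Ba am; apply: Fle; rewrite nF; apply: le_trans am.
  have gz : 1 <= normc (g z) ^+ 2 by rewrite exprn_ege1 // Xg.
  rewrite ler_pdivrMr; last by lra.
  apply: (@le_trans _ _ (a ^+ m)).
    by apply: lerXn2r => //; rewrite nnegrE ?sqr_ge0 // (le_trans (sqr_ge0 _) Ba).
  by rewrite ler_peMr // exprn_ge0 // (le_trans (sqr_ge0 _) Ba).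
have z0X : X z0.
  split; first by rewrite nz; apply/andP; split; lra.
  exists t0 => //; rewrite nz; apply: le_trans (normc_triangle (cp x) _ _) _.
  have -> : normc (z0 - cp x) = kap * rho.
    have -> : z0 - cp x = (- (kap * rho))%:C * cp x.
      by rewrite /z0 /node rmorphB rmorph1 rmorphN; ring.
    by rewrite normcM normc_cp mulr1 normcC normrN gtr0_norm.
  by have := dist_cp_le x t0; rewrite distrC; lra.
have bnd := @max_principle R X 1 cc F (sqrtr_ge0 _) Xc (fun z Xz => ltW (X1 z Xz))
  (fun z Xz => let: ex_intro _ d := Fd z Xz in cdiff_cont d).
have {bnd} : normc (F z0) <= cc.
  apply: bnd => // p Xp; have p1 := X1 p Xp; have [B1 B2 B3] := Bb p p1.
  have [/andP[pd pr] [t Kt pt]] := Xp.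
  have [pdl|pdl] := eqVneq (1 - normc p) dl.
    left; apply: Fle; rewrite nF.
    have gNp : N <= normc (g p) by apply: (gN t) => //; lra.
    have N2 : N ^+ 2 <= normc (g p) ^+ 2 by rewrite ler_sqr ?nnegrE ?normc_ge0 // ltW.
    have N20 : 0 < N ^+ 2 by rewrite exprn_gt0.
    apply: (@le_trans _ _ (normc (g p) ^+ 2)^-1).
      rewrite ler_piMl ?invr_ge0 ?sqr_ge0 // exprn_ile1 ?sqr_ge0 //.
      by rewrite exprn_ile1.
    rewrite lef_pV2 ?posrE //; first exact: le_trans N2.
    exact: lt_le_trans N2.
  (* If no point of K satisfies the aperture condition strictly, p lies on a sloping side and
     [tent_sum] applies. *)
  have [[s Ks ps]|nos] := pselect (exists2 s, K s & normc (p - cp s) < 4 * (1 - normc p)); last first.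
    left; apply: (Fge1 p (1 + q0)^-1) => //; last by rewrite /th exprVn.
    have Sq : q0 <= S p.
      apply: tent_sum => //; [by apply/andP|by exists t|right=> s Ks].
      by rewrite leNgt; apply/negP => ps; apply: nos; exists s.
    rewrite -[leRHS]mul1r ler_pdivlMr; last lra.
    by apply: le_trans B2; rewrite ler_wpM2l ?sqr_ge0 // lerD2l.
  have [prho|prho] := eqVneq (1 - normc p) rho.
    left; apply: (Fge1 p (1 + q0)^-1) => //; last by rewrite /th exprVn.
    have Sq : q0 <= S p.
      by apply: tent_sum => //; [by apply/andP|exists t|left].
    rewrite -[leRHS]mul1r ler_pdivlMr; last lra.
    by apply: le_trans B2; rewrite ler_wpM2l ?sqr_ge0 // lerD2l.
  right.
  have p2 : 0 < (1 - normc p) - dl by rewrite subr_gt0 lt_neqAle eq_sym pdl.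
  have p3 : 0 < rho - (1 - normc p) by rewrite subr_gt0 lt_neqAle prho.
  have p4 : 0 < 4 * (1 - normc p) - normc (p - cp s) by rewrite subr_gt0.
  (* A move by r lowers 4 (1 - |p|) by at most 4 r and raises the distance to [cp s] by at most r,
     hence the division by 5. *)
  pose r := Num.min ((1 - normc p) - dl) (Num.min (rho - (1 - normc p))
    ((4 * (1 - normc p) - normc (p - cp s)) / 5)).
  exists r; first by rewrite !lt_min p2 p3 divr_gt0.
  have sub w : cball p r w -> X w.
    rewrite /cball /= !le_min => /andP[w1 /andP[w2 w3]].
    have := normc_ler_sub p w; have := normc_ler_sub w p; rewrite (normcBC p w) => w4 w5.
    split; first by apply/andP; split; lra.
    by exists s => //; have := normc_triangle p w (cp s); lra.
  by split=> // w /sub; exact: Fd.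
move=> Fz0.
have : normc (F z0) ^+ 2 <= th.
  rewrite -(sqr_sqrtr (ltW th0)) ler_sqr ?nnegrE ?sqrtr_ge0 ?normc_ge0 //.
rewrite nF ler_pdivrMr ?exprn_gt0 ?normc_gt0 ?gn0 // /th => hF.
have [_ _ B3] := Bb z0 (X1 _ z0X).
have Sz := center_sum hsum.
have B4 : 1 - q0 / 2 <= normc (B z0) ^+ 2 by apply: le_trans B3; rewrite -/z0 in Sz; lra.
have B5 : (1 - q0 / 2) ^+ m <= (normc (B z0) ^+ 2) ^+ m.
  by apply: lerXn2r => //; rewrite nnegrE ?sqr_ge0 //; lra.
rewrite exprMn -ler_pdivlMr //; apply: (le_trans B5); apply: (le_trans hF).
by rewrite mulrC.
Qed.

End Estimate.
End Sawtooth.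

(** * Density points and the null set of blow-up points *)

Section AngularBlowup.
Context {R : realType}.
Local Notation C := (R[i]^o).
Local Notation cp := (@circle_point R).
Local Notation mu := (@lebesgue_measure R).
Implicit Types (s t x y h : R) (z w : C) (A K : set R).

Lemma lebesgue_measureS A K : measurable A -> measurable K -> A `<=` K -> (mu A <= mu K)%E.
Proof. by move=> mA mK AK; apply: le_measure; rewrite ?inE. Qed.

(** The half-open cells are disjoint; by induction, the part of A to the left of the n-th grid point
    has at least the measure of the cells counted so far. *)
Lemma sum_cells_le A x0 h (c : R) n (P : pred nat) : measurable A -> 0 < h ->
  (forall k, P k -> `[x0 + k%:R * h, x0 + k%:R * h + h[%classic `<=` A) ->
  (mu A <= c%:E)%E -> \sum_(0 <= k < n | P k) h <= c.
Proof.
move=> mA h0 PA Ac; rewrite -lee_fin; apply: le_trans Ac.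
pose B k : set R := A `&` `]-oo, x0 + k%:R * h[%classic.
have mB k : measurable (B k) by exact: measurableI.
have BS k : B k `<=` B k.+1.
  move=> t [At]; rewrite /= !in_itv /= => tk; split => //; rewrite /= in_itv /=.
  by apply: (lt_le_trans tk); rewrite lerD2l ler_pM2r // ler_nat.
suff H : ((\sum_(0 <= k < n | P k) h)%:E <= mu (B n))%E.
  apply: le_trans H _; apply: lebesgue_measureS => //; by move=> t [].
elim: n => [|n IH]; first by rewrite big_geq.
rewrite big_mkcond big_nat_recr //= -big_mkcond; case: ifPn => Pn; last first.
  rewrite addr0; apply: le_trans IH _; apply: lebesgue_measureS; [exact: mB|exact: mB|exact: BS].
have cell : mu `[x0 + n%:R * h, x0 + n%:R * h + h[%classic = h%:E.
  rewrite lebesgue_measure_itv /= lte_fin ltrDl h0 -EFinB; congr (_%:E); ring.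
apply: (@le_trans _ _ (mu (B n `|` `[x0 + n%:R * h, x0 + n%:R * h + h[%classic))).
  rewrite measureU //=.
  - by rewrite cell EFinD leeD2r.
  - exact: mB.
  apply/seteqP; split => t //= -[[_]]; rewrite !in_itv /= => h1 /andP[h2 _].
  by have := lt_le_trans h1 h2; rewrite ltxx.
apply: lebesgue_measureS => //; first by apply: measurableU => //; exact: mB.
move=> t [/BS //|tn]; split; first exact: (PA n Pn).
move: tn; rewrite /= !in_itv /= => /andP[_ h2]; apply: (lt_le_trans h2).
by rewrite -addrA lerD2l -natr1 mulrDl mul1r.
Qed.

Lemma density_defect A x (e r1 : R) : measurable A -> 0 < e -> 0 < r1 ->
  (mu (A `&` ball x r) / mu (ball x r))%E @[r --> 0^'+] --> 1%E ->
  exists2 r : R, 0 < r <= r1 & (mu (ball x r `\` A) <= (e * r)%:E)%E.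
Proof.
move=> mA e0 r10 lim.
(* The ball has measure 2 r, so density above 1 - e/2 leaves a deficit below e r. *)
have e1 : ((1 - e / 2)%:E < 1%E :> \bar R)%E by rewrite lte_fin; lra.
have near1 : \forall r \near 0^'+,
    ((1 - e / 2)%:E < mu (A `&` ball x r) / mu (ball x r))%E := lim _ (open_ereal_gt' e1).
have := filter_ex (filterI near1 (filterI (nbhs_right_gt 0) (nbhs_right_lt r10))).
move=> [r [hr [r0 rr1]]]; exists r; first by rewrite r0 ltW.
have mb : measurable (ball x r) by exact: measurable_realfun.measurable_ball.
have bl : mu (ball x r) = (r *+ 2)%:E by rewrite lebesgue_measure_ball // ltW.
have fb : (mu (ball x r) < +oo)%E by rewrite bl ltry.
have fA : (mu (A `&` ball x r) \is a fin_num).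
  rewrite ge0_fin_numE ?measure_ge0 //; apply: le_lt_trans fb.
  by apply: lebesgue_measureS => //; exact: measurableI.
have -> : mu (ball x r `\` A) = (mu (ball x r) - mu (A `&` ball x r))%E.
  by rewrite (setIC A); exact: measureD.
move: hr; rewrite bl.
rewrite -(fineK fA); set a := fine _.
have r20 : 0 < r *+ 2 by rewrite mulrn_wgt0.
rewrite inver (gt_eqF r20) -EFinM lte_fin ltr_pdivlMr // -EFinB lee_fin -(mulr_natr r); lra.
Qed.

Definition horn_ge (g : C -> C) (N d : R) : set R := [set t | forall z : C, normc z < 1 ->
  normc (z - cp t) < 5 * (1 - normc z) -> 1 - normc z < d -> N <= normc (g z)].

(** A point z in the open horn at t is also in the horn at every nearby s. So [horn_ge] is closed,
    which gives both its measurability and the closedness of K. *)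
Lemma horn_ge_adherent g N d t :
  (forall e : R, 0 < e -> exists2 s, horn_ge g N d s & `|s - t| < e) -> horn_ge g N d t.
Proof.
move=> ht z z1 zt zd.
have e0 : 0 < (5 * (1 - normc z) - normc (z - cp t)) / 2 by rewrite divr_gt0 // subr_gt0.
have [s hs st] := ht _ e0; apply: hs => //.
have h1 := normc_triangle (cp t) z (cp s); have h2 := normcBC (cp s) (cp t).
have := dist_cp_le s t; lra.
Qed.

Lemma horn_ge_measurable g N d : measurable (horn_ge g N d).
Proof.
apply: measurable_realfun.closed_measurable => t ht; apply: horn_ge_adherent => e e0.
have [s [hs st]] := ht (ball t e) (nbhsx_ballx t e e0).
by exists s => //; rewrite distrC.
Qed.

Lemma horn_geS g (N d d' : R) : d <= d' -> horn_ge g N d' `<=` horn_ge g N d.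
Proof. by move=> dd t ht z z1 zt zd; apply: ht => //; exact: lt_le_trans dd. Qed.

Section Density.
Variables (g : C -> C) (c1 : R).
Hypotheses (c10 : 0 < c1) (c11 : c1 <= 1).
Hypothesis polar : forall (xi : C) t, normc xi = 1 -> normc (xi - cp t) < c1 ->
  exists2 s, xi = cp s & c1 * `|s - t| <= normc (xi - cp t).
Hypothesis denom_ge : forall s t h y, `|s - t| <= 1 -> 0 <= h <= 1 / 2 -> 0 <= y <= 1 / 2 ->
  c1 * `|s - t| / 4 <= normc (1 - (node h s)^* * node y t).
Hypothesis dg : disk_holo g.

Let E (n j : nat) := horn_ge g n%:R (j.+1%:R^-1).

Lemma horn_geSn n j k : (j <= k)%N -> E n j `<=` E n k.
Proof. by move=> jk; apply: horn_geS; rewrite lef_pV2 ?posrE // ler_nat. Qed.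

(* The left-hand side is unbounded in [m], while the right-hand side does not depend on
   it: this is the contradiction. *)
Lemma blowup_power_bound A x (rho : R) j1 m : measurable A -> 0 < rho -> rho <= c1 / 8 ->
  rho < j1.+1%:R^-1 -> A `<=` E 1 j1 -> (forall n, A `<=` \bigcup_j E n j) ->
  (mu (ball x rho `\` A) <= (eps c1 / 2 * rho)%:E)%E ->
  ((1 - q0 / 2) * (1 + q0)) ^+ m <= normc (g (node (kap c1 * rho) x)) ^+ 2.
Proof.
move=> mA rho0 rho1 rhoj A1 AN hA.
have k0 : 0 < kap c1 by exact: kap_gt0.
have k1 : kap c1 <= 1 / 2 by exact: kap_le.
have q00 : 0 < (q0 : R) := q0_gt0.
have q01 : (q0 : R) <= 1 / 2 := q0_le.
have e0 : 0 < eps c1 by rewrite /eps divr_gt0 // mulr_gt0.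
have l0 : 8 <= lam c1 by exact: lam_ge8.
have mE n j : measurable (E n j) by exact: horn_ge_measurable.
have mb : measurable (ball x rho) by exact: measurable_realfun.measurable_ball.
pose n := (Num.truncn ((1 + q0 : R) ^+ m)).+1.
have N1 : 1 <= n%:R :> R by rewrite ler1n.
have Nm : (1 + q0 : R) ^+ m <= n%:R ^+ 2.
  have := truncnS_gt ((1 + q0 : R) ^+ m); rewrite -/n => h1; nra.
pose D j := (A `&` ball x rho) `\` E n j.
have mD j : measurable (D j) by apply: measurableD => //; exact: measurableI.
have [j hj] : exists j, (mu (D j) <= (eps c1 / 2 * rho)%:E)%E.
  (* Every point of A lies in some [E n j], so the decreasing sets [D j] have empty intersection,
     and by continuity of the measure one of them is small. *)
  have D0 : \bigcap_j D j = set0.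
    apply/seteqP; split => // t ht; have [[At _] _] := ht 0%N I.
    by have [j _ Ej] := AN n t At; have [_ ] := ht j I.
  have fD : (mu (D 0%N) < +oo)%E.
    apply: (@le_lt_trans _ _ (mu (ball x rho))).
      by apply: lebesgue_measureS => // => t [[]].
    by rewrite lebesgue_measure_ball ?ltry // ltW.
  have dD : {homo D : i j / (i <= j)%N >-> (j <= i)%O}.
    move=> i j ij; apply/subsetPset => t [At nt]; split => // ?; apply: nt.
    exact: horn_geSn ij _ _.
  have mD0 : measurable (\bigcap_j D j) by rewrite D0.
  have lim := nonincreasing_cvg_mu (mu := mu) fD mD mD0 dD.
  have lim0 : (mu \o D) j @[j --> \oo] --> 0%E by move: lim; rewrite D0 measure0.
  have e20 : (0%E < (eps c1 / 2 * rho)%:E)%E by rewrite lte_fin mulr_gt0 // divr_gt0.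
  have nr : \forall j \near \oo, (mu (D j) < (eps c1 / 2 * rho)%:E)%E.
    exact: lim0 _ (open_ereal_lt' e20).
  by have [j hj] := filter_ex nr; exists j; exact: ltW.
pose K : set R := [set t | `|t - x| <= rho /\ E 1 j1 t /\ E n j t].
have BK : ball x rho `\` K `<=` (ball x rho `\` A) `|` D j.
  move=> t [Bt nK]; case: (pselect (A t)) => At; last by left.
  right; split => // Et; apply: nK; split; last by split => //; exact: A1.
  by rewrite distrC ltW.
have mK : measurable K.
  have -> : K = `[x - rho, x + rho]%classic `&` (E 1 j1 `&` E n j).
    by apply/seteqP; split => t [h1 h2]; split => //; move: h1; rewrite /= in_itv /= ler_distl.
  by apply: measurableI => //; exact: measurableI.
have mBK : (mu (ball x rho `\` K) <= (eps c1 * rho)%:E)%E.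
  apply: (@le_trans _ _ (mu ((ball x rho `\` A) `|` D j))).
    apply: lebesgue_measureS => //; first exact: measurableD.
    by apply: measurableU => //; exact: measurableD.
  apply: le_trans (measureU2 _ _ _) _; [exact: measurableD|exact: mD|].
  have -> : eps c1 * rho = eps c1 / 2 * rho + eps c1 / 2 * rho by lra.
  by rewrite EFinD leeD.
(* Otherwise the ball of radius kap rho, of measure 2 kap rho, would miss K, although the missing
   part has measure at most eps rho with eps = kap q0 / 16. *)
have [t0 Kt0 t0x] : exists2 t0, K t0 & `|t0 - x| <= kap c1 * rho.
  apply: contrapT => nK.
  have sub : ball x (kap c1 * rho) `<=` ball x rho `\` K.
    move=> t; rewrite /ball /= => ht; split; first by apply: (lt_le_trans ht); nra.
    by move=> Kt; apply: nK; exists t => //; rewrite distrC ltW.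
  have kr0 : 0 < kap c1 * rho by rewrite mulr_gt0.
  have : (mu (ball x (kap c1 * rho)) <= (eps c1 * rho)%:E)%E.
    apply: le_trans mBK; apply: lebesgue_measureS => //.
      exact: measurable_realfun.measurable_ball.
    exact: measurableD.
  rewrite lebesgue_measure_ball ?(ltW kr0) // lee_fin -mulr_natr /eps; nra.
have kr0 : 0 < kap c1 * rho by rewrite mulr_gt0.
have [dl [dl0 dlk dlj]] : exists dl : R, [/\ 0 < dl, dl < kap c1 * rho & dl < j.+1%:R^-1].
  have : 0 < j.+1%:R^-1 :> R by rewrite invr_gt0.
  set q := _^-1 => q1; exists (Num.min (kap c1 * rho) q / 2).
  have m0 : 0 < Num.min (kap c1 * rho) q by rewrite lt_min kr0.
  have mk : Num.min (kap c1 * rho) q <= kap c1 * rho by rewrite ge_min lexx.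
  have mj : Num.min (kap c1 * rho) q <= q by rewrite ge_min lexx orbT.
  split; lra.
(* Enough cells on a grid of length 2 lam rho to have h <= dl / 8. *)
pose p := (Num.truncn (16 * lam c1 * rho / dl)).+1.
have p0 : 0 < p%:R :> R by rewrite ltr0n.
pose h := 2 * lam c1 * rho / p%:R.
have l1 : 0 < lam c1 by apply: lt_le_trans l0.
have L0 : 0 < 2 * lam c1 * rho by rewrite mulr_gt0 // mulr_gt0.
have h0 : 0 < h by rewrite divr_gt0.
have ph : p%:R * h = 2 * lam c1 * rho by rewrite /h; field; rewrite gt_eqF.
have hdl : h <= dl / 8.
  have := truncnS_gt (16 * lam c1 * rho / dl); rewrite -/p ltr_pdivrMr // => hp.
  rewrite /h ler_pdivrMr //; lra.
apply: (@sawtooth_estimate R c1 c10 c11 polar denom_ge x rho dl h p K rho0 rho1 dl0 dlk h0 hdl ph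
  _ g n%:R m t0 _ Kt0 t0x dg _ _ _ Nm).
- by move=> t [].
- move=> t ht; split; last split.
  + rewrite leNgt; apply/negP; rewrite -subr_gt0 => /ht[s [sx _] st].
    by have := ler_distD s t x; rewrite (distrC t s); lra.
  + by apply: horn_ge_adherent => e /ht[s [_ [Es _]] st]; exists s.
  + by apply: horn_ge_adherent => e /ht[s [_ [_ Es]] st]; exists s.
- move=> t z [_ [Et _]] z1 zt zr; apply: (Et z z1 zt); exact: le_lt_trans rhoj.
- move=> t z [_ [_ Et]] z1 zt zr; apply: (Et z z1 zt); exact: le_lt_trans dlj.
- by rewrite ltr0n.
apply: (@sum_cells_le (ball x rho `\` K) (x - lam c1 * rho)) => //; first exact: measurableD.
move=> k /andP[/asboolP free /andP[k1' k2']] s; rewrite /= in_itv /= => /andP[s1 s2].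
split; last by apply: free; rewrite s1.
by rewrite /ball /= distrC ltr_distl; apply/andP; split; [exact: lt_le_trans s1|exact: lt_le_trans k2'].
Qed.

(** Density fixes rho, hence the point where g is evaluated, before m varies. All powers of (1 -
    q0/2)(1 + q0) are then bounded, although this number exceeds 1 as 0 < q0 < 1. *)
Lemma blowup_density A x j1 : measurable A -> A `<=` E 1 j1 ->
  (forall n, A `<=` \bigcup_j E n j) ->
  (mu (A `&` ball x r) / mu (ball x r))%E @[r --> 0^'+] --> 1%E -> False.
Proof.
move=> mA A1 AN lim.
have q00 : 0 < (q0 : R) := q0_gt0.
have q01 : (q0 : R) <= 1 / 2 := q0_le.
have k0 : 0 < kap c1 by exact: kap_gt0.
have e0 : 0 < eps c1 / 2 by rewrite divr_gt0 // /eps divr_gt0 // mulr_gt0.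
have jV : 0 < j1.+1%:R^-1 :> R by rewrite invr_gt0.
pose r1 := Num.min (c1 / 8) (j1.+1%:R^-1 / 2).
have r10 : 0 < r1 by rewrite lt_min !divr_gt0.
have [rho /andP[rho0 rhor] hrho] := density_defect mA e0 r10 lim.
have : (1 - q0 / 2) * (1 + q0) <= (1 : R).
  apply: (@bounded_powers_le1 _ _ (normc (g (node (kap c1 * rho) x)) ^+ 2)) => m.
  apply: (@blowup_power_bound A x rho j1) => //.
    by apply: (le_trans rhor); rewrite ge_min lexx.
  apply: (le_lt_trans rhor); rewrite /r1 gt_min; apply/orP; right.
  by move: jV; set q := _^-1 => q1; lra.
by nra.
Qed.

(** A blow-up point lies in some [E n j] for each n. Intersecting with [E 1 j] makes the height
    below which |g| >= 1 uniform; each of these countably many measurable sets is null since almost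
    all its points would be density points. *)
Lemma blowup_negligible : {ae mu, forall t, ~ angular_blowup g (cp t) 5}.
Proof.
have mE n j : measurable (E n j) by exact: horn_ge_measurable.
pose G : set R := \bigcap_n \bigcup_j E n j.
have mG : measurable G.
  by apply: bigcap_measurableType => n _; apply: bigcup_measurable => j _.
suff : mu.-negligible (\bigcup_j (G `&` E 1 j)).
  apply: negligibleS.
  move=> t /contrapT ht.
  have Gt n : (\bigcup_j E n j) t.
    (* In a horn of aperture 5, heights below d / 5 put z within d of [cp t]. *)
    have [d d0 hd] := ht n%:R; exists (Num.truncn (5 / d)) => //.
    move=> z z1 zt; rewrite -[X in _ < X]mul1r ltr_pdivlMr // => zd; apply: hd => //.
    have := truncnS_gt (5 / d); rewrite ltr_pdivrMr // => h5.
    have z0 : 0 < 1 - normc z by lra.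
    apply: (lt_le_trans zt); nra.
  by have [j _ Ej] := Gt 1%N; exists j => //; split.
apply: negligible_bigcup => j.
have mGj : measurable (G `&` E 1 j) by exact: measurableI.
apply: negligibleS (lebesgue_density mGj) => t Gt lim.
apply: (@blowup_density (G `&` E 1 j) t j) => //.
- by move=> n s [Gs _]; exact: Gs.
- by move: lim => /=; rewrite indicE mem_set.
Qed.

End Density.
End AngularBlowup.

(** * Transfer to the circle and the equivalence *)

Section CircleReduction.
Context {R : realType}.
Local Notation C := (R[i]^o).
Local Notation cp := (@circle_point R).
Local Notation mu := (@lebesgue_measure R).
Implicit Types f : C -> C.

Lemma analytic_self_mapP f : analytic_self_map f ->
  disk_holo f /\ (forall z : C, normc z < 1 -> normc (f z) < 1).
Proof.
move=> [fa fs]; split=> z /unit_diskE z1; last exact/unit_diskE/fs.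
by exists (derive1 f z); apply: derivable_cdiff; exact: fa.
Qed.

Lemma disk_holo_derive1 f : disk_holo f -> disk_holo (derive1 f).
Proof.
move=> df z z1; apply: (@cderivable_derive1 _ f z ((1 - normc z) / 2)).
  by rewrite divr_gt0 // subr_gt0.
move=> w wz; apply: df; rewrite /cball /= in wz.
have := normc_ler_sub w z; lra.
Qed.

Lemma ae_not_blowup f : disk_holo f ->
  {ae mu, forall t, ~ angular_blowup (derive1 f) (cp t) 5}.
Proof.
move=> /disk_holo_derive1 dg; apply: (@blowup_negligible _ _ (cos 1)) => //.
- exact: cos1_gt0.
- exact: polar_near.
- exact: pick_denom_cp_ge.
Qed.

Lemma ae_circle_impl2 (P S : C -> Prop) (Q : R -> Prop) :
  (forall t : R, P (cp t) -> Q t -> S (cp t)) ->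
  ae_circle P -> {ae mu, forall t : R, Q t} -> ae_circle S.
Proof.
rewrite /ae_circle => PQS hP hQ.
have flt := @ae_filter_ringOfSetsType _ _ _ mu.
by apply: filterS2 hP hQ => t Pt Qt /Pt Ps; exact: PQS.
Qed.

End CircleReduction.

Theorem corollary1p4 (R : realType) (f : R[i]^o -> R[i]^o)
    (hf : analytic_self_map f) :
  ae_circle (fun zeta : R[i]^o =>
    angular_limit
      (fun z : R[i]^o => (1 - `|z| ^+ 2) * (`|derive1 f z| / (1 - `|f z| ^+ 2)))
      zeta 1)
  <->
  (inner_function f /\
   ae_circle (fun zeta : R[i]^o => has_finite_angular_derivative f zeta)).
Proof.
have [df fs] := analytic_self_mapP hf.
have -> : (fun z : R[i]^o => (1 - `|z| ^+ 2) * (`|derive1 f z| / (1 - `|f z| ^+ 2))) =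
    (fun z => (distortion f z)%:C) by apply/funext => z; exact: distortionE.
have julia_case t K : 0 < K -> julia_hyp f (circle_point t) K -> _ :=
  distortion_limit df fs (normc_cp t).
split=> [lim | [_]].
  have key t : angular_limit (fun z => (distortion f z)%:C) (circle_point t) 1 ->
      ~ angular_blowup (derive1 f) (circle_point t) 5 ->
      has_finite_angular_derivative f (circle_point t) /\
      exists2 om, unit_circle om & angular_limit f (circle_point t) om.
    move=> tl tb; have [|K K0 hK] := distortion_julia _ fs tl tb; first lra.
    by have [] := julia_case _ _ K0 hK.
  split; last first.
    by apply: ae_circle_impl2 lim (ae_not_blowup df) => t h1 h2; have [] := key t h1 h2.
  split; first exact: hf.
  by apply: ae_circle_impl2 lim (ae_not_blowup df) => t h1 h2; have [] := key t h1 h2.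
have flt := @ae_filter_ringOfSetsType _ _ _ (@lebesgue_measure R).
rewrite /ae_circle; apply: filterS => t ht /ht.
move=> /(finite_angular_derivative_julia fs (normc_cp t))[K K0 hK].
by have [] := julia_case _ _ K0 hK.
Qed.
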